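(* For i.i.d. real random variables $X_1,X_2,\ldots$ let $S_i=X_1+\cdots+X_i$, $S_n^{(2)}=S_1+\cdots+S_n$ and $p_n^{(2)}=\mathbb{P}\left(\max_{1\le k\le n}S_k^{(2)}<0\right)$ for $n\ge 1$. (i) Suppose $X_1$ is not almost surely zero, $\mathbb{E}X_1=0$, $\mathbb{E}X_1^2<\infty$, and there exist constants $r>0$, $\theta>1/r$ and finite $K,L$ such that for all $t>0$, $s>0$, $$\mathbb{P}(-X_1>t+s)\le K\,\mathbb{P}(-X_1>t)\,\mathbb{P}(-X_1>s)+L\,[\mathbb{P}(-X_1>r)]^{\theta(t+s)}.$$ Then $p_n^{(2)}\asymp n^{-1/4}$. (ii) In contrast, for any $0<\gamma<1/4$ there exists an integrable, zero-mean random variable $X_1$ such that, for i.i.d. copies $X_1,X_2,\ldots$ of it, $p_n^{(2)}\asymp n^{-\gamma}$.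
   Context: For positive sequences, $a_n\asymp b_n$ means that there are constants $0<C_1\le C_2<\infty$, not depending on $n$, with $C_1 b_n\le a_n\le C_2 b_n$ for all $n\ge 1$. *)

(* Defs.v *)
From HB Require Import structures.
From mathcomp Require Import all_boot all_order all_algebra.
From mathcomp Require Import all_classical all_reals all_analysis.

Set Implicit Arguments.
Unset Strict Implicit.
Unset Printing Implicit Defensive.

Import Order.TTheory GRing.Theory Num.Theory.
Import numFieldNormedType.Exports.

Local Open Scope classical_set_scope.
Local Open Scope ring_scope.

(* The random variables X_1, X_2, ... are indexed from 0 throughout:
   [X i] stands for X_{i+1}. *)

Definition same_law d (T : measurableType d) d' (T' : measurableType d')
    (R : realType) (P : probability T R) (P' : probability T' R)
    (X : {RV P >-> R}) (Y : {RV P' >-> R}) : Prop :=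
  forall B : set R, measurable B -> distribution P X B = distribution P' Y B.

(* Mutual independence: the product rule on every finite subfamily. *)
Definition independent_RVs d (T : measurableType d) (R : realType)
    (P : probability T R) (X : nat -> {RV P >-> R}) : Prop :=
  forall (J : seq nat) (B : nat -> set R),
    uniq J -> (forall i, i \in J -> measurable (B i)) ->
    P (\bigcap_(i in [set` J]) (X i @^-1` B i)) =
    (\prod_(i <- J) P (X i @^-1` B i))%E.

Definition iid d (T : measurableType d) (R : realType)
    (P : probability T R) (X : nat -> {RV P >-> R}) : Prop :=
  independent_RVs X /\ forall i, same_law (X i) (X 0%N).

(* S_k = X_1 + ... + X_k *)
Definition psum (T : Type) (R : realType) (X : nat -> T -> R) (k : nat)
    (w : T) : R := \sum_(0 <= j < k) X j w.

(* S^(2)_k = S_1 + ... + S_k *)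
Definition ipsum (T : Type) (R : realType) (X : nat -> T -> R) (k : nat)
    (w : T) : R := \sum_(1 <= i < k.+1) psum X i w.

(* The default value S^(2)_1 belongs to the range of the maximum as soon as
   n >= 1; the value at n = 0 is irrelevant. *)
Definition persist2 d (T : measurableType d) (R : realType)
    (P : probability T R) (X : nat -> {RV P >-> R}) (n : nat) : R :=
  fine (P [set w | \big[Num.max/ipsum X 1 w]_(1 <= k < n.+1) ipsum X k w < 0]).

(* P(-X > t) *)
Definition ltail d (T : measurableType d) (R : realType)
    (P : probability T R) (X : {RV P >-> R}) (t : R) : R :=
  fine (P [set w | t < - X w]).

Definition asymp_equiv (R : realType) (a b : nat -> R) : Prop :=
  exists C1 C2 : R, [/\ 0 < C1, C1 <= C2 &
    forall n : nat, (1 <= n)%N -> C1 * b n <= a n <= C2 * b n].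

(* Main.v *)
Require Import Defs.
From HB Require Import structures.
From mathcomp Require Import all_boot all_order all_algebra.
From mathcomp Require Import all_classical all_reals all_analysis.
From mathcomp Require Import measurable_realfun.
From mathcomp Require Import ring lra zify.

Set Implicit Arguments.
Unset Strict Implicit.
Unset Printing Implicit Defensive.

Import Order.TTheory GRing.Theory Num.Theory.
Import numFieldNormedType.Exports.

Local Open Scope classical_set_scope.
Local Open Scope ring_scope.

(** Let A_k be the integrated walk S^(2)_k and consider the least concave
majorant of A on {0, ..., n+1}. The slopes of the lines supporting it at an
inner vertex k form an interval of length (-X_k - M - M')^+, where M and M'
are the maxima of A_m / (m+1) for the integrated walks started from k in both
directions of time: they are nonnegative, independent of each other and of
X_k, and vanish with probabilities F(n-k) and F(k-1), where
F(a) = P(A_1, ..., A_a <= 0). These intervals have disjoint interiors, lie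
between the extreme values of S, and cover the slopes between S_{n+1} and S_1.
So the sum over k of the mean lengths is bounded above by the mean range of S
and below by E|S_n| / 2. The mean length at k is at least E[X^-] F(n-k) F(k-1),
and the tail condition on X^- provides the matching upper bound up to a
constant. Once E|S_n| and the mean range are both of order n^(1-2 gamma), this
gives sum_k F(n-k) F(k-1) of order n^(1-2 gamma), and the monotonicity of F
turns this into F(n) of order n^(-gamma), which is also the order of p_n.

In (i), gamma = 1/4 by the Doob and Khinchine inequalities. In (ii), take
X bounded below, with the value 2^((1-2 gamma) k) with probability 2^(-k-1) for
k >= 1. *)

(** * Paths and their concave majorants *)

(** The integrated walk is not Markov. The majorant helps because at each of its vertices two
    persistence events, one forwards and one backwards in time, occur together and independently,
    while the total length of the slope intervals is controlled by the walk [S] alone. The order of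
    the range of [S] is thus shared between two factors F: n products adding up to n^(1/2) force F
    to be of order n^(-1/4). The obstacle is the upper bound on the mean gap. A very negative
    increment can open a gap although M and M' are positive, so the gap is not confined to the event
    that both vanish. The tail condition makes the mean overshoot of -X_k over M + M' at most a
    function of M times the same function of M'. The mean of P(-X > M) is itself a persistence
    probability, since M < -X says that the integrated walk stays negative once X is put in front.
    The inequality theta > 1/r makes the error term as small as this main term. *)

Section paths.
Variable R : realType.
Implicit Types (x y : nat -> R) (k m n a : nat).

Definition wsum x k : R := \sum_(0 <= j < k) x j.

Definition area x k : R := \sum_(1 <= i < k.+1) wsum x i.

(** This is the maximum of A_m / (m+1) over 0 <= m <= a. An increment put in front of the path
    enters A_{m+1} with weight m+1 ([area_head]), so dividing by m+1 gives the threshold which that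
    increment has to beat. *)
Fixpoint mslope x a : R :=
  if a is m.+1 then Num.max (mslope x m) (area x a / a.+1%:R) else 0.

Lemma wsum0 x : wsum x 0 = 0. Proof. by rewrite /wsum big_geq. Qed.

Lemma wsumS x k : wsum x k.+1 = wsum x k + x k.
Proof. by rewrite /wsum big_nat_recr. Qed.

Lemma area0 x : area x 0 = 0. Proof. by rewrite /area big_geq. Qed.

Lemma areaS x k : area x k.+1 = area x k + wsum x k.+1.
Proof. by rewrite /area big_nat_recr. Qed.

Lemma eq_wsum x y k : (forall i, (i < k)%N -> x i = y i) -> wsum x k = wsum y k.
Proof.
by move=> xy; rewrite /wsum; apply: eq_big_nat => i /andP[_ ik]; apply: xy.
Qed.

Lemma eq_area x y k : (forall i, (i < k)%N -> x i = y i) -> area x k = area y k.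
Proof.
elim: k => [_|k IH xy]; first by rewrite !area0.
rewrite !areaS (eq_wsum xy) IH// => i ik; apply: xy; lia.
Qed.

Lemma eq_mslope x y a :
  (forall i, (i < a)%N -> x i = y i) -> mslope x a = mslope y a.
Proof.
elim: a => [//|a IH] xy; rewrite /= (eq_area xy) IH// => i ik; apply: xy; lia.
Qed.

Lemma wsum_shift x k m :
  wsum x (k + m) = wsum x k + wsum (fun i => x (k + i)%N) m.
Proof.
elim: m => [|m IH]; first by rewrite addn0 wsum0 addr0.
by rewrite addnS !wsumS IH addrA.
Qed.

Lemma area_shift x k m :
  area x (k + m) = area x k + m%:R * wsum x k + area (fun i => x (k + i)%N) m.
Proof.
elim: m => [|m IH]; first by rewrite addn0 area0; ring.
rewrite addnS !areaS IH -addnS wsum_shift -natr1; ring.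
Qed.

Lemma area_head x m :
  area x m.+1 = m.+1%:R * x 0%N + area (fun i => x i.+1) m.
Proof.
rewrite -(add1n m) area_shift areaS area0 wsumS wsum0 -natr1.
rewrite (_ : (fun i => x (1 + i)%N) = (fun i => x i.+1)); last first.
  by apply/funext => i; rewrite add1n.
ring.
Qed.

Lemma mslope_ge0 x a : 0 <= mslope x a.
Proof. by elim: a => //= a IH; rewrite le_max IH. Qed.

Lemma mslope_mono x a b : (a <= b)%N -> mslope x a <= mslope x b.
Proof.
elim: b => [|b IH]; first by rewrite leqn0 => /eqP ->.
rewrite leq_eqVlt => /predU1P[->//|]; rewrite ltnS => /IH h.
by rewrite /= le_max h.
Qed.

Lemma mslope_leP x a c :
  mslope x a <= c <-> (forall m, (m <= a)%N -> area x m <= m.+1%:R * c).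
Proof.
elim: a => [|a IH] /=.
  split=> [c0 m|/(_ 0%N)]; last by rewrite area0 mul1r; apply.
  by rewrite leqn0 => /eqP ->; rewrite area0 mul1r.
rewrite ge_max; split.
  move=> /andP[/IH h1 h2] m; rewrite leq_eqVlt => /predU1P[->|].
    by move: h2; rewrite ler_pdivrMr ?ltr0n// mulrC.
  by rewrite ltnS; exact: h1.
move=> h; apply/andP; split; first by apply/IH => m ma; apply: h; lia.
by rewrite ler_pdivrMr ?ltr0n// mulrC; apply: h.
Qed.

Lemma mslope_ltP x a c :
  mslope x a < c <-> (forall m, (m <= a)%N -> area x m < m.+1%:R * c).
Proof.
elim: a => [|a IH] /=.
  split=> [c0 m|/(_ 0%N)]; last by rewrite area0 mul1r; apply.
  by rewrite leqn0 => /eqP ->; rewrite area0 mul1r.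
rewrite gt_max; split.
  move=> /andP[/IH h1 h2] m; rewrite leq_eqVlt => /predU1P[->|].
    by move: h2; rewrite ltr_pdivrMr ?ltr0n// mulrC.
  by rewrite ltnS; exact: h1.
move=> h; apply/andP; split; first by apply/IH => m ma; apply: h; lia.
by rewrite ltr_pdivrMr ?ltr0n// mulrC; apply: h.
Qed.

Lemma area_neg_mslope x n :
  (forall k, (1 <= k < n.+2)%N -> area x k < 0) <->
  mslope (fun i => x i.+1) n < - x 0%N.
Proof.
rewrite mslope_ltP; split => [h m mn|h [//|m] /andP[_ mn]].
  by have := h m.+1 ltac:(lia); rewrite area_head; lra.
by have := h m ltac:(lia); rewrite area_head; lra.
Qed.

(** The first increment is counted m+1 times in A_{m+1}, so every quotient drops by at least r once
    it is included. The condition on [c] takes care of the quotient 0 at m = 0. *)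
Lemma mslope_head_step x a (r c : R) : 0 <= c -> x 0%N <= - r ->
  mslope (fun i => x i.+1) a <= c + r -> mslope x a.+1 <= c.
Proof.
move=> c0 xr /mslope_leP h; apply/mslope_leP => -[_|m]; first by rewrite area0 mul1r.
rewrite ltnS => /h ham; rewrite area_head.
have : m.+1%:R * x 0%N <= m.+1%:R * - r :> R by rewrite ler_wpM2l.
rewrite -(natr1 m.+1); lra.
Qed.

(** * Supporting slopes at the vertices of the majorant *)

Section majorant.
Variables (x : nat -> R) (n : nat).

(** Increment k itself belongs to neither path: [fwd k] reads the increments after it and [bwd k]
    those before it in reversed order. A gap therefore depends on three disjoint blocks of
    increments. *)
Definition fwd k : nat -> R := fun i => x (k.+1 + i)%N.
Definition bwd k : nat -> R := fun i => x (k.-1 - i)%N.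

(** The largest slope of a chord of the area path from k to a later point. Symmetrically, [lslope k]
    is the smallest slope of a chord from an earlier point to k. The next two lemmas state this. *)
Definition rslope k := wsum x k.+1 + mslope (fwd k) (n - k).
Definition lslope k := wsum x k - mslope (bwd k) k.-1.

Lemma rslope_leP k (y : R) : (k <= n)%N ->
  rslope k <= y <-> forall j, (k < j <= n.+1)%N ->
    area x j - area x k <= (j - k)%:R * y.
Proof.
move=> kn.
have aux m : area x (k + m.+1) - area x k =
    m.+1%:R * wsum x k.+1 + area (fwd k) m.
  rewrite area_shift area_head addn0 wsumS.
  rewrite (_ : (fun i => x (k + i.+1)%N) = fwd k); last first.
    by apply/funext => i; rewrite /fwd addSnnS.
  ring.
have -> : (rslope k <= y) = (mslope (fwd k) (n - k) <= y - wsum x k.+1).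
  by rewrite /rslope; apply/idP/idP; lra.
rewrite mslope_leP; split=> [h j /andP[kj jn]|h m mn].
  have -> : j = (k + (j - k).-1.+1)%N by lia.
  rewrite aux addKn; have := h (j - k).-1 ltac:(lia); rewrite mulrBr; lra.
have := h (k + m.+1)%N ltac:(lia); rewrite aux addKn mulrBr; lra.
Qed.

Lemma lslope_geP k (y : R) : (0 < k)%N ->
  y <= lslope k <-> forall j, (j < k)%N ->
    (k - j)%:R * y <= area x k - area x j.
Proof.
move=> k0.
have wb m : (m <= k)%N -> wsum x (k - m) = wsum x k - wsum (bwd k) m.
  elim: m => [_|m IH mk]; first by rewrite subn0 wsum0 subr0.
  have e : (k - m = (k - m.+1).+1)%N by lia.
  move: (IH (ltnW mk)); rewrite e !wsumS /bwd.
  have -> : (k.-1 - m = k - m.+1)%N by lia.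
  lra.
have aux m : (m < k)%N -> area x k - area x (k - m.+1) =
    m.+1%:R * wsum x k - area (bwd k) m.
  elim: m => [_|m IH mk].
    by rewrite subn1 -{1 3}(prednK k0) areaS area0; ring.
  have e : (k - m.+1 = (k - m.+2).+1)%N by lia.
  have := IH ltac:(lia); rewrite {1}e areaS -e wb ?(ltnW mk)// areaS.
  rewrite -(natr1 m.+1); lra.
have -> : (y <= lslope k) = (mslope (bwd k) k.-1 <= wsum x k - y).
  by rewrite /lslope; apply/idP/idP; lra.
rewrite mslope_leP; split=> [h j jk|h m mn].
  have [m mE] : {m | k - j = m.+1}%N by exists (k - j).-1; lia.
  have jE : j = (k - m.+1)%N by lia.
  have := h m ltac:(lia); rewrite mE jE aux; last lia.
  by rewrite mulrBr; lra.
have := h (k - m.+1)%N ltac:(lia); rewrite aux; last lia.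
have -> : (k - (k - m.+1) = m.+1)%N by lia.
rewrite mulrBr; lra.
Qed.

(** Both sides are compared with the slope of the chord from k to k'. *)
Lemma lslope_le_rslope k k' : (k < k' <= n)%N -> lslope k' <= rslope k.
Proof.
move=> kk.
have /(lslope_geP _ (k := k') ltac:(lia)) /(_ k ltac:(lia)) h1 := lexx (lslope k').
have /(rslope_leP _ (k := k) ltac:(lia)) /(_ k' ltac:(lia)) h2 := lexx (rslope k).
have : (k' - k)%:R * lslope k' <= (k' - k)%:R * rslope k by apply: le_trans h1 h2.
by rewrite ler_pM2l// ltr0n; lia.
Qed.

(* The length of the interval [rslope k, lslope k] of slopes of lines
   supporting, at the vertex [k], the least concave majorant of
   [j |-> area x j] on [0, n + 1]. *)
Definition gap k := Num.max 0 (lslope k - rslope k).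

Lemma gapE k : gap k =
  Num.max 0 (- x k - mslope (fwd k) (n - k) - mslope (bwd k) k.-1).
Proof. by rewrite /gap /lslope /rslope wsumS; congr Num.max; ring. Qed.

Lemma gap_ge0 k : 0 <= gap k. Proof. by rewrite le_max lexx. Qed.

Lemma sum_gap_le (lo hi : R) :
  (forall j, (1 <= j <= n.+1)%N -> lo <= wsum x j <= hi) ->
  \sum_(1 <= k < n.+1) gap k <= hi - lo.
Proof.
move=> lohi.
(* Slopes decrease along the majorant. The frontier [r] is the least of [hi] and the right slopes
   met so far: the gaps up to m fit into [r, hi], and all later intervals lie below r. *)
have key m : (m <= n)%N -> exists r, [/\ lo <= r <= hi,
    (forall k, (1 <= k <= m)%N -> r <= rslope k),
    (forall k, (m < k <= n)%N -> lslope k <= r) &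
    \sum_(1 <= k < m.+1) gap k <= hi - r].
  elim: m => [_|m IH mn].
    exists hi; split.
    - by have /andP[? ?] := lohi 1%N isT; rewrite lexx andbT; lra.
    - by move=> k; lia.
    - move=> k kn; have /andP[_] := lohi k ltac:(lia).
      by rewrite /lslope; have := mslope_ge0 (bwd k) k.-1; lra.
    - by rewrite big_geq// subrr.
  have [r [rlh rR lL sm]] := IH (ltnW mn).
  have Rlo : lo <= rslope m.+1.
    have /andP[+ _] := lohi m.+2 ltac:(lia).
    by rewrite /rslope; have := mslope_ge0 (fwd m.+1) (n - m.+1); lra.
  have Lr := lL m.+1 ltac:(lia).
  exists (Num.min r (rslope m.+1)); split.
  - by rewrite le_min Rlo ge_min; case/andP: rlh => -> ->.
  - move=> k /andP[k1]; rewrite leq_eqVlt => /predU1P[->|km].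
      by rewrite ge_min lexx orbT.
    by rewrite ge_min rR//; lia.
  - by move=> k kn; rewrite le_min lL ?lslope_le_rslope//; lia.
  - rewrite big_nat_recr//= /gap.
    by case: (leP 0 (lslope m.+1 - rslope m.+1)); case: (leP r (rslope m.+1)); lra.
have [r [/andP[lr _] _ _ h]] := key n (leqnn n); lra.
Qed.

(* A slope [y] strictly between the last and the first slope of the path is a
   supporting slope of its concave majorant at an interior point: the argmax
   of [area x j - j * y]. *)
Lemma slope_covered (y : R) : wsum x n.+1 < y < x 0%N ->
  exists2 k, (1 <= k <= n)%N & rslope k <= y <= lslope k.
Proof.
move=> /andP[ylo yhi].
pose f (j : 'I_n.+2) := area x j - j%:R * y.
have [k _ kmax] := @arg_maxP _ _ 'I_n.+2 ord0 xpredT f isT.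
have fk j : (j <= n.+1)%N -> area x j - j%:R * y <= area x k - k%:R * y.
  by move=> jn; have := kmax (inord j) isT; rewrite /f inordK.
have k1 : (0 < k)%N.
  rewrite lt0n; apply/eqP => k0; have := fk 1%N isT.
  by rewrite k0 areaS wsumS wsum0 area0; lra.
have kn : (k <= n)%N.
  rewrite -ltnS ltn_neqAle -ltnS ltn_ord andbT; apply/eqP => kE.
  have := fk n (leqnSn n); rewrite kE areaS -natr1; lra.
exists (val k); first by rewrite k1.
apply/andP; split.
  apply/rslope_leP => // j /andP[kj jn].
  have := fk j jn; rewrite natrB ?(ltnW kj)// mulrBl; lra.
apply/lslope_geP => // j jk.
have := fk j (leq_trans (ltnW jk) (leqW kn)).
rewrite natrB ?(ltnW jk)// mulrBl; lra.
Qed.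

(** By [slope_covered] the supporting intervals cover an interval of slopes, and subadditivity of
    Lebesgue measure compares the lengths. A vertex below the majorant contributes an empty interval
    and the gap 0. *)
Lemma sum_gap_ge : x 0%N - wsum x n.+1 <= \sum_(1 <= k < n.+1) gap k.
Proof.
have [le0|gt0] := leP (x 0%N) (wsum x n.+1).
  apply: (@le_trans _ _ 0); first by rewrite subr_le0.
  by apply: sumr_ge0 => k _; apply: gap_ge0.
pose I k : set R := `[rslope k, lslope k]%classic.
have cov : `]wsum x n.+1, x 0%N[%classic `<=` \big[setU/set0]_(k < n) I k.+1.
  move=> y /=; rewrite in_itv /= => /slope_covered[[//|k] kn ky].
  rewrite -(bigcup_mkord n (fun k => I k.+1)); exists k; first by rewrite /=; lia.
  by rewrite /I /= in_itv.
have mI k : measurable (I k) by exact: measurable_itv.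
have /= B1 := @le_measure _ _ _ (@lebesgue_measure R) _ _ _ _ cov.
have B2 := Boole_inequality (@lebesgue_measure R) (n := n) (fun k _ => mI k.+1).
rewrite big_add1 /= big_mkord -lee_fin EFinB.
rewrite lebesgue_measure_itv /= lte_fin gt0 in B1.
apply: (le_trans (B1 _ _)).
- by rewrite inE; exact: measurable_itv.
- by rewrite inE; apply: bigsetU_measurable => k _; exact: mI.
apply: (le_trans B2); rewrite -sumEFin; apply: lee_sum => k _.
rewrite /= /I.
rewrite lebesgue_measure_itv /= /gap; case: ifPn => _.
  by rewrite lee_fin le_max lexx orbT.
by rewrite lee_fin le_max lexx.
Qed.

End majorant.

(** * Running maxima and averages over signs *)

Fixpoint runmax x n : R :=
  if n is m.+1 then Num.max (runmax x m) (wsum x n) else 0.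

Lemma runmax_ge0 x n : 0 <= runmax x n.
Proof. by elim: n => //= n IH; rewrite le_max IH. Qed.

Lemma wsum_le_runmax x n k : (k <= n)%N -> wsum x k <= runmax x n.
Proof.
elim: n => [|n IH]; first by rewrite leqn0 => /eqP ->; rewrite wsum0.
rewrite leq_eqVlt => /predU1P[->|]; first by rewrite le_max lexx orbT.
by rewrite ltnS => /IH h; rewrite le_max h.
Qed.

Lemma eq_runmax x y n :
  (forall i, (i < n)%N -> x i = y i) -> runmax x n = runmax y n.
Proof.
elim: n => [//|n IH] xy; rewrite /= (eq_wsum xy) IH// => i ik; apply: xy; lia.
Qed.

(** Each cross term has the form past times present, so that independence evaluates its mean. *)
Lemma wsum_sqr x n : wsum x n ^+ 2 =
  \sum_(0 <= i < n) x i ^+ 2 + \sum_(0 <= i < n) 2 * wsum x i * x i.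
Proof.
elim: n => [|n IH]; first by rewrite wsum0 !big_geq// expr0n addr0.
by rewrite wsumS !big_nat_recr//= sqrrD IH; ring.
Qed.

(* The pathwise form of Doob's L2 maximal inequality. *)
Lemma runmax_sqr_le x n : runmax x n ^+ 2 <=
  4 * \sum_(0 <= i < n) x i ^+ 2 +
  \sum_(0 <= i < n) (8 * wsum x i - 4 * runmax x i) * x i.
Proof.
(* Summation by parts: the maximum changes only by jumping to the current value of the walk, and
   such a step leaves over half the square of the jump. *)
have key : \sum_(0 <= i < n) runmax x i * x i <=
    runmax x n * wsum x n - runmax x n ^+ 2 / 2.
  elim: n => [|n IH]; first by rewrite big_geq//= mul0r expr0n/=; lra.
  rewrite big_nat_recr//= wsumS.
  have h0 := sqr_ge0 (runmax x n - (wsum x n + x n)).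
  case: (leP (runmax x n) (wsum x n + x n)) => _;
    move: (\sum_(0 <= i < n) _) (runmax x n) (wsum x n) (x n) IH h0;
    by move=> I r w y IH h0; lra.
have -> : \sum_(0 <= i < n) (8 * wsum x i - 4 * runmax x i) * x i =
    4 * (\sum_(0 <= i < n) 2 * wsum x i * x i) -
    4 * (\sum_(0 <= i < n) runmax x i * x i).
  by rewrite !mulr_sumr -sumrB; apply: eq_bigr => i _; ring.
have := wsum_sqr x n; set s := \sum_(0 <= i < n) x i ^+ 2.
set s' := \sum_(0 <= i < n) 2 * _ * _ => e.
have : 0 <= (runmax x n - 2 * wsum x n) ^+ 2 by exact: sqr_ge0.
by nra.
Qed.

(* The average of [f (s +- x_0 +- ... +- x_{n-1})] over all choices of signs. *)
Fixpoint ravg (f : R -> R) x n (s : R) : R :=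
  if n is m.+1 then (ravg f x m (s + x m) + ravg f x m (s - x m)) / 2 else f s.

Lemma ravg_norm_ge0 x n (s : R) : 0 <= ravg Num.norm x n s.
Proof.
elim: n s => [|n IH] s /=; first exact: normr_ge0.
by have := IH (s + x n); have := IH (s - x n); lra.
Qed.

(* [|u| >= u ^ 2 / tau - u ^ 4 / tau ^ 3], averaged over the signs; the fourth
   moment of a sign average is at most the parenthesis on the left. *)
Lemma ravg_norm_ge x n (tau s : R) : 0 < tau ->
  let q := \sum_(0 <= i < n) x i ^+ 2 in
  (s ^+ 2 + q) / tau - (s ^+ 4 + 6 * s ^+ 2 * q + 3 * q ^+ 2) / tau ^+ 3
    <= ravg Num.norm x n s.
Proof.
move=> t0 /=; elim: n s => [|n IH] s.
  rewrite big_geq//= !(addr0, mulr0, expr0n)/=.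
  have -> : s ^+ 2 = `|s| ^+ 2 by rewrite real_normK// num_real.
  have -> : s ^+ 4 = `|s| ^+ 4.
    by rewrite (exprM s 2 2) (exprM _ 2 2) real_normK// num_real.
  set z := `|s|; have z0 : 0 <= z by exact: normr_ge0.
  have -> : z ^+ 2 / tau - z ^+ 4 / tau ^+ 3 =
     z * ((z / tau) * (1 - (z / tau) ^+ 2)) by field; lra.
  have : 0 <= z / tau by apply: divr_ge0 => //; lra.
  set u := z / tau => u0.
  suff : u * (1 - u ^+ 2) <= 1 by move=> h; rewrite ler_piMr.
  have [u1|u1] := leP u 1; first by nra.
  by nra.
rewrite big_nat_recr//=; set q := \sum_(0 <= i < n) _ in IH *.
have h1 := IH (s + x n); have h2 := IH (s - x n).
have q0 : 0 <= q by apply: sumr_ge0 => i _; exact: sqr_ge0.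
set A := ravg _ _ _ _ in h1 *; set B := ravg _ _ _ _ in h2 *.
set y := x n in h1 h2 *.
(* Averaging over the sign of [y] produces the claimed bound up to exactly 2 y^4 / tau^3, which is
   then dropped. *)
have : ((s ^+ 2 + (q + y ^+ 2)) / tau - (s ^+ 4 + 6 * s ^+ 2 * (q + y ^+ 2) +
   3 * (q + y ^+ 2) ^+ 2) / tau ^+ 3) + 2 * y ^+ 4 / tau ^+ 3 <= (A + B) / 2.
  apply: le_trans (_ : _ <= (((s + y) ^+ 2 + q) / tau - ((s + y) ^+ 4 +
    6 * (s + y) ^+ 2 * q + 3 * q ^+ 2) / tau ^+ 3 +
    (((s - y) ^+ 2 + q) / tau - ((s - y) ^+ 4 +
    6 * (s - y) ^+ 2 * q + 3 * q ^+ 2) / tau ^+ 3)) / 2) _; last lra.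
  by rewrite le_eqVlt; apply/orP; left; apply/eqP; field; lra.
have : 0 <= 2 * y ^+ 4 / tau ^+ 3.
  by rewrite divr_ge0 ?exprn_ge0 ?(ltW t0)// mulr_ge0// exprn_even_ge0.
lra.
Qed.

(** The bound is not monotone in Q, so a truncated sum of squares cannot be inserted into
    [ravg_norm_ge] directly. At the best scale 3 sqrt q that lemma gives 2/9 sqrt q, a Khinchine
    inequality. The square root is monotone, and y >= y^2 / tau - y^4 / tau^3 at y = sqrt Q returns
    to a fixed scale, where means can be computed. *)
Lemma ravg_norm_ge_trunc x n (tau Q : R) : 0 < tau ->
  0 <= Q <= \sum_(0 <= i < n) x i ^+ 2 ->
  2 / 9 * (Q / tau - Q ^+ 2 / tau ^+ 3) <= ravg Num.norm x n 0.
Proof.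
move=> t0; set q := \sum_(0 <= i < n) _ => /andP[Q0 Qq].
have ra0 := ravg_norm_ge0 x n 0.
have [q0|q0] := eqVneq q 0.
  have -> : Q = 0 by lra.
  by rewrite !mul0r expr0n mul0r subrr mulr0.
have qp : 0 < q by rewrite lt_neqAle eq_sym q0; lra.
have sq0 : 0 < Num.sqrt q by rewrite sqrtr_gt0.
have sqE : Num.sqrt q ^+ 2 = q by rewrite sqr_sqrtr ?ltW.
have := @ravg_norm_ge x n (3 * Num.sqrt q) 0 ltac:(lra).
rewrite -/q /= !expr0n /= !(mulr0, mul0r, add0r).
set z := Num.sqrt q in sq0 sqE *; rewrite -sqE.
have -> : z ^+ 2 / (3 * z) - 3 * (z ^+ 2) ^+ 2 / (3 * z) ^+ 3 = 2 / 9 * z.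
  by field; lra.
apply: le_trans; rewrite ler_pM2l; last lra.
apply: le_trans (_ : Num.sqrt Q <= _); last by rewrite /z ler_sqrt ?(ltW qp).
set y := Num.sqrt Q; have y0 : 0 <= y by exact: sqrtr_ge0.
have -> : Q = y ^+ 2 by rewrite sqr_sqrtr.
have -> : y ^+ 2 / tau - (y ^+ 2) ^+ 2 / tau ^+ 3 =
   y * ((y / tau) * (1 - (y / tau) ^+ 2)) by field; lra.
have : 0 <= y / tau by apply: divr_ge0 => //; lra.
set u := y / tau => u0.
suff : u * (1 - u ^+ 2) <= 1 by move=> h; rewrite ler_piMr.
have [u1|u1] := leP u 1; first by nra.
by nra.
Qed.

End paths.

(** * Independence and laws of sequences *)

Definition indep2 d (T : measurableType d) (R : realType) (P : probability T R)
    d1 (T1 : measurableType d1) d2 (T2 : measurableType d2)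
    (U : T -> T1) (W : T -> T2) : Prop :=
  forall A B, measurable A -> measurable B ->
  P (U @^-1` A `&` W @^-1` B) = (P (U @^-1` A) * P (W @^-1` B))%E.

Lemma indep2_comp d (T : measurableType d) (R : realType) (P : probability T R)
    d1 (T1 : measurableType d1) d2 (T2 : measurableType d2)
    d3 (T3 : measurableType d3) d4 (T4 : measurableType d4)
    (U : T -> T1) (W : T -> T2) (f : T1 -> T3) (g : T2 -> T4) :
  measurable_fun setT f -> measurable_fun setT g ->
  indep2 P U W -> indep2 P (f \o U) (g \o W).
Proof.
move=> mf mg UW A B mA mB; apply: (UW (f @^-1` A) (g @^-1` B)).
  by rewrite -[X in measurable X]setTI; exact: mf.
by rewrite -[X in measurable X]setTI; exact: mg.
Qed.

Section indep2_integral.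
Context d (T : measurableType d) (R : realType) (P : probability T R).
Context d1 (T1 : measurableType d1) d2 (T2 : measurableType d2).
Variables (U : T -> T1) (W : T -> T2).
Hypotheses (mU : measurable_fun setT U) (mW : measurable_fun setT W).
Hypothesis UW : indep2 P U W.
Local Open Scope ereal_scope.

Let mU_mixin := isMeasurableFun.Build _ _ _ _ _ mU.
Let pU : {mfun T >-> T1} := HB.pack U mU_mixin.
Let mW_mixin := isMeasurableFun.Build _ _ _ _ _ mW.
Let pW : {mfun T >-> T2} := HB.pack W mW_mixin.
Let mUW : measurable_fun setT (fun w => (U w, W w)).
Proof. exact: measurable_fun_pair. Qed.
Let mUW_mixin := isMeasurableFun.Build _ _ _ _ _ mUW.
Let pUW : {mfun T >-> (T1 * T2)%type} := HB.pack (fun w => (U w, W w)) mUW_mixin.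

Lemma indep2_tonelli (f : T1 * T2 -> \bar R) :
  measurable_fun setT f -> (forall z, 0 <= f z) ->
  \int[P]_w f (U w, W w) = \int[P]_w' \int[P]_w f (U w, W w').
Proof.
move=> mf f0.
have -> : \int[P]_w f (U w, W w) = \int[distribution P pUW]_z f z.
  by rewrite ge0_integral_distribution.
have -> : \int[distribution P pUW]_z f z =
    \int[(distribution P pU \x distribution P pW)]_z f z.
  apply: eq_measure_integral => //= A mA _; apply/esym.
  apply: (@product_measure_unique _ _ _ _ _ _ _ (distribution P pUW)) => //.
rewrite (fubini_tonelli2 _ mf f0) /fubini_G.
have mG : measurable_fun setT (fun y => \int[distribution P pU]_x f (x, y)).
  exact: measurable_fun_fubini_tonelli_G.
rewrite ge0_integral_distribution//; last by move=> y; exact: integral_ge0.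
apply: eq_integral => w _ /=; rewrite ge0_integral_distribution//.
exact: measurableT_comp.
Qed.

End indep2_integral.

(** Both sides are finite measures in A, so agreement on a generating pi-system suffices. [Q] is
    kept free: it will be the law of [U], and later the uniform law, which yields invariance and
    independence at once. *)
Lemma prob_pi_ind d (T : measurableType d) d' (T' : measurableType d')
    (R : realType) (P : probability T R) (Q : probability T' R)
    (U : T -> T') (D : set T) (G : set (set T')) :
  measurable_fun setT U -> measurable D ->
  @measurable _ T' = <<s G >> -> setI_closed G ->
  (forall A, G A -> P (U @^-1` A `&` D) = Q A * P D)%E ->
  forall A : set T', measurable A -> (P (U @^-1` A `&` D) = Q A * P D)%E.
Proof.
move=> mU mD GE GI hG A0 mA0.
have mUA (A : set T') : measurable A -> measurable (U @^-1` A).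
  by move=> mA; rewrite -[X in measurable X]setTI; exact: mU.
have {}mA0 : <<s G >> A0 by rewrite -GE.
move: A0 mA0; apply: (@dynkin_induction _ T' G) => //.
- by rewrite preimage_setT setTI probability_setT mul1e.
- move=> A mA hA; rewrite preimage_setC probability_setC//.
  have -> : ~` (U @^-1` A) `&` D = D `\` U @^-1` A by rewrite setIC.
  rewrite measureD//=; [|exact: mUA|by rewrite ltey_eq fin_num_measure].
  rewrite setIC hA muleBl ?mul1e//; exact: fin_num_measure.
- move=> F mF tF hF; rewrite preimage_bigcup setI_bigcupl.
  have tF' : trivIset setT (fun n => U @^-1` F n).
    apply/trivIsetP => i j _ _ ij; rewrite -preimage_setI.
    by move/trivIsetP : tF => /(_ i j I I ij) ->; rewrite preimage_set0.
  rewrite [in LHS]measure_bigcup; last 2 first.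
  + by move=> i _; apply: measurableI => //; exact: mUA.
  + apply/trivIsetP => i j _ _ ij.
    rewrite setIACA setIid -[X in X `&` _]/(U @^-1` F i `&` U @^-1` F j).
    by move/trivIsetP : tF' => /(_ i j I I ij) ->; rewrite set0I.
  rewrite [in RHS]measure_bigcup//.
  have pE : P D = (fine (P D))%:E by rewrite fineK ?fin_num_measure.
  rewrite pE [RHS]muleC -nneseriesZl//.
  by apply: eq_eseriesr => i _; apply: etrans (hF i) _; rewrite pE muleC.
Qed.

Section seqspace.
Variable R : realType.

Definition rects : set (set (nat -> R)) := [set A | exists B n,
  [/\ forall i, measurable (B i), forall i, (n <= i)%N -> B i = [set: R] &
      A = [set x : nat -> R | forall i, B i (x i)]]].

(** The product sigma-algebra on real sequences, generated by rectangles that constrain finitely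
    many coordinates. Path functionals become measurable maps on this one space. *)
Definition seqsp := g_sigma_algebraType rects.

Lemma rects_setI : setI_closed rects.
Proof.
move=> _ _ [B [n [mB Bn ->]]] [C [m [mC Cm ->]]].
exists (fun i => B i `&` C i), (maxn n m); split.
- by move=> i; exact: measurableI.
- by move=> i; rewrite geq_max => /andP[/Bn -> /Cm ->]; rewrite setTI.
- apply/seteqP; split=> x /=; first by case=> h1 h2 i; split.
  by move=> h; split=> i; have [] := h i.
Qed.

Lemma rects_setT : rects setT.
Proof. by exists (fun=> setT), 0%N; split => //; apply/seteqP; split. Qed.

Lemma measurable_rect (B : nat -> set R) (n : nat) :
  (forall i, measurable (B i)) -> (forall i, (n <= i)%N -> B i = [set: R]) ->
  measurable ([set x | forall i, B i (x i)] : set seqsp).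
Proof. by move=> mB Bn; apply: sub_sigma_algebra; exists B, n; split. Qed.

Lemma measurable_coord i : measurable_fun setT (fun x : seqsp => x i).
Proof.
move=> _ B mB; rewrite setTI.
have -> : (fun x : seqsp => x i) @^-1` B =
    [set x | forall j, (if j == i then B else setT) (x j)].
  apply/seteqP; split=> x /=; first by move=> Bx j; case: eqP => // ->.
  by move/(_ i); rewrite eqxx.
apply: (@measurable_rect (fun j => if j == i then B else setT) i.+1) => j; first by case: ifP.
by move=> ij; rewrite ifF//; apply/eqP; lia.
Qed.

Lemma measurable_seqsp d (T : measurableType d) (f : T -> seqsp) :
  (forall i, measurable_fun setT (fun t => f t i)) -> measurable_fun setT f.
Proof.
move=> mf; have := @measurability _ _ T seqsp setT f rects erefl; apply.
move=> _ [_ [B [n [mB Bn ->]]] <-]; rewrite setTI.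
have -> : f @^-1` [set x : nat -> R | forall i, B i (x i)] =
    \bigcap_i ((fun t => f t i) @^-1` B i).
  by apply/seteqP; split=> t /= h i; [move=> _|]; apply: h.
apply: bigcapT_measurable => i; rewrite -[X in measurable X]setTI; exact: mf.
Qed.

(** Zeroing the other coordinates keeps a subfamily inside the same sequence space; a functional
    that depends on the coordinates in [S] alone is one that is invariant under [mask S]. *)
Definition mask (S : pred nat) (x : nat -> R) : nat -> R :=
  fun i => if S i then x i else 0.

Lemma rects_ind d (T : measurableType d) (P : probability T R)
    (U : T -> seqsp) (D : set T) :
  measurable_fun setT U -> measurable D ->
  (forall A, rects A -> P (U @^-1` A `&` D) = P (U @^-1` A) * P D)%E ->
  forall A : set seqsp, measurable A ->
    (P (U @^-1` A `&` D) = P (U @^-1` A) * P D)%E.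
Proof.
move=> mU mD hR.
pose mUm := isMeasurableFun.Build _ _ _ _ _ mU.
pose pU : {mfun T >-> seqsp} := HB.pack U mUm.
apply: (@prob_pi_ind _ _ _ _ _ P (distribution P pU) U D rects) => //.
exact: rects_setI.
Qed.

End seqspace.

Section indep_sequences.
Context d (T : measurableType d) (R : realType) (P : probability T R).
Variable X : nat -> {RV P >-> R}.
Hypothesis indX : independent_RVs X.

Definition path_of d' (T' : measurableType d') (P' : probability T' R)
  (Y : nat -> {RV P' >-> R}) (w : T') : seqsp R := fun i => Y i w.

Lemma measurable_path_of d' (T' : measurableType d') (P' : probability T' R)
  (Y : nat -> {RV P' >-> R}) : measurable_fun setT (path_of Y).
Proof. by apply: measurable_seqsp => i; exact: measurable_funP. Qed.

Lemma indep_rect (B : nat -> set R) n :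
  (forall i, measurable (B i)) -> (forall i, (n <= i)%N -> B i = [set: R]) ->
  P [set w | forall i, B i (X i w)] = (\prod_(i < n) P (X i @^-1` B i))%E.
Proof.
move=> mB Bn.
have -> : [set w | forall i, B i (X i w)] =
    \bigcap_(i in [set` iota 0 n]) (X i @^-1` B i).
  apply/seteqP; split=> w /= h; first by move=> i _; exact: h.
  move=> i; have [ni|ni] := leqP n i; first by rewrite Bn.
  by apply: h; rewrite /= mem_iota.
rewrite indX ?iota_uniq//.
by rewrite -[in LHS](subn0 n) -/(index_iota 0 n) big_mkord.
Qed.

Lemma indep_inj (f : nat -> nat) : injective f ->
  independent_RVs (fun i => X (f i)).
Proof.
move=> inj_f J B uJ mB.
(* A left inverse of [f]; the default 0 occurs only off the image of [f]. *)
pose g j := xget 0%N [set i | f i = j].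
have gf i : g (f i) = i by apply: inj_f; exact: (@xgetPex _ 0%N [set k | f k = f i] (ex_intro _ i erefl)).
have h := @indX (map f J) (fun j => B (g j)).
rewrite big_map in h.
under eq_bigr do rewrite -[X in B X]gf.
rewrite -h ?map_inj_uniq//; last by move=> _ /mapP[i iJ ->]; rewrite gf; exact: mB.
congr (P _); apply/seteqP; split=> w /= hw.
  by move=> _ /= /mapP[i iJ ->]; rewrite gf; exact: hw.
by move=> i /= iJ; have := hw (f i); rewrite /= map_f// gf; apply.
Qed.

(** The preimage of the constraint [B i] under the i-th masked coordinate. Off [S] that coordinate
    is constantly 0, so the constraint is void or impossible. *)
Let maskset (S : pred nat) (B : nat -> set R) i : set R :=
  if S i then B i else if `[< B i 0 >] then setT else set0.

Let measurable_mask S : measurable_fun setT (fun w => mask S (path_of X w) : seqsp R).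
Proof.
apply: measurable_seqsp => i; rewrite /mask; case: (S i).
  exact: measurable_funP.
exact: measurable_cst.
Qed.

(** Checked on pairs of rectangles, then extended by the pi-lambda argument to one side at a
    time. *)
Lemma indep_mask (S : pred nat) :
  indep2 P (fun w => mask S (path_of X w) : seqsp R)
           (fun w => mask (predC S) (path_of X w) : seqsp R).
Proof.
have mskE (S' : pred nat) (B : nat -> set R) :
    (fun w => mask S' (path_of X w)) @^-1` [set x | forall i, B i (x i)] =
    [set w | forall i, maskset S' B i (X i w)].
  apply/seteqP; split=> w /= h i; have := h i; rewrite /mask /maskset;
    case: ifP => // _; by case: asboolP.
have mm (S' : pred nat) (B : nat -> set R) i :
    measurable (B i) -> measurable (maskset S' B i).
  by move=> mB; rewrite /maskset; case: ifP => // _; case: ifP.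
have mT (S' : pred nat) (B : nat -> set R) i :
    B i = setT -> maskset S' B i = setT.
  by move=> BT; rewrite /maskset BT; case: ifP => // _; rewrite asboolT.
have mD (S' : pred nat) (A : set (seqsp R)) : measurable A ->
    measurable ((fun w => mask S' (path_of X w)) @^-1` A).
  by move=> mA; rewrite -[X in measurable X]setTI; exact: measurable_mask.
have RR A C : rects A -> rects C ->
   (P ((fun w => mask S (path_of X w)) @^-1` A `&`
      (fun w => mask (predC S) (path_of X w)) @^-1` C) =
    P ((fun w => mask S (path_of X w)) @^-1` A) *
    P ((fun w => mask (predC S) (path_of X w)) @^-1` C))%E.
  move=> [B [n [mB Bn ->]]] [B' [m [mB' Bm ->]]]; rewrite !mskE.
  have := @indep_rect (fun i => maskset S B i `&` maskset (predC S) B' i) (maxn n m).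
  rewrite (_ : [set w | _] = [set w | forall i, maskset S B i (X i w)] `&`
     [set w | forall i, maskset (predC S) B' i (X i w)]); last first.
    apply/seteqP; split => w /=; first by move=> h; split=> i; have [] := h i.
    by case=> h1 h2 i; split.
  move=> ->; last 2 first.
    by move=> i; apply: measurableI; exact: mm.
    by move=> i; rewrite geq_max => /andP[ni mi]; rewrite !mT ?setTI ?Bn ?Bm.
  rewrite (@indep_rect (maskset S B) (maxn n m)); last 2 first.
    by move=> i; exact: mm.
    by move=> i; rewrite geq_max => /andP[ni mi]; rewrite mT ?Bn.
  rewrite (@indep_rect (maskset (predC S) B') (maxn n m)); last 2 first.
    by move=> i; exact: mm.
    by move=> i; rewrite geq_max => /andP[ni mi]; rewrite mT ?Bm.
  (* At each index one of the two constraints is trivial, being [setT] or [set0]. *)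
  rewrite -big_split/=; apply: eq_bigr => i _.
  rewrite preimage_setI {1 3}/maskset /=; case: (boolP (S i)) => Si.
    rewrite {1 2}/maskset /= Si /=; case: asboolP => _.
      by rewrite preimage_setT setIT probability_setT mule1.
    by rewrite preimage_set0 setI0 measure0 mule0.
  rewrite {1 2}/maskset /= (negbTE Si) /=; case: asboolP => _.
    by rewrite preimage_setT setTI probability_setT mul1e.
  by rewrite preimage_set0 set0I measure0 mul0e.
move=> A C mA mC.
apply: (rects_ind (measurable_mask S) (mD (predC S) C mC)) => // A' rA'.
rewrite setIC muleC.
apply: (rects_ind (measurable_mask (predC S)) (mD S A' _)) => //.
  exact: sub_sigma_algebra.
by move=> C' rC'; rewrite setIC muleC RR.
Qed.

(** Reduces independence of functionals of disjoint blocks to invariance under masks, which is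
    checked by comparing indices. *)
Lemma indep2_blocks (S : pred nat) d1 (T1 : measurableType d1)
    d2 (T2 : measurableType d2) (f : seqsp R -> T1) (g : seqsp R -> T2) :
  measurable_fun setT f -> measurable_fun setT g ->
  (forall x, f (mask S x) = f x) -> (forall x, g (mask (predC S) x) = g x) ->
  indep2 P (fun w => f (path_of X w)) (fun w => g (path_of X w)).
Proof.
move=> mf mg fS gS; have := indep2_comp mf mg (indep_mask S).
by rewrite /comp; under eq_fun do rewrite fS; under [X in indep2 P _ X]eq_fun do rewrite gS.
Qed.

End indep_sequences.

Section path_law.
Context d (T : measurableType d) (R : realType) (P : probability T R).
Context d' (T' : measurableType d') (P' : probability T' R).
Variables (X : nat -> {RV P >-> R}) (Y : nat -> {RV P' >-> R}).
Hypotheses (indX : independent_RVs X) (indY : independent_RVs Y).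
Hypothesis XY : forall i, same_law (X i) (Y i).

Let mX := isMeasurableFun.Build _ _ _ _ _ (measurable_path_of X).
Let mY := isMeasurableFun.Build _ _ _ _ _ (measurable_path_of Y).
Let pX : {mfun T >-> seqsp R} := HB.pack (path_of X) mX.
Let pY : {mfun T' >-> seqsp R} := HB.pack (path_of Y) mY.

(** Two probability spaces are allowed because the lemma serves both to relabel the increments of
    one walk and to transfer the example in (ii) to arbitrary copies. *)
Lemma eq_path_law (A : set (seqsp R)) : measurable A ->
  P (path_of X @^-1` A) = P' (path_of Y @^-1` A).
Proof.
move=> mA.
apply: (@measure_unique _ R (seqsp R) (@rects R) (fun=> setT) _ _ _ _
  (distribution P pX) (distribution P' pY)) => //.
- exact: rects_setI.
- by move=> _; exact: rects_setT.
- by apply/seteqP; split => // x _; exists 0%N.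
- move=> _ [B [n [mB Bn ->]]].
  apply: etrans (indep_rect indX mB Bn) _.
  apply: etrans (esym (indep_rect indY mB Bn)).
  by apply: eq_bigr => i _; exact: XY.
- by move=> _; rewrite -ge0_fin_numE ?fin_num_measure.
Qed.

Lemma eq_path_int_ge0 (f : seqsp R -> \bar R) :
  measurable_fun setT f -> (forall x, (0 <= f x)%E) ->
  (\int[P]_w f (path_of X w) = \int[P']_w f (path_of Y w))%E.
Proof.
move=> mf f0.
rewrite -(@ge0_integral_distribution _ _ _ _ _ P pX f mf f0).
rewrite -(@ge0_integral_distribution _ _ _ _ _ P' pY f mf f0).
by apply: eq_measure_integral => A mA _; exact: eq_path_law.
Qed.

Lemma eq_path_int (f : seqsp R -> \bar R) : measurable_fun setT f ->
  (\int[P]_w f (path_of X w) = \int[P']_w f (path_of Y w))%E.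
Proof.
move=> mf; rewrite integralE [RHS]integralE.
rewrite (_ : (fun w => f (path_of X w))^\+%E = f^\+%E \o path_of X); last first.
  exact: funepos_comp.
rewrite (_ : (fun w => f (path_of X w))^\-%E = f^\-%E \o path_of X); last first.
  exact: funeneg_comp.
rewrite (_ : (fun w => f (path_of Y w))^\+%E = f^\+%E \o path_of Y); last first.
  exact: funepos_comp.
rewrite (_ : (fun w => f (path_of Y w))^\-%E = f^\-%E \o path_of Y); last first.
  exact: funeneg_comp.
by congr (_ - _)%E; apply: eq_path_int_ge0 => //;
  [exact: measurable_funepos|exact: measurable_funeneg].
Qed.

Lemma path_integrable (f : seqsp R -> R) : measurable_fun setT f ->
  P.-integrable setT (EFin \o (fun w => f (path_of X w))) ->
  P'.-integrable setT (EFin \o (fun w => f (path_of Y w))).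
Proof.
move=> mf /integrableP[_ foo]; apply/integrableP; split.
  apply/measurable_EFinP; apply: measurableT_comp => //.
  exact: measurable_path_of.
rewrite (le_lt_trans _ foo)// le_eqVlt; apply/orP; left; apply/eqP/esym.
apply: (@eq_path_int_ge0 (fun x => `|(f x)%:E|%E)) => //.
by apply: measurableT_comp => //; exact/measurable_EFinP.
Qed.

End path_law.

(** * Expectations *)

Section expect.
Context d (T : measurableType d) (R : realType) (P : probability T R).
Implicit Types (f g : T -> R) (r : R).

Definition integ f := P.-integrable [set: T] (EFin \o f).
Definition EE f : R := \int[P]_w f w.

Lemma integ_measurable f : integ f -> measurable_fun setT f.
Proof. by move/measurable_int/measurable_EFinP. Qed.

Lemma EE_EFin f : integ f -> (EE f)%:E = (\int[P]_w (f w)%:E)%E.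
Proof. by move=> If; rewrite /EE /Rintegral fineK// integrable_fin_num. Qed.

Lemma EE_of_int f r : (\int[P]_w (f w)%:E = r%:E)%E -> EE f = r.
Proof. by rewrite /EE /Rintegral => ->. Qed.

Lemma eq_EE f g : f =1 g -> EE f = EE g.
Proof. by move=> fg; apply: eq_Rintegral => w _. Qed.

Lemma integ_cst r : integ (fun=> r).
Proof. exact: finite_measure_integrable_cst. Qed.

Lemma EE_cst r : EE (fun=> r) = r.
Proof.
have e : fine (P setT) = 1 by rewrite probability_setT.
by rewrite /EE Rintegral_cst//; apply: etrans (congr1 ( *%R r) e) _; rewrite mulr1.
Qed.

Lemma integD f g : integ f -> integ g -> integ (fun w => f w + g w).
Proof. by move=> If Ig; exact: (integrableD _ If Ig). Qed.

Lemma EE_D f g : integ f -> integ g ->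
  EE (fun w => f w + g w) = EE f + EE g.
Proof. by move=> If Ig; rewrite /EE RintegralD. Qed.

Lemma integZ r f : integ f -> integ (fun w => r * f w).
Proof. by move=> If; exact: (integrableZl _ r If). Qed.

Lemma EE_Z r f : integ f -> EE (fun w => r * f w) = r * EE f.
Proof. by move=> If; rewrite /EE RintegralZl. Qed.

Lemma integN f : integ f -> integ (fun w => - f w).
Proof. by move=> /(integZ (-1)); apply: eq_integrable => // w _ /=; rewrite mulN1r. Qed.

Lemma EE_N f : integ f -> EE (fun w => - f w) = - EE f.
Proof.
by move=> If; rewrite -mulN1r -EE_Z//; apply: eq_EE => w; rewrite mulN1r.
Qed.

Lemma integB f g : integ f -> integ g -> integ (fun w => f w - g w).
Proof. by move=> If /integN; exact: integD. Qed.

Lemma EE_B f g : integ f -> integ g ->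
  EE (fun w => f w - g w) = EE f - EE g.
Proof. by move=> If Ig; rewrite EE_D ?EE_N//; exact: integN. Qed.

Lemma integ_sum (h : nat -> T -> R) m n :
  (forall i, (m <= i < n)%N -> integ (h i)) ->
  integ (fun w => \sum_(m <= i < n) h i w) /\
  EE (fun w => \sum_(m <= i < n) h i w) = \sum_(m <= i < n) EE (h i).
Proof.
have triv k : (k <= m)%N -> integ (fun w => \sum_(m <= i < k) h i w) /\
    EE (fun w => \sum_(m <= i < k) h i w) = \sum_(m <= i < k) EE (h i).
  move=> km; rewrite (_ : (fun w => _) = (fun=> 0)); last first.
    by apply/funext => w; rewrite big_geq.
  by rewrite big_geq//; split; [exact: integ_cst|exact: EE_cst].
elim: n => [_|n IH Ih]; first exact: triv.
have [mn|nm] := leqP m n; last exact: triv.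
have [I1 E1] := IH (fun i h => Ih i ltac:(lia)).
have I2 := Ih n ltac:(lia).
rewrite (_ : (fun w => _) = (fun w => \sum_(m <= i < n) h i w + h n w)); last first.
  by apply/funext => w; rewrite big_nat_recr.
by rewrite big_nat_recr//= -E1 -EE_D//; split => //; exact: integD.
Qed.

Lemma le_integ f g : measurable_fun setT f -> integ g ->
  (forall w, `|f w| <= g w) -> integ f.
Proof.
move=> mf Ig fg; apply: (le_integrable _ _ _ Ig) => //.
  exact/measurable_EFinP.
by move=> w _ /=; rewrite lee_fin (le_trans (fg w))// ler_norm.
Qed.

Lemma integ_norm f : integ f -> integ (fun w => `|f w|).
Proof. exact: integrable_norm. Qed.

Lemma integ_bounded f r : measurable_fun setT f -> (forall w, `|f w| <= r) ->
  integ f.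
Proof. by move=> mf fr; apply: (le_integ mf (integ_cst r)). Qed.

Lemma le_EE f g : integ f -> integ g -> (forall w, f w <= g w) -> EE f <= EE g.
Proof. by move=> If Ig fg; apply: le_Rintegral. Qed.

Lemma EE_ge0 f : (forall w, 0 <= f w) -> 0 <= EE f.
Proof. by move=> f0; apply: Rintegral_ge0. Qed.

Lemma integ_max0 f : integ f -> integ (fun w => Num.max 0 (f w)).
Proof.
move=> If; have mf := integ_measurable If.
apply: le_integ (integ_norm If) _.
  by apply: measurable_maxr => //; exact: measurable_cst.
by move=> w; rewrite ger0_norm ?le_max ?lexx// ge_max normr_ge0 ler_norm.
Qed.

Lemma ge0_integ f r : measurable_fun setT f -> (forall w, 0 <= f w) ->
  (\int[P]_w (f w)%:E <= r%:E)%E -> integ f /\ EE f <= r.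
Proof.
move=> mf f0 fr.
have If : integ f.
  apply/integrableP; split; first exact/measurable_EFinP.
  under eq_integral do rewrite /= ger0_norm//.
  exact: le_lt_trans fr (ltry _).
by split => //; rewrite -lee_fin EE_EFin.
Qed.

Lemma measurable_bool (b : T -> bool) : measurable_fun setT b ->
  measurable_fun setT (fun w => (b w)%:R : R).
Proof.
move=> mb; have -> : (fun w => (b w)%:R : R) = (fun w => if b w then 1 else 0).
  by apply/funext => w; case: (b w).
by apply: measurable_fun_ifT => //; exact: measurable_cst.
Qed.

Lemma measurable_setbool (b : T -> bool) : measurable_fun setT b ->
  measurable [set w | b w].
Proof.
move=> mb; have := mb measurableT [set true] ltac:(by []).
by rewrite setTI.
Qed.

Lemma integ_bool (b : T -> bool) : measurable_fun setT b ->
  integ (fun w => (b w)%:R).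
Proof.
move=> mb; apply: (@integ_bounded _ 1); first exact: measurable_bool.
by move=> w; case: (b w); rewrite ?normr1 ?normr0.
Qed.

Lemma EE_bool (b : T -> bool) : measurable_fun setT b ->
  EE (fun w => (b w)%:R) = fine (P [set w | b w]).
Proof.
move=> mb; rewrite /EE /Rintegral; congr fine.
transitivity (\int[P]_w (\1_[set w | b w] w)%:E)%E.
  apply: eq_integral => w _; rewrite indicE; congr (_%:R%:E).
  by apply/esym; case: (boolP (b w)) => h; [rewrite mem_set|rewrite memNset//; apply/negP].
by rewrite integral_indic ?setIT//; exact: measurable_setbool.
Qed.

Lemma Efine_P (A : set T) : measurable A -> (fine (P A))%:E = P A.
Proof. by move=> mA; rewrite fineK// fin_num_measure. Qed.

End expect.
Arguments integ {d T R} P f.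
Arguments EE {d T R} P f.

Section product_expect.
Context d (T : measurableType d) (R : realType) (P : probability T R).

Lemma EE_tonelli d1 (T1 : measurableType d1) d2 (T2 : measurableType d2)
    (U : T -> T1) (W : T -> T2) (f : T1 * T2 -> R) :
  measurable_fun setT U -> measurable_fun setT W -> indep2 P U W ->
  measurable_fun setT f -> (forall z, 0 <= f z) ->
  (forall w', integ P (fun w => f (U w, W w'))) ->
  (\int[P]_w (f (U w, W w))%:E =
   \int[P]_w' (EE P (fun w => f (U w, W w')))%:E)%E.
Proof.
move=> mU mW UW mf f0 If.
rewrite (@indep2_tonelli _ _ _ _ _ _ _ _ _ _ mU mW UW (EFin \o f))//.
- by apply: eq_integral => w' _; rewrite EE_EFin.
- exact/measurable_EFinP.
Qed.

(** Freeze [W], bound the mean over [U] by [q], then integrate; the integrability of the joint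
    functional is part of the conclusion. *)
Lemma EE_tonelli_le d1 (T1 : measurableType d1) d2 (T2 : measurableType d2)
    (U : T -> T1) (W : T -> T2) (f : T1 * T2 -> R) (q : T -> R) :
  measurable_fun setT U -> measurable_fun setT W -> indep2 P U W ->
  measurable_fun setT f -> (forall z, 0 <= f z) ->
  (forall w', integ P (fun w => f (U w, W w'))) ->
  integ P q -> (forall w', EE P (fun w => f (U w, W w')) <= q w') ->
  integ P (fun w => f (U w, W w)) /\ EE P (fun w => f (U w, W w)) <= EE P q.
Proof.
move=> mU mW UW mf f0 If Iq fq.
apply: ge0_integ => //.
  by apply: measurableT_comp => //; exact: measurable_fun_pair.
rewrite EE_tonelli// EE_EFin//; apply: ge0_le_integral => //.
- by move=> w _; rewrite lee_fin EE_ge0.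
- have h : measurable_fun setT (fun w' => \int[P]_w (f (U w, W w'))%:E)%E.
    pose mUm := isMeasurableFun.Build _ _ _ _ _ mU.
    pose pU : {mfun T >-> T1} := HB.pack U mUm.
    have mG : measurable_fun setT (fun y => \int[distribution P pU]_x (f (x, y))%:E)%E.
      apply: (@measurable_fun_fubini_tonelli_G _ _ _ _ R (distribution P pU) (EFin \o f)).
        exact/measurable_EFinP.
      by move=> z; rewrite lee_fin.
    apply: (eq_measurable_fun ((fun y => \int[distribution P pU]_x (f (x, y))%:E)%E \o W)).
      move=> w _ /=; rewrite ge0_integral_distribution//.
        by apply/measurable_EFinP; exact: measurableT_comp.
      by move=> z; rewrite lee_fin.
    exact: measurableT_comp.
  by apply: (eq_measurable_fun _ _ h) => w' _; rewrite EE_EFin.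
- by apply/measurable_EFinP/(integ_measurable Iq).
- by move=> w _; rewrite lee_fin.
Qed.

Lemma EE_indepM_ge0 (U W : T -> R) : indep2 P U W ->
  integ P U -> integ P W -> (forall w, 0 <= U w) -> (forall w, 0 <= W w) ->
  integ P (fun w => U w * W w) /\ EE P (fun w => U w * W w) = EE P U * EE P W.
Proof.
move=> UW IU IW U0 W0.
have mU := integ_measurable IU; have mW := integ_measurable IW.
pose f (z : R * R) : R := `|z.1| * `|z.2|.
have mf : measurable_fun setT f.
  by apply: measurable_funM; apply: measurableT_comp.
have fE w w' : f (U w, W w') = W w' * U w by rewrite /f/= !ger0_norm// mulrC.
have eqI : (\int[P]_w (U w * W w)%:E = (EE P U * EE P W)%:E)%E.
  transitivity (\int[P]_w (f (U w, W w))%:E)%E.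
    by apply: eq_integral => w _; rewrite fE mulrC.
  rewrite EE_tonelli//; last 2 first.
  - by move=> z; rewrite /f mulr_ge0.
  - by move=> w'; under eq_fun do rewrite fE; exact: integZ.
  transitivity (\int[P]_w (EE P U * W w)%:E)%E.
    apply: eq_integral => w' _; congr EFin; rewrite mulrC -EE_Z//.
    by apply: eq_EE => w; rewrite fE.
  by rewrite -EE_EFin ?EE_Z//; exact: integZ.
have [IUW _] := ge0_integ (measurable_funM mU mW)
  (fun w => mulr_ge0 (U0 w) (W0 w)) (eq_ind_r (fun z => (z <= (EE P U * EE P W)%:E)%E) (lexx _) eqI).
by split => //; exact: EE_of_int.
Qed.

Lemma EE_indepM (U W : T -> R) : indep2 P U W -> integ P U -> integ P W ->
  integ P (fun w => U w * W w) /\ EE P (fun w => U w * W w) = EE P U * EE P W.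
Proof.
move=> UW IU IW.
pose p (x : R) : R := Num.max 0 x; pose m (x : R) : R := Num.max 0 (- x).
have pm x : x = p x - m x by rewrite /p /m; case: (leP 0 x); case: (leP 0 (-x)); lra.
have mp : measurable_fun setT p by apply: measurable_maxr.
have mm : measurable_fun setT m by apply: measurable_maxr => //; exact: measurable_funN.
have p0 x : 0 <= p x by rewrite le_max lexx.
have m0 x : 0 <= m x by rewrite le_max lexx.
have Ip V : integ P V -> integ P (p \o V) by exact: integ_max0.
have Im V : integ P V -> integ P (m \o V) by move=> /integN; exact: integ_max0.
have [I1 E1] := EE_indepM_ge0 (indep2_comp mp mp UW) (Ip _ IU) (Ip _ IW)
   (fun w => p0 _) (fun w => p0 _).
have [I2 E2] := EE_indepM_ge0 (indep2_comp mp mm UW) (Ip _ IU) (Im _ IW)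
   (fun w => p0 _) (fun w => m0 _).
have [I3 E3] := EE_indepM_ge0 (indep2_comp mm mp UW) (Im _ IU) (Ip _ IW)
   (fun w => m0 _) (fun w => p0 _).
have [I4 E4] := EE_indepM_ge0 (indep2_comp mm mm UW) (Im _ IU) (Im _ IW)
   (fun w => m0 _) (fun w => m0 _).
have UWE w : U w * W w = (p (U w) * p (W w) - p (U w) * m (W w)) -
    (m (U w) * p (W w) - m (U w) * m (W w)).
  by rewrite [in LHS](pm (U w)) [in LHS](pm (W w)); ring.
under eq_fun do rewrite UWE.
split; first by apply: integB; apply: integB.
rewrite EE_B ?EE_B//; [|exact: integB|exact: integB].
rewrite /comp in E1 E2 E3 E4; rewrite E1 E2 E3 E4.
have EU V : integ P V -> EE P V = EE P (p \o V) - EE P (m \o V).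
  by move=> IV; rewrite -EE_B; [apply: eq_EE => w /=; exact: pm|exact: Ip|exact: Im].
by rewrite (EU _ IU) (EU _ IW) /comp; ring.
Qed.

End product_expect.

Section path_expect.
Context d (T : measurableType d) (R : realType) (P : probability T R).
Context d' (T' : measurableType d') (P' : probability T' R).
Variables (X : nat -> {RV P >-> R}) (Y : nat -> {RV P' >-> R}).
Hypotheses (indX : independent_RVs X) (indY : independent_RVs Y).
Hypothesis XY : forall i, same_law (X i) (Y i).

Lemma eq_path_EE (f : seqsp R -> R) : measurable_fun setT f ->
  EE P (fun w => f (path_of X w)) = EE P' (fun w => f (path_of Y w)).
Proof.
move=> mf; rewrite /EE /Rintegral; congr fine.
by apply: (eq_path_int indX indY XY (f := EFin \o f)); exact/measurable_EFinP.
Qed.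

End path_expect.

Section measurable_functionals.
Context d (T : measurableType d) (R : realType) (g : T -> nat -> R).
Hypothesis mg : forall i, measurable_fun setT (fun t => g t i).

Lemma measurable_sum_nat (h : nat -> T -> R) m n :
  (forall i, measurable_fun setT (h i)) ->
  measurable_fun setT (fun t => \sum_(m <= i < n) h i t).
Proof.
move=> mh; elim: n => [|n IH].
  under eq_fun do rewrite big_geq//; exact: measurable_cst.
have [mn|nm] := leqP m n; last first.
  under eq_fun do rewrite big_geq//; exact: measurable_cst.
by under eq_fun do rewrite big_nat_recr//=; exact: measurable_funD.
Qed.

Lemma measurable_wsum k : measurable_fun setT (fun t => wsum (g t) k).
Proof. exact: measurable_sum_nat. Qed.

Lemma measurable_area k : measurable_fun setT (fun t => area (g t) k).
Proof. by apply: measurable_sum_nat => i; exact: measurable_wsum. Qed.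

Lemma measurable_mslope a : measurable_fun setT (fun t => mslope (g t) a).
Proof.
elim: a => [|a IH]; first exact: measurable_cst.
apply: measurable_maxr => //; apply: measurable_funM; last exact: measurable_cst.
exact: measurable_area.
Qed.

Lemma measurable_runmax n : measurable_fun setT (fun t => runmax (g t) n).
Proof.
elim: n => [|n IH]; first exact: measurable_cst.
by apply: measurable_maxr => //; exact: measurable_wsum.
Qed.

Lemma measurable_ravg n (s : T -> R) : measurable_fun setT s ->
  measurable_fun setT (fun t => ravg Num.norm (g t) n (s t)).
Proof.
elim: n s => [|n IH] s ms; first exact: measurableT_comp.
apply: measurable_funM; last exact: measurable_cst.
by apply: measurable_funD; apply: IH; [exact: measurable_funD|exact: measurable_funB].
Qed.

End measurable_functionals.

(** * Gaps of random walks *)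

Section iid_walk.
Context d (T : measurableType d) (R : realType) (P : probability T R).
Variable X : nat -> {RV P >-> R}.
Hypothesis iidX : iid X.

Let mX i : measurable_fun setT (X i).
Proof. exact: measurable_funP. Qed.

(** Used for shifts and for time reversal. *)
Lemma EE_relabel (f : nat -> nat) (phi : seqsp R -> R) : injective f ->
  measurable_fun setT phi ->
  EE P (fun w => phi (fun i => X (f i) w)) = EE P (fun w => phi (path_of X w)).
Proof.
have [indX lawX] := iidX => inj_f mphi.
apply: (@eq_path_EE _ _ _ P _ _ P (fun i => X (f i)) X) => //.
  exact: indep_inj.
by move=> i B mB; rewrite lawX// -(lawX i).
Qed.

Lemma EE_coord k (phi : R -> R) : measurable_fun setT phi ->
  EE P (fun w => phi (X k w)) = EE P (fun w => phi (X 0%N w)).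
Proof.
move=> mphi; have /= := @EE_relabel (addn k) (fun x => phi (x 0%N)) (@addnI k).
rewrite addn0; apply; apply: measurableT_comp => //; exact: measurable_coord.
Qed.

Lemma integ_coord k (phi : R -> R) : measurable_fun setT phi ->
  integ P (fun w => phi (X 0%N w)) -> integ P (fun w => phi (X k w)).
Proof.
have [indX lawX] := iidX => mphi I0.
have := @path_integrable _ _ _ P _ _ P X (fun i => X (k + i)%N) indX
  (indep_inj indX (@addnI k)) _ (fun x => phi (x 0%N)).
rewrite /path_of /= addn0; apply => //.
  by move=> i B mB; rewrite lawX// -(lawX (k + i)%N).
by apply: measurableT_comp => //; exact: measurable_coord.
Qed.

(** This is F(a) of the overview. *)
Definition stay0 a : R := fine (P [set w | mslope (path_of X w) a <= 0]).

Lemma EE_stay0 a : EE P (fun w => (mslope (path_of X w) a <= 0)%R%:R) = stay0 a.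
Proof.
rewrite EE_bool//; apply: measurable_fun_ler; last exact: measurable_cst.
exact: measurable_mslope.
Qed.

Lemma stay0_ge0 a : 0 <= stay0 a.
Proof. exact: fine_ge0. Qed.

Lemma integ_ind_mslope (g : T -> nat -> R) a (c : R) :
  (forall i, measurable_fun setT (fun t => g t i)) ->
  integ P (fun w => (mslope (g w) a <= c)%R%:R).
Proof.
move=> mg; apply: integ_bool; apply: measurable_fun_ler => //.
exact: measurable_mslope.
Qed.

Lemma stay0_mono a b : (a <= b)%N -> stay0 b <= stay0 a.
Proof.
move=> ab; rewrite -!EE_stay0; apply: le_EE.
- exact: integ_ind_mslope.
- exact: integ_ind_mslope.
- move=> w; case: (leP (mslope _ b) 0) => h; last by rewrite ler_nat.
  by rewrite (le_trans (mslope_mono _ ab)).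
Qed.

Let mcoord i : measurable_fun setT (fun x : seqsp R => x i).
Proof. exact: measurable_coord. Qed.

Definition fwdM n k w := mslope (fwd (path_of X w) k) (n - k).
Definition bwdM k w := mslope (bwd (path_of X w) k) k.-1.

Lemma measurable_fwdM n k : measurable_fun setT (fwdM n k).
Proof. by apply: measurable_mslope => i; exact: mX. Qed.

Lemma measurable_bwdM k : measurable_fun setT (bwdM k).
Proof. by apply: measurable_mslope => i; exact: mX. Qed.

Lemma EE_fwdM n k (phi : R -> R) : measurable_fun setT phi ->
  EE P (fun w => phi (fwdM n k w)) =
  EE P (fun w => phi (mslope (path_of X w) (n - k))).
Proof.
move=> mphi.
apply: (@EE_relabel (addn k.+1) (fun x => phi (mslope x (n - k)))).
  exact: addnI.
by apply: measurableT_comp => //; exact: measurable_mslope.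
Qed.

Lemma EE_bwdM k (phi : R -> R) : (0 < k)%N -> measurable_fun setT phi ->
  EE P (fun w => phi (bwdM k w)) =
  EE P (fun w => phi (mslope (path_of X w) k.-1)).
Proof.
(* The reversal of 0, ..., k-1, extended to an injection of all indices by moving the others beyond
   2k. *)
move=> k0 mphi; pose f i := if (i < k)%N then (k.-1 - i)%N else (i + k)%N.
rewrite -(@EE_relabel f (fun x => phi (mslope x k.-1))); last 2 first.
- by rewrite /f => i j; case: (ltnP i k); case: (ltnP j k); lia.
- by apply: measurableT_comp => //; exact: measurable_mslope.
apply: eq_EE => w; congr phi; apply: eq_mslope => i ik.
by rewrite /bwd /path_of /f ifT//; lia.
Qed.

Lemma indep_fwdM_bwdM n k : (0 < k)%N -> indep2 P (fwdM n k) (bwdM k).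
Proof.
move=> k0; have [indX _] := iidX.
apply: (@indep2_blocks _ _ _ _ X indX (fun i => (k < i)%N) _ _ _ _
  (fun x : seqsp R => mslope (fwd x k) (n - k))
  (fun x : seqsp R => mslope (bwd x k) k.-1)).
- by apply: measurable_mslope => i; exact: mcoord.
- by apply: measurable_mslope => i; exact: mcoord.
- by move=> x; apply: eq_mslope => i _; rewrite /fwd /mask ifT//; lia.
- by move=> x; apply: eq_mslope => i _; rewrite /bwd /mask ifT//=; lia.
Qed.

Lemma indep_coord_gap n k : (0 < k)%N ->
  indep2 P (fun w => - X k w) (fun w => (fwdM n k w, bwdM k w)).
Proof.
move=> k0; have [indX _] := iidX.
apply: (@indep2_blocks _ _ _ _ X indX (pred1 k) _ _ _ _
  (fun x : seqsp R => - x k)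
  (fun x : seqsp R => (mslope (fwd x k) (n - k), mslope (bwd x k) k.-1))).
- by apply: measurableT_comp => //; exact: mcoord.
- by apply: measurable_fun_pair; apply: measurable_mslope => i; exact: mcoord.
- by move=> x; rewrite /mask /= eqxx.
- move=> x; congr pair; apply: eq_mslope => i _; rewrite /fwd /bwd /mask ifT//=;
    by apply/eqP; lia.
Qed.

Lemma indep_coord (phi : seqsp R -> R) k : measurable_fun setT phi ->
  (forall x, phi (mask (predC (pred1 k)) x) = phi x) ->
  indep2 P (X k) (fun w => phi (path_of X w)).
Proof.
move=> mphi phik; have [indX _] := iidX.
apply: (@indep2_blocks _ _ _ _ X indX (pred1 k) _ _ _ _ (fun x : seqsp R => x k)) => //.
by move=> x; rewrite /mask /= eqxx.
Qed.

Section integrable_walk.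
Hypothesis IX : integ P (X 0%N).

Lemma integ_gap n k : integ P (fun w => gap (path_of X w) n k).
Proof.
have IXk : integ P (fun w => `|X k w|).
  apply: (@integ_coord k Num.norm) => //; exact: integ_norm.
apply: le_integ IXk _.
  under eq_fun do rewrite gapE.
  apply: measurable_maxr => //; apply: measurable_funB; last exact: measurable_bwdM.
  apply: measurable_funB; last exact: measurable_fwdM.
  by apply: measurableT_comp.
move=> w; rewrite ger0_norm ?gap_ge0// gapE ge_max normr_ge0/=.
have := mslope_ge0 (fwd (path_of X w) k) (n - k).
have := mslope_ge0 (bwd (path_of X w) k) k.-1.
by have := ler_norm (- path_of X w k); rewrite normrN /path_of; lra.
Qed.

Lemma EE_gap_ge n k : (0 < k)%N ->
  EE P (fun w => Num.max 0 (- X 0%N w)) * (stay0 (n - k) * stay0 k.-1) <=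
  EE P (fun w => gap (path_of X w) n k).
Proof.
move=> k0.
have mneg : measurable_fun setT (fun x : R => Num.max 0 (- x)).
  by apply: measurable_maxr => //; exact: measurable_funN.
have mle0 : measurable_fun setT (fun m : R => (m <= 0)%R%:R : R).
  by apply: measurable_bool; apply: measurable_fun_ler.
have I1 : integ P (fun w => Num.max 0 (- X 0%N w)) by apply: integ_max0; exact: integN.
have Ik : integ P (fun w => Num.max 0 (- X k w)).
  exact: (@integ_coord k (fun x => Num.max 0 (- x))).
have If : integ P (fun w => (fwdM n k w <= 0)%R%:R).
  by apply: integ_ind_mslope => i; exact: mX.
have Ib : integ P (fun w => (bwdM k w <= 0)%R%:R).
  by apply: integ_ind_mslope => i; exact: mX.
have [Ifb Efb] := EE_indepM (indep2_comp mle0 mle0 (indep_fwdM_bwdM n k0)) If Ib.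
have mprod : measurable_fun setT (fun z : R * R => (z.1 <= 0)%R%:R * (z.2 <= 0)%R%:R : R).
  by apply: measurable_funM; apply: (measurableT_comp mle0).
have mp0 : measurable_fun setT (fun z : R => Num.max 0 z) by apply: measurable_maxr.
have [Ig Eg] := EE_indepM (indep2_comp mp0 mprod (indep_coord_gap n k0)) Ik Ifb.
rewrite -(EE_coord k mneg).
rewrite -!EE_stay0 -(EE_fwdM n k mle0) -(EE_bwdM k0 mle0) -Efb -Eg.
apply: le_EE => //; first exact: integ_gap.
move=> w /=; rewrite gapE /fwdM /bwdM /path_of.
case: (leP (mslope (fwd _ _) _) 0) => h1; last by rewrite mul0r mulr0 le_max lexx.
case: (leP (mslope (bwd _ _) _) 0) => h2; last by rewrite !mulr0 le_max lexx.
rewrite !mulr1 ge_max !le_max lexx /=; apply/orP; right.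
have := mslope_ge0 (fwd (path_of X w) k) (n - k).
have := mslope_ge0 (bwd (path_of X w) k) k.-1.
rewrite /path_of; lra.
Qed.

End integrable_walk.

Lemma persist2E n : persist2 X n.+1 =
  fine (P [set w | mslope (fun i => path_of X w i.+1) n < - X 0%N w]).
Proof.
rewrite /persist2; congr (fine (P _)); apply/seteqP; split=> w /=.
  move=> h; apply/area_neg_mslope => k kn; apply: le_lt_trans h.
  apply: (@le_bigmax_seq _ _ _ _ _ k xpredT (fun k => ipsum X k w)) => //.
  by rewrite mem_index_iota.
move=> /area_neg_mslope h; rewrite big_nat_cond; apply: bigmax_lt.
  exact: (h 1%N).
by move=> k; rewrite andbT; exact: h.
Qed.

Lemma persist2_le n : persist2 X n.+1 <= stay0 n.+1.
Proof.
rewrite persist2E -EE_stay0 -EE_bool; last first.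
  by apply: measurable_fun_ltr; [apply: measurable_mslope => i; exact: mX|exact: measurable_funN].
apply: le_EE.
- apply: integ_bool; apply: measurable_fun_ltr; last exact: measurable_funN.
  by apply: measurable_mslope => i; exact: mX.
- exact: integ_ind_mslope.
- move=> w; case: (ltP (mslope _ n) _) => h; last by rewrite ler_nat.
  suff -> : mslope (path_of X w) n.+1 <= 0 by [].
  apply/mslope_leP => -[|m] mn.
    by rewrite area0 mulr0.
  rewrite mulr0; apply/ltW.
  by move/(area_neg_mslope (path_of X w) n): h => /(_ m.+1); apply; lia.
Qed.

Lemma indep_head a : indep2 P (fun w => - X 0%N w)
  (fun w => mslope (fun i => path_of X w i.+1) a).
Proof.
have [indX _] := iidX.
apply: (@indep2_blocks _ _ _ _ X indX (pred1 0%N) _ _ _ _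
  (fun x : seqsp R => - x 0%N) (fun x : seqsp R => mslope (fun i => x i.+1) a)).
- by apply: measurableT_comp => //; exact: mcoord.
- by apply: measurable_mslope => i; exact: mcoord.
- by [].
- by move=> x; apply: eq_mslope => i _.
Qed.

Lemma EE_tail_mslope a (phi : R -> R) : measurable_fun setT phi ->
  EE P (fun w => phi (mslope (fun i => path_of X w i.+1) a)) =
  EE P (fun w => phi (mslope (path_of X w) a)).
Proof.
move=> mphi; apply: (@EE_relabel S (fun x => phi (mslope x a))).
  exact: succn_inj.
by apply: measurableT_comp => //; exact: measurable_mslope.
Qed.

(** A negative first increment followed by a path whose areas stay nonpositive makes every area
    negative, and the two events are independent. This passes from the weak inequality in F to the
    strict one in p at the price of one index and a constant. *)
Lemma persist2_ge n : fine (P [set w | 0 < - X 0%N w]) * stay0 n <= persist2 X n.+1.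
Proof.
have mtail : measurable_fun setT (fun w => mslope (fun i => path_of X w i.+1) n).
  by apply: measurable_mslope => i; exact: mX.
have mN : measurable_fun setT (fun w => - X 0%N w) by exact: measurable_funN.
have mgt0 : measurable_fun setT (fun m : R => (0 < m)%R%:R : R).
  by apply: measurable_bool; apply: measurable_fun_ltr.
have mle0 : measurable_fun setT (fun m : R => (m <= 0)%R%:R : R).
  by apply: measurable_bool; apply: measurable_fun_ler.
have I1 : integ P (fun w => (0 < - X 0%N w)%R%:R).
  by apply: integ_bool; apply: measurable_fun_ltr.
have I2 : integ P (fun w => (mslope (fun i => path_of X w i.+1) n <= 0)%R%:R).
  by apply: integ_ind_mslope => i; exact: mX.
have I3 : integ P (fun w => (mslope (fun i => path_of X w i.+1) n < - X 0%N w)%R%:R).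
  by apply: integ_bool; apply: measurable_fun_ltr.
have [I4 E4] := EE_indepM (indep2_comp mgt0 mle0 (indep_head n)) I1 I2.
rewrite -EE_bool; last by apply: measurable_fun_ltr.
rewrite persist2E -EE_bool; last by apply: measurable_fun_ltr.
rewrite -EE_stay0 -(EE_tail_mslope n mle0) -E4; apply: le_EE => // w /=.
case: (leP (mslope _ n) 0) => h; last by rewrite mulr0.
by case: (ltP 0 (- X 0%N w)) => h'; rewrite ?mul0r// (le_lt_trans h h') mulr1.
Qed.

End iid_walk.

Section null_expect.
Context d (T : measurableType d) (R : realType) (P : probability T R).

Lemma ge0_EE_null (f : T -> R) : integ P f -> (forall w, 0 <= f w) ->
  fine (P [set w | 0 < f w]) = 0 -> EE P f = 0.
Proof.
move=> If f0 P0; have mf := integ_measurable If.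
have mN : measurable [set w | 0 < f w].
  by apply: measurable_setbool; apply: measurable_fun_ltr.
apply: EE_of_int; rewrite (@ae_eq_integral _ _ _ P setT (cst 0%E)) ?integral0//.
  exact/measurable_EFinP.
exists [set w | 0 < f w]; split => //.
  by apply: etrans (esym (Efine_P P mN)) _; rewrite P0.
move=> w /= h; rewrite ltNge; apply/negP => fw; apply: h => _ /=.
by congr EFin; apply/le_anti; rewrite fw f0.
Qed.

Lemma EE_norm_gt0 (f : T -> R) : integ P f ->
  ~ {ae P, forall w, f w = 0} -> 0 < EE P (fun w => `|f w|).
Proof.
move=> If nae; rewrite lt_neqAle EE_ge0 ?andbT//; apply/eqP => E0; apply: nae.
have mf := integ_measurable If.
have /(ae_eq_integral_abs P measurableT) : measurable_fun setT (EFin \o f).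
  exact/measurable_EFinP.
case=> h _; have := h _; rewrite /= => {}h.
have : ae_eq P setT (EFin \o f) (cst 0%E).
  by apply: h; rewrite -EE_EFin -?E0//; exact: integ_norm.
by apply: filterS => w /(_ I) [].
Qed.

Lemma EE_parts (f : T -> R) : integ P f -> EE P f = 0 ->
  EE P (fun w => Num.max 0 (- f w)) = EE P (fun w => `|f w|) / 2 /\
  EE P (fun w => Num.max 0 (f w)) = EE P (fun w => `|f w|) / 2.
Proof.
move=> If f0.
have I1 : integ P (fun w => Num.max 0 (- f w)) by apply: integ_max0; exact: integN.
have I2 : integ P (fun w => Num.max 0 (f w)) by exact: integ_max0.
have e1 : EE P (fun w => `|f w|) =
    EE P (fun w => Num.max 0 (f w)) + EE P (fun w => Num.max 0 (- f w)).
  rewrite -EE_D//; apply: eq_EE => w.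
  by case: (ger0P (f w)) => ?; case: (leP 0 (f w)) => ?; case: (leP 0 (- f w)) => ?; lra.
have : EE P f = EE P (fun w => Num.max 0 (f w)) - EE P (fun w => Num.max 0 (- f w)).
  rewrite -EE_B//; apply: eq_EE => w.
  case: (leP 0 (f w)); case: (leP 0 (- f w)) => h1 h2; lra.
lra.
Qed.

End null_expect.

(** * Discrete layer-cake bounds *)

Section level_counting.
Variable R : realType.

(** Counting the integer levels below z replaces the integral of a tail by a sum of tails. The
    converse bound, with an additive 1, follows. *)
Lemma pos_le_level_count (z : R) n :
  Num.min (Num.max 0 z) n%:R <= \sum_(0 <= j < n) (j%:R < z)%R%:R.
Proof.
elim: n => [|n IH]; first by rewrite big_geq// ge_min lexx orbT.
rewrite big_nat_recr//= -natr1.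
case: (ltP n%:R z) => h.
  move: IH; rewrite !minEle; case: ifP; case: ifP; rewrite -?natr1; lra.
rewrite addr0; apply: le_trans IH; rewrite le_min !ge_min lexx /=.
by have n0 : 0 <= n%:R :> R by []; case: (leP 0 z); lra.
Qed.

Lemma level_count_le (z : R) n :
  \sum_(0 <= j < n) (j%:R < z)%R%:R <= 1 + Num.max 0 z.
Proof.
have key k : \sum_(0 <= j < k) (j%:R < z)%R%:R <= k%:R :> R.
  elim: k => [|k IH]; first by rewrite big_geq.
  by rewrite big_nat_recr//= -natr1; apply: lerD => //; case: (_ < _).
elim: n => [|n IH]; first by rewrite big_geq// addr_ge0// le_max lexx.
case: (ltP n%:R z) => h; last by rewrite big_nat_recr//= ltNge h addr0.
apply: le_trans (key n.+1) _; rewrite -natr1 addrC lerD2l le_max.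
by rewrite (ltW h) orbT.
Qed.

End level_counting.

(** * Upper bound on the mean gap under the tail condition *)

Section tail_bound.
Context d (T : measurableType d) (R : realType) (P : probability T R).
Variable X : nat -> {RV P >-> R}.
Hypotheses (iidX : iid X) (IX : integ P (X 0%N)).
Variables (r theta K L : R).
Hypotheses (r0 : 0 < r) (theta_r : 1 / r < theta).
Hypothesis rho1 : ltail (X 0%N) r < 1.
Hypothesis tail_submul : forall t s : R, 0 < t -> 0 < s ->
      ltail (X 0%N) (t + s) <=
        K * ltail (X 0%N) t * ltail (X 0%N) s
        + L * ltail (X 0%N) r `^ (theta * (t + s)).

Let Z w := - X 0%N w.
Let G := ltail (X 0%N).
Let rho := G r.
(* Adding [phi] to the tail absorbs the error term of the tail condition:
   [h] is submultiplicative up to a constant, see [h_submul]. *)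
Let phi (t : R) := rho `^ (theta * t).
Let h t := G t + phi t.
Let mZ : measurable_fun setT Z.
Proof. exact: measurable_funN. Qed.

Let theta0 : 0 < theta.
Proof. by apply: lt_trans theta_r; rewrite divr_gt0. Qed.

Lemma ltail_EE t : ltail (X 0%N) t = EE P (fun w => (t < - X 0%N w)%R%:R).
Proof. by rewrite EE_bool//; apply: measurable_fun_ltr => //; exact: measurable_cst. Qed.

Let G0 t : 0 <= G t. Proof. exact: fine_ge0. Qed.

Let G_mono : {homo G : s t /~ s <= t}.
Proof.
move=> s t st; rewrite /G !ltail_EE; apply: le_EE.
- by apply: integ_bool; apply: measurable_fun_ltr => //; exact: measurable_cst.
- by apply: integ_bool; apply: measurable_fun_ltr => //; exact: measurable_cst.
- move=> w; case: (ltP s) => hs; first by rewrite (le_lt_trans st hs).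
  by rewrite ler_nat.
Qed.

Let G1 t : G t <= 1.
Proof.
rewrite /G ltail_EE -[leRHS](EE_cst P 1); apply: le_EE.
- by apply: integ_bool; apply: measurable_fun_ltr => //; exact: measurable_cst.
- exact: integ_cst.
- by move=> w; case: (_ < _).
Qed.

Let phi0 t : 0 <= phi t. Proof. exact: powR_ge0. Qed.
Let phi00 : phi 0 = 1. Proof. by rewrite /phi mulr0 powRr0. Qed.

Let phiD t s : 0 <= t -> 0 <= s -> phi (t + s) = phi t * phi s.
Proof.
move=> t0 s0; have [e|e] := eqVneq (t + s) 0.
  have -> : t = 0 by lra.
  have -> : s = 0 by lra.
  by rewrite addr0 phi00 mulr1.
rewrite /phi mulrDr powRD//; apply/implyP; rewrite -mulrDr mulf_eq0 (negbTE e) orbF.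
by rewrite gt_eqF.
Qed.

Let rho0 : 0 <= rho. Proof. exact: G0. Qed.

Let phi_lt1 : phi 1 < 1.
Proof.
rewrite /phi mulr1; have [->|re] := eqVneq rho 0; first by rewrite powR0 ?gt_eqF.
have e1 : 1 `^ theta = 1 :> R by rewrite powR1.
rewrite -[ltRHS]e1.
by apply: gt0_ltr_powR => //; rewrite nnegrE.
Qed.

Let phi_le1 t : 0 <= t -> phi t <= 1.
Proof.
move=> t0; rewrite /phi; have [->|re] := eqVneq rho 0.
  by rewrite /powR eqxx; case: (_ == _).
rewrite -(powRr0 rho); apply: ger_powR; last by rewrite mulr_ge0// ltW.
by rewrite lt_neqAle eq_sym re rho0 ltW.
Qed.

Let mphi : measurable_fun setT phi.
Proof.
apply: (measurableT_comp (measurable_powRr rho)).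
by apply: measurable_funM => //; exact: measurable_cst.
Qed.

Let mG : measurable_fun setT G.
Proof. by apply: nonincreasing_measurable => // s t; exact: G_mono. Qed.

Let mh : measurable_fun setT h. Proof. exact: measurable_funD. Qed.

Let h0 t : 0 <= h t. Proof. exact: addr_ge0. Qed.

Let h_le2 t : 0 <= t -> h t <= 2.
Proof. by move=> t0; have := G1 t; have := phi_le1 t0; rewrite /h; lra. Qed.

Let C1 := `|K| + `|L| + 1.

Let C1_ge1 : 1 <= C1.
Proof. by have := normr_ge0 K; have := normr_ge0 L; rewrite /C1; lra. Qed.

Let h_submul t s : 0 <= t -> 0 <= s -> h (t + s) <= C1 * (h t * h s).
Proof.
(* The tail condition concerns positive arguments; at 0 the bound comes from [h 0 >= 1] and
   [C1 >= 1]. *)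
have h0_ge1 : 1 <= h 0 by rewrite /h phi00; have := G0 0; lra.
have zero u : h u <= C1 * (h 0 * h u).
  have h1 : h u <= h 0 * h u by rewrite ler_peMl.
  by apply: le_trans h1 _; rewrite ler_peMl// mulr_ge0.
move=> t_ge0 s_ge0.
have [->|tn] := eqVneq t 0; first by rewrite add0r.
have [->|sn] := eqVneq s 0; first by rewrite addr0 [h t * _]mulrC.
have t0 : 0 < t by rewrite lt_neqAle eq_sym tn.
have s0 : 0 < s by rewrite lt_neqAle eq_sym sn.
have := tail_submul t0 s0; rewrite -/G -/rho -/(phi (t + s)) phiD// => le1.
have a1 : K * G t * G s <= `|K| * (G t * G s).
  by rewrite -mulrA ler_wpM2r ?mulr_ge0// ler_norm.
have a2 : L * (phi t * phi s) <= `|L| * (phi t * phi s).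
  by rewrite ler_wpM2r ?mulr_ge0// ler_norm.
rewrite /h phiD//.
have g1 : 0 <= G t * G s by rewrite mulr_ge0.
have g2 : 0 <= phi t * phi s by rewrite mulr_ge0.
have g3 : 0 <= G t * phi s by rewrite mulr_ge0.
have g4 : 0 <= phi t * G s by rewrite mulr_ge0.
have e : (G t + phi t) * (G s + phi s) =
   G t * G s + phi t * phi s + (G t * phi s + phi t * G s) by ring.
rewrite e /C1; move: le1 a1 a2.
set u := G t * G s in g1 *; set v := phi t * phi s in g2 *.
set p := G t * phi s in g3 *; set q := phi t * G s in g4 *.
have := normr_ge0 K; have := normr_ge0 L; set k := `|K|; set l := `|L| => l0 k0 *.
have : 0 <= k * v by exact: mulr_ge0.
have : 0 <= l * u by exact: mulr_ge0.
have : 0 <= (k + l + 1) * (p + q) by apply: mulr_ge0; lra.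
lra.
Qed.

Let integ_level c j : integ P (fun w => (c + j%:R < Z w)%R%:R).
Proof. by apply: integ_bool; apply: measurable_fun_ltr => //; exact: measurable_cst. Qed.

(** A bound for the sum of [h] over the integers: level counting handles the tail [G], and [phi]
    gives a geometric series of ratio [phi 1 < 1]. *)
Let Hs := 1 + EE P (fun w => Num.max 0 (Z w)) + (1 - phi 1)^-1.

Let sum_h n : \sum_(0 <= j < n) h j%:R <= Hs.
Proof.
rewrite /h big_split/=; apply: lerD.
  have IZ : integ P (fun w => 1 + Num.max 0 (Z w)).
    by apply: integD; [exact: integ_cst|apply: integ_max0; exact: integN].
  have -> : 1 + EE P (fun w => Num.max 0 (Z w)) = EE P (fun w => 1 + Num.max 0 (Z w)).
    by rewrite EE_D ?EE_cst//; [exact: integ_cst|apply: integ_max0; exact: integN].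
  have Ij j : (0 <= j < n)%N -> integ P (fun w => (j%:R < Z w)%R%:R).
    by have := integ_level 0 j; under eq_fun do rewrite add0r.
  have [Is Es] := integ_sum Ij.
  under eq_bigr do rewrite /G ltail_EE.
  by rewrite -Es; apply: le_EE => // w; exact: level_count_le.
have phiX j : phi j%:R = phi 1 ^+ j.
  elim: j => [|j IH]; first by rewrite phi00 expr0.
  by rewrite -natr1 phiD// IH exprSr.
under eq_bigr do rewrite phiX.
have key : (\sum_(0 <= j < n) phi 1 ^+ j) * (1 - phi 1) = 1 - phi 1 ^+ n.
  elim: n => [|n IH]; first by rewrite big_geq// mul0r expr0 subrr.
  by rewrite big_nat_recr//= mulrDl IH exprS; ring.
have p1 : 0 < 1 - phi 1 by rewrite subr_gt0.
rewrite -[leRHS]mul1r ler_pdivlMr// key.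
by have := exprn_ge0 n (phi0 1); lra.
Qed.

(** The mean is at most the sum of the tails at c + j, and submultiplicativity pulls [h c] out of
    that sum. *)
Let overshoot c : 0 <= c ->
  EE P (fun w => Num.max 0 (Z w - c)) <= C1 * Hs * h c.
Proof.
move=> c0.
have If : integ P (fun w => Num.max 0 (Z w - c)).
  by apply: integ_max0; apply: integB; [exact: integN|exact: integ_cst].
have ml j : measurable_fun setT (fun w => (j%:R < Z w - c)%R%:R : R).
  by apply: measurable_bool; apply: measurable_fun_ltr => //; apply: measurable_funB.
have Il j : integ P (fun w => (j%:R < Z w - c)%R%:R).
  by apply: integ_bool; apply: measurable_fun_ltr => //; apply: measurable_funB.
have El j : EE P (fun w => (j%:R < Z w - c)%R%:R) = G (c + j%:R).
  by rewrite /G ltail_EE; apply: eq_EE => w; rewrite ltrBrDl.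
rewrite -lee_fin EE_EFin//.
apply: (@le_trans _ _ (\int[P]_w (\sum_(0 <= j <oo) ((j%:R < Z w - c)%R%:R : R)%:E)))%E.
  apply: ge0_le_integral => //.
  - by move=> w _; rewrite lee_fin le_max lexx.
  - exact/measurable_EFinP/(integ_measurable If).
  - apply: ge0_emeasurable_sum => // j _; exact/measurable_EFinP.
  - move=> w _; set z := Z w - c.
    have [n zn] : exists n, Num.max 0 z <= n%:R.
      exists (Num.bound (Num.max 0 z)); apply/ltW/archi_boundP.
      by rewrite le_max lexx.
    apply: le_trans (nneseries_lim_ge n _); last by move=> *; rewrite lee_fin.
    rewrite sumEFin lee_fin; apply: le_trans (pos_le_level_count z n).
    by rewrite le_min lexx.
rewrite integral_nneseries//; last by move=> j; exact/measurable_EFinP.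
apply: lime_le.
  by apply: is_cvg_nneseries => j _ _; apply: integral_ge0 => w _; rewrite lee_fin.
apply: nearW => n.
rewrite (eq_bigr (fun j => (G (c + j%:R))%:E)); last first.
  by move=> j _; rewrite -EE_EFin// El.
rewrite sumEFin lee_fin.
apply: (@le_trans _ _ (\sum_(0 <= j < n) C1 * h c * h j%:R)).
  apply: ler_sum => j _; rewrite -mulrA.
  apply: le_trans (h_submul c0 (ler0n _ j)).
  by rewrite /h lerDl.
rewrite -mulr_sumr [leRHS]mulrAC ler_wpM2l//.
by rewrite mulr_ge0//; have := C1_ge1; lra.
Qed.

Let integ_phiM a : integ P (fun w => phi (mslope (path_of X w) a)).
Proof.
apply: (@integ_bounded _ _ _ _ _ 1).
  apply: measurableT_comp => //; apply: measurable_mslope => i; exact: measurable_funP.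
by move=> w; rewrite ger0_norm// phi_le1// mslope_ge0.
Qed.

Let integ_GM a : integ P (fun w => G (mslope (path_of X w) a)).
Proof.
apply: (@integ_bounded _ _ _ _ _ 1).
  apply: measurableT_comp => //; apply: measurable_mslope => i; exact: measurable_funP.
by move=> w; rewrite ger0_norm.
Qed.

Let mtail a : measurable_fun setT (fun w => mslope (fun i => path_of X w i.+1) a).
Proof. by apply: measurable_mslope => i; exact: measurable_funP. Qed.

(** Reading [G] as the conditional probability that a fresh increment in front beats the maximal
    slope, the mean is exactly the persistence probability of order a+1. *)
Let EE_GM a : EE P (fun w => G (mslope (path_of X w) a)) <= stay0 X a.
Proof.
rewrite -(EE_tail_mslope iidX a mG).
have mf : measurable_fun setT (fun z : R * R => (z.2 < z.1)%R%:R : R).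
  by apply: measurable_bool; exact: measurable_fun_ltr.
have E := @EE_tonelli _ _ _ P _ _ _ _ _ _ _ mZ (mtail a) (indep_head iidX a) mf
  (fun z => ler0n _ _)
  (fun w' => integ_bool P (measurable_fun_ltr (measurable_cst _) mZ)).
rewrite (_ : EE P _ = EE P (fun w => (mslope (fun i => path_of X w i.+1) a < Z w)%R%:R)).
  rewrite EE_bool; last by apply: measurable_fun_ltr.
  rewrite -(persist2E X a); apply: le_trans (persist2_le X a) _.
  exact: stay0_mono.
rewrite {2}/EE /Rintegral; rewrite /= in E; rewrite E -/(Rintegral _ _ _).
by apply: eq_EE => w; rewrite /G ltail_EE.
Qed.

(* Prefixing an increment below [-r] lowers the maximal slope by [r]: this has
   probability [rho] but multiplies [phi] by [1 / phi r], where
   [phi r < rho] because [theta * r > 1]. Hence the mean of [phi] is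
   controlled by the event that the maximal slope is at most [r], and the same
   prefix compares that event with [stay0]. *)
Let EE_phiM : exists C, 0 <= C /\
  forall a, EE P (fun w => phi (mslope (path_of X w) a)) <= C * stay0 X a.
Proof.
have [rhoE|rho_neq0] := eqVneq rho 0.
  (* Here [phi] is the indicator of 0 on nonnegative arguments, because 0 to the power 0 is 1. *)
  exists 1; split => // a; rewrite mul1r -EE_stay0; apply: le_EE => //.
    by apply: integ_ind_mslope => i; exact: measurable_funP.
  move=> w; rewrite /phi rhoE; case: (leP (mslope _ a) 0) => hm.
    by rewrite -rhoE phi_le1 ?mslope_ge0.
  by rewrite powR0// gt_eqF// mulr_gt0.
have rho_gt0 : 0 < rho by rewrite lt_neqAle eq_sym rho_neq0.
pose kap := rho / phi r.
have phir : 0 < phi r by rewrite powR_gt0.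
have kap1 : 1 < kap.
  rewrite /kap ltr_pdivlMr// mul1r.
  have -> : rho = rho `^ 1 by rewrite powRr1.
  have e : 1 < theta * r by move: theta_r; rewrite ltr_pdivrMr.
  rewrite /phi /powR gt_eqF// ltr_expR ltr_nM2r//; apply: ln_lt0.
  by rewrite rho_gt0; exact: rho1.
(* With E the mean of [phi] and Q the probability of a slope at most r, the constant solves
   [kap * (E - Q) <= E] for E and then uses [rho * Q <= stay0 X a]. *)
exists (kap / ((kap - 1) * rho)); split.
  by apply: divr_ge0; [lra|apply: mulr_ge0 => //; lra].
move=> a.
have IX0 : integ P (fun w => (r < Z w)%R%:R).
  by apply: integ_bool; apply: measurable_fun_ltr => //; exact: measurable_cst.
have mlt : measurable_fun setT (fun z : R => (r < z)%R%:R : R).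
  by apply: measurable_bool; apply: measurable_fun_ltr => //; exact: measurable_cst.
have mle : measurable_fun setT (fun z : R => (z <= r)%R%:R : R).
  by apply: measurable_bool; apply: measurable_fun_ler => //; exact: measurable_cst.
have Ile (g : T -> nat -> R) : (forall i, measurable_fun setT (fun t => g t i)) ->
    integ P (fun w => (mslope (g w) a <= r)%R%:R).
  by move=> mg; exact: integ_ind_mslope.
have le_r : rho * EE P (fun w => (mslope (path_of X w) a <= r)%R%:R) <= stay0 X a.
  rewrite -(EE_tail_mslope iidX a mle).
  have [Ip Ep] := EE_indepM (indep2_comp mlt mle (indep_head iidX a)) IX0
     (Ile _ (fun i => measurable_funP (X i.+1))).
  rewrite /rho /G ltail_EE -Ep; apply: le_trans (stay0_mono X (leqnSn a)).
  rewrite -EE_stay0; apply: le_EE => //.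
    by apply: integ_ind_mslope => i; exact: measurable_funP.
  move=> w /=; case: (ltP r) => hr; last by rewrite mul0r.
  case: (leP _ r) => hm; last by rewrite mulr0.
  suff -> : mslope (path_of X w) a.+1 <= 0 by rewrite mulr1.
  apply: (@mslope_head_step _ _ a r) => //; last by rewrite add0r.
  by rewrite /path_of; move: hr; rewrite /Z; lra.
pose phi' (m : R) := phi (Num.max 0 (m - r)).
have mphi' : measurable_fun setT phi'.
  apply: measurableT_comp => //; apply: measurable_maxr => //.
  by apply: measurable_funB => //; exact: measurable_cst.
have Iphi' (g : T -> nat -> R) : (forall i, measurable_fun setT (fun t => g t i)) ->
    integ P (fun w => phi' (mslope (g w) a)).
  move=> mg; apply: (@integ_bounded _ _ _ _ _ 1).
    by apply: measurableT_comp => //; exact: measurable_mslope.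
  by move=> w; rewrite /phi' ger0_norm// phi_le1// le_max lexx.
have phi_mono s t : s <= t -> phi t <= phi s.
  move=> st; apply: ger_powR; first by rewrite rho_gt0 ltW.
  by rewrite ler_pM2l.
have step : rho * EE P (fun w => phi' (mslope (path_of X w) a)) <=
    EE P (fun w => phi (mslope (path_of X w) a)).
  rewrite -(EE_tail_mslope iidX a mphi').
  have [Ip Ep] := EE_indepM (indep2_comp mlt mphi' (indep_head iidX a)) IX0
     (Iphi' _ (fun i => measurable_funP (X i.+1))).
  rewrite {1}/rho {1}/G ltail_EE -Ep.
  apply: (@le_trans _ _ (EE P (fun w => phi (mslope (path_of X w) a.+1)))); last first.
    by apply: le_EE => // w; apply: phi_mono; exact: mslope_mono.
  apply: le_EE => // w /=; case: (ltP r) => hr; last by rewrite mul0r.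
  rewrite mul1r; apply: phi_mono.
  apply: (@mslope_head_step _ _ a r); first by rewrite le_max lexx.
  - by rewrite /path_of; move: hr; rewrite /Z; lra.
  - by rewrite -lerBlDr le_max lexx orbT.
(* Above the level r, [phi] is [phi r] times [phi']; below it, [phi] is at most 1. *)
have lower : (EE P (fun w => phi (mslope (path_of X w) a)) -
    EE P (fun w => (mslope (path_of X w) a <= r)%R%:R)) / phi r <=
    EE P (fun w => phi' (mslope (path_of X w) a)).
  rewrite ler_pdivrMr// mulrC -EE_Z; last by apply: Iphi' => i; exact: measurable_funP.
  rewrite -EE_B//; last by apply: Ile => i; exact: measurable_funP.
  apply: le_EE.
  - by apply: integB => //; apply: Ile => i; exact: measurable_funP.
  - by apply: integZ; apply: Iphi' => i; exact: measurable_funP.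
  - move=> w; rewrite /phi'; have m0 := mslope_ge0 (path_of X w) a.
    case: (leP (mslope _ a) r) => hm.
      apply: (@le_trans _ _ 0); last by rewrite mulr_ge0.
      by rewrite subr_le0 phi_le1.
    rewrite subr0 max_r ?subr_ge0 ?(ltW hm)// -phiD ?subr_ge0 ?(ltW hm) ?(ltW r0)//.
    by rewrite [r + _]addrC subrK.
set E := EE P (fun w => phi _) in step lower *.
set Q := EE P (fun w => (_ <= r)%R%:R) in le_r lower *.
have l1 : kap * (E - Q) <= E.
  apply: le_trans step; rewrite /kap -mulrA ler_pM2l// mulrC; exact: lower.
have l2 : (kap - 1) * E <= kap * Q by rewrite mulrBl mul1r; move: l1; rewrite mulrBr; lra.
have d0 : 0 < (kap - 1) * rho by rewrite mulr_gt0// subr_gt0.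
rewrite mulrAC ler_pdivlMr//.
have l3 : rho * ((kap - 1) * E) <= rho * (kap * Q) by rewrite ler_wpM2l.
have l4 : kap * (rho * Q) <= kap * stay0 X a by rewrite ler_wpM2l//; lra.
lra.
Qed.

(** Given both maximal slopes, the mean gap is an overshoot over their sum. It is at most a constant
    times [h] of each slope; these two factors are independent, and each has mean of the order of
    [stay0]. *)
Lemma EE_gap_le : exists C, 0 < C /\ forall n k, (0 < k)%N ->
  EE P (fun w => gap (path_of X w) n k) <= C * (stay0 X (n - k) * stay0 X k.-1).
Proof.
have [C3 [C30 phiM]] := EE_phiM.
have hM a : EE P (fun w => h (mslope (path_of X w) a)) <= (1 + C3) * stay0 X a.
  by rewrite EE_D// mulrDl mul1r; apply: lerD.
have Hs0 : 0 <= Hs.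
  by have := sum_h 0; rewrite big_geq.
pose C := C1 * Hs * C1.
have C0 : 0 <= C by rewrite /C !mulr_ge0//; have := C1_ge1; lra.
(* The summand 1 makes the constant positive. *)
exists (C * ((1 + C3) * (1 + C3)) + 1); split.
  have : 0 <= C * ((1 + C3) * (1 + C3)) by apply: mulr_ge0 => //; apply: mulr_ge0; lra.
  lra.
move=> n k k0.
have mZk : measurable_fun setT (fun w => - X k w) by exact: measurable_funN.
have mM : measurable_fun setT (fun w => (fwdM X n k w, bwdM X k w)).
  apply: measurable_fun_pair; [exact: measurable_fwdM|exact: measurable_bwdM].
pose f (z : R * (R * R)) : R := Num.max 0 (z.1 - (z.2.1 + z.2.2)).
have mf : measurable_fun setT f.
  apply: measurable_maxr => //; apply: measurable_funB => //.
  apply: measurable_funD; first by apply: (measurableT_comp measurable_fst).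
  by apply: (measurableT_comp measurable_snd).
have Ih (V : T -> R) : measurable_fun setT V -> (forall w, 0 <= V w) ->
    integ P (fun w => h (V w)).
  move=> mV V0; apply: (@integ_bounded _ _ _ _ _ 2); first exact: measurableT_comp.
  by move=> w; rewrite ger0_norm// h_le2.
have If0 : integ P (fun w => h (fwdM X n k w)).
  by apply: Ih; [exact: measurable_fwdM|move=> w; exact: mslope_ge0].
have Ib0 : integ P (fun w => h (bwdM X k w)).
  by apply: Ih; [exact: measurable_bwdM|move=> w; exact: mslope_ge0].
have [Ifb Efb] := EE_indepM (indep2_comp mh mh (indep_fwdM_bwdM iidX n k0)) If0 Ib0.
have IXk : integ P (fun w => - X k w).
  by apply: (@integ_coord _ _ _ _ _ iidX k -%R); [exact: measurable_funN|exact: integN].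
have fq w' : EE P (fun w => f (- X k w, (fwdM X n k w', bwdM X k w'))) <=
    C * (h (fwdM X n k w') * h (bwdM X k w')).
  have m1 : 0 <= fwdM X n k w' by exact: mslope_ge0.
  have m2 : 0 <= bwdM X k w' by exact: mslope_ge0.
  have mc : measurable_fun setT
      (fun x : R => Num.max 0 (- x - (fwdM X n k w' + bwdM X k w'))).
    apply: measurable_maxr => //; apply: measurable_funB => //; exact: measurable_funN.
  rewrite (EE_coord iidX k mc) /C -mulrA.
  apply: le_trans (overshoot (addr_ge0 m1 m2)) _.
  apply: ler_wpM2l; last exact: h_submul.
  by apply: mulr_ge0 => //; have := C1_ge1; lra.
have If w' : integ P (fun w => f (- X k w, (fwdM X n k w', bwdM X k w'))).
  exact: (integ_max0 (integB IXk (integ_cst P (fwdM X n k w' + bwdM X k w')))).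
have [_] := @EE_tonelli_le _ _ _ P _ _ _ _ _ _ _
  (fun w => C * (h (fwdM X n k w) * h (bwdM X k w)))
  mZk mM (indep_coord_gap iidX n k0) mf
  (fun z => ltac:(by rewrite le_max lexx)) If (integZ C Ifb) fq.
rewrite EE_Z// Efb (EE_fwdM iidX n k mh) (EE_bwdM iidX k0 mh).
rewrite (_ : EE P (fun w => f _) = EE P (fun w => gap (path_of X w) n k)); last first.
  by apply: eq_EE => w; rewrite gapE /f /= opprD addrA.
move/le_trans; apply.
set a := EE P _; set b := EE P (fun w => h (mslope _ k.-1)).
have a0 : 0 <= a by apply: EE_ge0.
have b0 : 0 <= b by apply: EE_ge0.
have s1 := stay0_ge0 X (n - k); have s2 := stay0_ge0 X k.-1.
have : a * b <= (1 + C3) * stay0 X (n - k) * ((1 + C3) * stay0 X k.-1).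
  by apply: ler_pM => //; exact: hM.
move=> /(ler_wpM2l C0) h1; apply: le_trans h1 _; rewrite mulrDl mul1r.
have : 0 <= stay0 X (n - k) * stay0 X k.-1 by exact: mulr_ge0.
lra.
Qed.

End tail_bound.

(** * Moments of random walks *)

Section path_inequalities.
Variable R : realType.
Implicit Types (x y z : nat -> R).

Lemma wsumN x n : wsum (fun i => - x i) n = - wsum x n.
Proof. by rewrite /wsum sumrN. Qed.

Lemma runmax_le_add x y z n : (forall i, x i <= y i + z i) ->
  (forall i, 0 <= z i) -> runmax x n <= runmax y n + wsum z n.
Proof.
move=> xyz z0.
have wz0 k : 0 <= wsum z k by apply: sumr_ge0 => i _.
have key k : wsum x k <= wsum y k + wsum z k.
  by rewrite /wsum -big_split/=; apply: ler_sum => i _; exact: xyz.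
elim: n => [|n IH]; first by rewrite /= wsum0 addr0.
rewrite /= ge_max; apply/andP; split.
  apply: le_trans IH _; rewrite [wsum z n.+1]wsumS; apply: lerD; first by rewrite le_max lexx.
  by rewrite lerDl.
by apply: le_trans (key n.+1) _; rewrite lerD2r le_max lexx orbT.
Qed.

Lemma runmax_le_norm x n : runmax x n <= wsum (fun i => `|x i|) n.
Proof.
have -> : wsum (fun i => `|x i|) n = runmax (fun=> 0) n + wsum (fun i => `|x i|) n.
  have -> : runmax (fun=> 0 : R) n = 0; last by rewrite add0r.
  elim: n => //= n ->; rewrite maxEle; case: ifP => // _.
  by rewrite /wsum big1.
by apply: runmax_le_add => i; rewrite ?add0r ?ler_norm.
Qed.

Lemma sum_gap_le_runmax x n : \sum_(1 <= k < n.+1) gap x n k <=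
  runmax x n.+1 + runmax (fun i => - x i) n.+1.
Proof.
rewrite -[X in _ + X]opprK; apply: sum_gap_le => j /andP[_ jn].
rewrite wsum_le_runmax// andbT lerNl -wsumN; exact: wsum_le_runmax.
Qed.

Lemma ravg_norm_le x n s : ravg Num.norm x n s <= `|s| + wsum (fun i => `|x i|) n.
Proof.
elim: n s => [|n IH] s /=; first by rewrite wsum0 addr0.
have h1 := IH (s + x n); have h2 := IH (s - x n); rewrite wsumS.
have := ler_normD s (x n); have := ler_normB s (x n); lra.
Qed.

End path_inequalities.

Section moments.
Context d (T : measurableType d) (R : realType) (P : probability T R).
Variable X : nat -> {RV P >-> R}.
Hypothesis iidX : iid X.

Let mX i : measurable_fun setT (X i).
Proof. exact: measurable_funP. Qed.

Let mcoordf (f : R -> R) i : measurable_fun setT f ->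
  measurable_fun setT (fun x : seqsp R => f (x i)).
Proof. by move=> mf; apply: measurableT_comp => //; exact: measurable_coord. Qed.

Lemma integ_wsum (f : R -> R) n : measurable_fun setT f ->
  integ P (fun w => f (X 0%N w)) ->
  integ P (fun w => wsum (fun i => f (X i w)) n) /\
  EE P (fun w => wsum (fun i => f (X i w)) n) = n%:R * EE P (fun w => f (X 0%N w)).
Proof.
move=> mf If.
have [I E] := @integ_sum _ _ _ P (fun i w => f (X i w)) 0%N n
  (fun i _ => @integ_coord _ _ _ _ _ iidX i f mf If).
split => //; rewrite E.
under eq_bigr do rewrite (EE_coord iidX _ mf).
by rewrite big_const_nat subn0 iter_addr_0 mulr_natl.
Qed.

(** An increment is independent of every functional of the earlier ones. [phi] acts on plain
    sequences, measurably along substitutions, so that combinations of [wsum] and [runmax] of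
    transformed increments fit. *)
Lemma EE_past_mul (f g : R -> R) (phi : (nat -> R) -> R) i :
  measurable_fun setT f -> measurable_fun setT g ->
  (forall (h : seqsp R -> seqsp R), (forall j, measurable_fun setT (fun x => h x j)) ->
     measurable_fun setT (fun x => phi (h x))) ->
  (forall x y, (forall j, (j < i)%N -> x j = y j) -> phi x = phi y) ->
  integ P (fun w => phi (fun j => g (X j w))) ->
  integ P (fun w => f (X 0%N w)) ->
  integ P (fun w => phi (fun j => g (X j w)) * f (X i w)) /\
  EE P (fun w => phi (fun j => g (X j w)) * f (X i w)) =
  EE P (fun w => phi (fun j => g (X j w))) * EE P (fun w => f (X 0%N w)).
Proof.
move=> mf mg mphi phiE Iphi If.
have ind := @indep_coord _ _ _ P X iidX (fun x => phi (fun j => g (x j))) i.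
have mphi' : measurable_fun setT (fun x : seqsp R => phi (fun j => g (x j))).
  by apply: (mphi (fun x j => g (x j))) => j; exact: mcoordf.
have {}ind := ind mphi' _.
have {}ind : indep2 P (X i) (fun w => phi (fun j => g (X j w))).
  by apply: ind => x; apply: phiE => j ji; rewrite /mask ifT//=; apply/eqP; lia.
have ind' := indep2_comp mf (@measurable_id _ _ setT) ind.
have [I E] := EE_indepM ind' (@integ_coord _ _ _ _ _ iidX i f mf If) Iphi.
split; first by under eq_fun do rewrite mulrC.
by under eq_EE do rewrite mulrC; rewrite E mulrC (EE_coord iidX i mf).
Qed.

Section maximal.
Variable f : R -> R.
Hypotheses (mf : measurable_fun setT f) (If : integ P (fun w => f (X 0%N w))).
Hypothesis If2 : integ P (fun w => f (X 0%N w) ^+ 2).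
Hypothesis Ef0 : EE P (fun w => f (X 0%N w)) = 0.

Let y w := fun i => f (X i w).
Let my i : measurable_fun setT (fun w => y w i).
Proof. exact: measurableT_comp. Qed.

Lemma integ_runmax n : integ P (fun w => runmax (y w) n).
Proof.
have [I _] := @integ_wsum (fun u => `|f u|) n (measurableT_comp (@normr_measurable _ setT) mf) (integ_norm If).
apply: le_integ I _; first exact: measurable_runmax.
by move=> w; rewrite ger0_norm ?runmax_ge0//; exact: runmax_le_norm.
Qed.

(** Taking means in [runmax_sqr_le] removes all terms past times present, as [f (X i)] is
    centered. *)
Lemma EE_runmax_sqr n :
  integ P (fun w => runmax (y w) n ^+ 2) /\
  EE P (fun w => runmax (y w) n ^+ 2) <= 4 * n%:R * EE P (fun w => f (X 0%N w) ^+ 2).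
Proof.
have mf2 : measurable_fun setT (fun u => f u ^+ 2) by exact: measurable_funX.
have [I1 E1] := integ_wsum n mf2 If2.
pose phi i (x : nat -> R) : R := 8 * wsum x i - 4 * runmax x i.
have cross i : integ P (fun w => phi i (y w) * f (X i w)) /\
    EE P (fun w => phi i (y w) * f (X i w)) = 0.
  have [|||I E] := @EE_past_mul f f (phi i) i mf mf _ _ _ If.
  - move=> h mh; apply: measurable_funB; apply: measurable_funM; try exact: measurable_cst.
      exact: measurable_wsum.
    exact: measurable_runmax.
  - by move=> x x' xx'; rewrite /phi (eq_wsum xx') (eq_runmax xx').
  - have [Iw _] := integ_wsum i mf If.
    by apply: integB; apply: integZ => //; exact: integ_runmax.
  - by split => //; rewrite E Ef0 mulr0.
have [I2 E2] := @integ_sum _ _ _ P (fun i w => phi i (y w) * f (X i w)) 0%N n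
  (fun i _ => (cross i).1).
rewrite big1_seq in E2; last by move=> i _; exact: (cross i).2.
have I3 := integD (integZ 4 I1) I2.
have le3 w : runmax (y w) n ^+ 2 <= 4 * wsum (fun i => f (X i w) ^+ 2) n +
  \sum_(0 <= i < n) phi i (y w) * f (X i w) by exact: runmax_sqr_le.
have I4 : integ P (fun w => runmax (y w) n ^+ 2).
  apply: le_integ I3 _; first by apply: measurable_funX; exact: measurable_runmax.
  by move=> w; rewrite ger0_norm ?sqr_ge0.
split => //; apply: le_trans (le_EE I4 I3 le3) _.
by rewrite EE_D ?EE_Z ?E1 ?E2 ?addr0 ?mulrA//; exact: integZ.
Qed.

(** From z <= z^2 / (2b) + b/2. The scale b is left free, to be matched with the order of the
    walk. *)
Lemma EE_runmax_le n (b : R) : 0 < b ->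
  EE P (fun w => runmax (y w) n) <=
  2 * n%:R * EE P (fun w => f (X 0%N w) ^+ 2) / b + b / 2.
Proof.
move=> b0; have [I E] := EE_runmax_sqr n.
have le1 : EE P (fun w => runmax (y w) n) <=
    EE P (fun w => (2 * b)^-1 * runmax (y w) n ^+ 2 + b / 2).
  apply: le_EE; [exact: integ_runmax|by apply: integD; [exact: integZ|exact: integ_cst]|].
  move=> w; set z := runmax _ _.
  have : z = (2 * b)^-1 * z ^+ 2 + b / 2 - (2 * b)^-1 * (z - b) ^+ 2.
    by field; lra.
  have : 0 <= (2 * b)^-1 * (z - b) ^+ 2.
    by rewrite mulr_ge0 ?sqr_ge0// invr_ge0; lra.
  lra.
apply: le_trans le1 _.
rewrite EE_D ?EE_cst ?EE_Z//; [|exact: integZ|exact: integ_cst].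
rewrite lerD2r; set s := EE P (fun w => f _ ^+ 2) in E *.
have -> : 2 * n%:R * s / b = (2 * b)^-1 * (4 * n%:R * s) by field; lra.
by rewrite ler_wpM2l// invr_ge0; lra.
Qed.

End maximal.

(* [u (X i)] plays the role of the truncated variable: it is centered and
   handled by Doob, while the remainder is summed in absolute value. *)
Lemma EE_runmax_trunc (f u : R -> R) n (b : R) : 0 < b ->
  measurable_fun setT f -> measurable_fun setT u ->
  integ P (fun w => f (X 0%N w)) -> EE P (fun w => f (X 0%N w)) = 0 ->
  integ P (fun w => u (X 0%N w)) -> integ P (fun w => u (X 0%N w) ^+ 2) ->
  integ P (fun w => runmax (fun i => f (X i w)) n) /\
  EE P (fun w => runmax (fun i => f (X i w)) n) <=
  2 * n%:R * EE P (fun w => u (X 0%N w) ^+ 2) / b + b / 2 +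
  2 * n%:R * EE P (fun w => `|f (X 0%N w) - u (X 0%N w)|).
Proof.
move=> b0 mf mu If Ef Iu Iu2.
set s := EE P (fun w => u _ ^+ 2); set m := EE P (fun w => `|_|).
pose c := EE P (fun w => u (X 0%N w)).
pose g v := u v - c.
have mg : measurable_fun setT g by apply: measurable_funB => //; exact: measurable_cst.
have Ig : integ P (fun w => g (X 0%N w)) by apply: integB => //; exact: integ_cst.
have Eg : EE P (fun w => g (X 0%N w)) = 0.
  by rewrite EE_B ?EE_cst ?subrr//; exact: integ_cst.
have Ig2' : integ P (fun w => u (X 0%N w) ^+ 2 - (2 * c * u (X 0%N w) - c ^+ 2)).
  apply: integB => //; apply: integB; [exact: integZ|exact: integ_cst].
have g2E w : g (X 0%N w) ^+ 2 = u (X 0%N w) ^+ 2 - (2 * c * u (X 0%N w) - c ^+ 2).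
  by rewrite /g; ring.
have Ig2 : integ P (fun w => g (X 0%N w) ^+ 2) by under eq_fun do rewrite g2E.
have s_le : EE P (fun w => g (X 0%N w) ^+ 2) <= s.
  under eq_EE do rewrite g2E.
  rewrite EE_B//; last by apply: integB; [exact: integZ|exact: integ_cst].
  rewrite EE_B ?EE_cst ?EE_Z//; [|exact: integZ|exact: integ_cst].
  by rewrite -/s -/c; have := sqr_ge0 c; lra.
have Ifu : integ P (fun w => `|f (X 0%N w) - u (X 0%N w)|).
  by apply: integ_norm; exact: integB.
(* Since [f] is centered, the mean of the truncated part is minus that of the remainder. Recentering
   thus costs one more remainder per term, whence the factor 2. *)
have c_le : `|c| <= m.
  have -> : c = EE P (fun w => u (X 0%N w) - f (X 0%N w)) by rewrite EE_B// Ef subr0.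
  apply: le_trans (le_normr_Rintegral _ (integB Iu If)) _ => //.
  by rewrite /m /EE; under eq_Rintegral do rewrite distrC.
pose z v := `|f v - u v| + `|c|.
have mz : measurable_fun setT z.
  apply: measurable_funD; last exact: measurable_cst.
  by apply: measurableT_comp => //; exact: measurable_funB.
have Iz : integ P (fun w => z (X 0%N w)) by apply: integD => //; exact: integ_cst.
have [Iw Ew] := integ_wsum n mz Iz.
have Irf := @integ_runmax f mf If n; have Irg := @integ_runmax g mg Ig n.
split => //.
apply: (@le_trans _ _ (EE P (fun w => runmax (fun i => g (X i w)) n +
    wsum (fun i => z (X i w)) n))).
  apply: le_EE => //; first exact: integD.
  move=> w; apply: runmax_le_add => i; last by rewrite /z addr_ge0.
  rewrite /g /z; have := ler_norm (f (X i w) - u (X i w)); have := ler_norm c; lra.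
rewrite EE_D// Ew; apply: lerD.
  apply: le_trans (EE_runmax_le mg Ig Ig2 Eg n b0) _.
  rewrite lerD2r ler_pM2r ?invr_gt0//; exact: ler_wpM2l.
rewrite [2 * _]mulrC -mulrA ler_wpM2l// EE_D ?EE_cst//; last exact: integ_cst.
by rewrite -/m; lra.
Qed.

(** * Lower bounds on the mean of |S_n| *)

Section khinchine.
Hypotheses (IX : integ P (X 0%N)) (EX : EE P (X 0%N) = 0).

Let S n w := wsum (path_of X w) n.
Let mid : measurable_fun setT (@id R) := @measurable_id _ _ setT.

Lemma integ_S n : integ P (fun w => wsum (path_of X w) n).
Proof. exact: (integ_wsum n mid IX).1. Qed.

Lemma EE_S n : EE P (fun w => wsum (path_of X w) n) = 0.
Proof. by apply: etrans (integ_wsum n mid IX).2 _; rewrite EX mulr0. Qed.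

Lemma integ_mask (A : pred nat) n :
  integ P (fun w => wsum (mask A (path_of X w)) n) /\
  EE P (fun w => wsum (mask A (path_of X w)) n) = 0.
Proof.
have Im i : integ P (fun w => mask A (path_of X w) i) /\
    EE P (fun w => mask A (path_of X w) i) = 0.
  rewrite /mask; case: (A i); last by split; [exact: integ_cst|exact: EE_cst].
  split; first exact: (@integ_coord _ _ _ _ _ iidX i id mid IX).
  by rewrite /path_of (EE_coord iidX i mid).
have [I E] := @integ_sum _ _ _ P (fun i w => mask A (path_of X w) i) 0%N n
  (fun i _ => (Im i).1).
by split => //; rewrite E big1// => i _; rewrite (Im i).2.
Qed.

(* Jensen's inequality for the conditioning on the terms in [A]. *)
Lemma EE_norm_mask (A : pred nat) n :
  EE P (fun w => `|wsum (mask A (path_of X w)) n|) <= EE P (fun w => `|wsum (path_of X w) n|).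
Proof.
pose U w := wsum (mask A (path_of X w)) n.
pose V w := wsum (mask (predC A) (path_of X w)) n.
have [IU _] := integ_mask A n; have [IV EV] := integ_mask (predC A) n.
have SE w : wsum (path_of X w) n = U w + V w.
  rewrite /U /V /wsum -big_split/=; apply: eq_bigr => i _; rewrite /mask /=.
  by case: (A i); rewrite ?addr0 ?add0r.
pose e (u : R) : R := if 0 <= u then 1 else -1.
have me : measurable_fun setT e.
  apply: measurable_fun_ifT; [exact: measurable_fun_ler|exact: measurable_cst..].
have mmask (B : pred nat) : measurable_fun setT (fun x : seqsp R => wsum (mask B x) n).
  apply: measurable_wsum => i; rewrite /mask; case: (B i); first exact: measurable_coord.
  exact: measurable_cst.
have [indX _] := iidX.
have maskK (B : pred nat) x : mask B (mask B x) = mask B x :> (nat -> R).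
  by apply/funext => i; rewrite /mask; case: (B i).
have ind : indep2 P (fun w => e (U w)) V.
  apply: (@indep2_blocks _ _ _ _ X indX A _ _ _ _
    (fun x : seqsp R => e (wsum (mask A x) n)) (fun x => wsum (mask (predC A) x) n)) => //.
  - exact: measurableT_comp.
  - by move=> x; rewrite maskK.
  - by move=> x; rewrite maskK.
have Ie : integ P (fun w => e (U w)).
  apply: (@integ_bounded _ _ _ _ _ 1).
    by apply: measurableT_comp => //; exact: integ_measurable IU.
  by move=> w; rewrite /e; case: ifP; rewrite ?normrN normr1.
have [IeV EeV] := EE_indepM ind Ie IV.
have -> : EE P (fun w => `|U w|) = EE P (fun w => `|U w| + e (U w) * V w).
  by rewrite EE_D ?EeV ?EV ?mulr0 ?addr0//; exact: integ_norm.
apply: le_EE.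
- by apply: integD => //; exact: integ_norm.
- by apply: integ_norm; exact: integ_S.
- move=> w; rewrite SE /e; case: ifP => u0.
    by rewrite ger0_norm// mul1r ler_norm.
  rewrite ltr0_norm ?ltNge ?u0// mulN1r -opprD -normrN; exact: ler_norm.
Qed.

(** The terms from m on with fixed signs; [ravg] averages over the signs of the first m. *)
Let sgsum (del : pred nat) m n (x : nat -> R) : R :=
  \sum_(m <= i < n) (if del i then x i else - x i).

Let msgsum del m n : measurable_fun setT (fun w => sgsum del m n (path_of X w)).
Proof.
apply: (@measurable_sum_nat _ _ _ (fun i w => if del i then path_of X w i else - path_of X w i)).
by move=> i; case: (del i); rewrite /path_of//; exact: measurable_funN.
Qed.

Let EE_norm_sgsum del n :
  EE P (fun w => `|sgsum del 0 n (path_of X w)|) <=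
  2 * EE P (fun w => `|wsum (path_of X w) n|).
Proof.
have E w : sgsum del 0 n (path_of X w) =
    wsum (mask del (path_of X w)) n - wsum (mask (predC del) (path_of X w)) n.
  rewrite /sgsum /wsum -sumrB; apply: eq_bigr => i _; rewrite /mask /=.
  by case: (del i); rewrite ?subr0 ?sub0r.
have [I1 _] := integ_mask del n; have [I2 _] := integ_mask (predC del) n.
under eq_EE do rewrite E.
apply: (@le_trans _ _ (EE P (fun w => `|wsum (mask del (path_of X w)) n| +
    `|wsum (mask (predC del) (path_of X w)) n|))).
  apply: le_EE; [by apply: integ_norm; exact: integB| |by move=> w; exact: ler_normB].
  by apply: integD; exact: integ_norm.
rewrite EE_D; [|exact: integ_norm|exact: integ_norm].
by have := EE_norm_mask del n; have := EE_norm_mask (predC del) n; lra.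
Qed.

Lemma integ_ravg n m del : (m <= n)%N ->
  integ P (fun w => ravg Num.norm (path_of X w) m (sgsum del m n (path_of X w))).
Proof.
move=> mn.
have [I1 _] := integ_wsum n (@normr_measurable R setT) (integ_norm IX).
have [I2 _] := integ_wsum m (@normr_measurable R setT) (integ_norm IX).
apply: le_integ (integD I1 I2) _.
  by apply: measurable_ravg => // i; exact: mX.
move=> w; rewrite ger0_norm ?ravg_norm_ge0//.
apply: le_trans (ravg_norm_le _ _ _) _; rewrite lerD2r.
apply: le_trans (ler_norm_sum _ _ _) _.
rewrite /wsum [leRHS](big_cat_nat (n := m))//= -[leLHS]add0r; apply: lerD.
  by apply: sumr_ge0.
by apply: ler_sum => i _; case: (del i); rewrite ?normrN.
Qed.

(** The increments need not be symmetric, so signs cannot be inserted by equality in law. Instead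
    each fixed sign pattern at most doubles the mean, by splitting the sum into its positive and
    negative signs and applying Jensen to each. *)
Lemma EE_ravg n :
  integ P (fun w => ravg Num.norm (path_of X w) n 0) /\
  EE P (fun w => ravg Num.norm (path_of X w) n 0) <=
    2 * EE P (fun w => `|wsum (path_of X w) n|).
Proof.
have s0 del w : sgsum del n n (path_of X w) = 0 by rewrite /sgsum big_geq.
have key m del : (m <= n)%N ->
    EE P (fun w => ravg Num.norm (path_of X w) m (sgsum del m n (path_of X w))) <=
    2 * EE P (fun w => `|wsum (path_of X w) n|).
  elim: m del => [|m IH] del mn; first exact: EE_norm_sgsum.
  (* [d1] and [d2] fix the sign averaged in the outermost step of [ravg] to plus and to minus. *)
  pose d1 i := if i == m then true else del i.
  pose d2 i := if i == m then false else del i.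
  have e1 w : sgsum del m.+1 n (path_of X w) + path_of X w m = sgsum d1 m n (path_of X w).
    rewrite /sgsum [RHS]big_ltn// /d1 eqxx addrC; congr +%R.
    by apply: eq_big_nat => i im; have -> : (i == m) = false by lia.
  have e2 w : sgsum del m.+1 n (path_of X w) - path_of X w m = sgsum d2 m n (path_of X w).
    rewrite /sgsum [RHS]big_ltn// /d2 eqxx addrC; congr +%R.
    by apply: eq_big_nat => i im; have -> : (i == m) = false by lia.
  have I1 := integ_ravg d1 (ltnW mn); have I2 := integ_ravg d2 (ltnW mn).
  have -> : EE P (fun w => ravg Num.norm (path_of X w) m.+1 (sgsum del m.+1 n (path_of X w))) =
     EE P (fun w => 2^-1 * (ravg Num.norm (path_of X w) m (sgsum d1 m n (path_of X w)) +
       ravg Num.norm (path_of X w) m (sgsum d2 m n (path_of X w)))).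
    by apply: eq_EE => w; rewrite /= e1 e2 mulrC.
  rewrite EE_Z ?EE_D//; last exact: integD.
  by have := IH d1 (ltnW mn); have := IH d2 (ltnW mn); lra.
split; first by have := integ_ravg xpredT (leqnn n); under eq_fun do rewrite s0.
by have := key n xpredT (leqnn n); under eq_EE do rewrite s0.
Qed.

(** [xi] is a bounded minorant of the square, so the sum Q of the [xi (X i)] has mean n v and a
    second moment controlled by [B2], even if X has infinite variance. The factor 1/9 is the 2/9 of
    [ravg_norm_ge_trunc] halved by [EE_ravg]. *)
Lemma EE_norm_S_ge (xi : R -> R) n (B2 tau : R) : 0 < tau ->
  measurable_fun setT xi -> (forall u, 0 <= xi u <= u ^+ 2) ->
  (forall u, xi u <= B2) ->
  let v := EE P (fun w => xi (X 0%N w)) in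
  (n%:R * v / tau - (n%:R * B2 * v + 2 * n%:R ^+ 2 * v ^+ 2) / tau ^+ 3) / 9 <=
    EE P (fun w => `|wsum (path_of X w) n|).
Proof.
move=> t0 mxi xi_sq xiB; lazy zeta; set v := EE P _.
have xi0 u : 0 <= xi u by have /andP[] := xi_sq u.
have Ixi : integ P (fun w => xi (X 0%N w)).
  apply: (@integ_bounded _ _ _ _ _ B2); first exact: measurableT_comp.
  by move=> w; rewrite ger0_norm.
have v0 : 0 <= v by apply: EE_ge0.
pose y w i := xi (X i w).
have [IQ EQ] := integ_wsum n mxi Ixi.
have mxi2 : measurable_fun setT (fun u => xi u ^+ 2) by exact: measurable_funX.
have Ixi2 : integ P (fun w => xi (X 0%N w) ^+ 2).
  apply: le_integ (integZ B2 Ixi) _; first exact: measurableT_comp mxi2 (mX 0%N).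
  by move=> w; rewrite ger0_norm ?sqr_ge0// expr2 ler_wpM2r.
have Exi2 : EE P (fun w => xi (X 0%N w) ^+ 2) <= B2 * v.
  rewrite /v -EE_Z//; apply: le_EE => //; first exact: integZ.
  by move=> w; rewrite expr2 ler_wpM2r.
have [I1 E1] := integ_wsum n mxi2 Ixi2.
have cross i : (i < n)%N -> integ P (fun w => 2 * wsum (y w) i * xi (X i w)) /\
    EE P (fun w => 2 * wsum (y w) i * xi (X i w)) <= 2 * n%:R * v ^+ 2.
  move=> i_n; have [Iw Ew] := integ_wsum i mxi Ixi.
  have [|||I E] := @EE_past_mul xi xi (fun x => 2 * wsum x i) i mxi mxi _ _ _ Ixi.
  - move=> h mh; apply: measurable_funM; first exact: measurable_cst.
    exact: measurable_wsum.
  - by move=> x x' xx'; rewrite (eq_wsum xx').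
  - exact: integZ.
  - split => //; rewrite E EE_Z// Ew -/v mulrA -mulrA -[v * v]expr2.
    by rewrite ler_wpM2r ?sqr_ge0// ler_wpM2l// ler_nat ltnW.
have [I2 E2] := @integ_sum _ _ _ P (fun i w => 2 * wsum (y w) i * xi (X i w)) 0%N n
  (fun i h => (cross i ltac:(lia)).1).
have IQ2 : integ P (fun w => wsum (y w) n ^+ 2).
  by under eq_fun do rewrite wsum_sqr; exact: integD.
have EQ2 : EE P (fun w => wsum (y w) n ^+ 2) <= n%:R * B2 * v + 2 * n%:R ^+ 2 * v ^+ 2.
  under eq_EE do rewrite wsum_sqr.
  rewrite EE_D//; apply: lerD.
    by apply: le_trans (_ : _ <= _) _; [rewrite E1; exact: lexx|rewrite -mulrA ler_wpM2l].
  rewrite E2; apply: (@le_trans _ _ (\sum_(0 <= i < n) 2 * n%:R * v ^+ 2)).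
    by rewrite big_seq_cond [leRHS]big_seq_cond; apply: ler_sum => i;
      rewrite andbT mem_index_iota => /andP[_ h]; exact: (cross i h).2.
  rewrite big_const_nat subn0 iter_addr_0 -mulr_natl le_eqVlt.
  by apply/orP; left; apply/eqP; ring.
have [Ir Er] := EE_ravg n.
have low w : 2 / 9 * (tau^-1 * wsum (y w) n - (tau ^+ 3)^-1 * wsum (y w) n ^+ 2) <=
    ravg Num.norm (path_of X w) n 0.
  rewrite ![_^-1 * _]mulrC; apply: ravg_norm_ge_trunc => //; apply/andP; split.
    by apply: sumr_ge0 => i _; exact: xi0.
  by apply: ler_sum => i _; have /andP[] := xi_sq (X i w).
have Ilow : integ P (fun w => tau^-1 * wsum (y w) n - (tau ^+ 3)^-1 * wsum (y w) n ^+ 2).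
  by apply: integB; exact: integZ.
have := le_EE (integZ (2 / 9) Ilow) Ir low.
rewrite EE_Z// EE_B ?EE_Z//; [|exact: integZ|exact: integZ].
rewrite EQ -/v => h.
have t3 : 0 < (tau ^+ 3)^-1 by rewrite invr_gt0 exprn_gt0.
have := EQ2; rewrite -(ler_pM2l t3) => h2.
move: h h2 Er; rewrite [_ / tau]mulrC [_ / tau ^+ 3]mulrC; lra.
Qed.

End khinchine.

Lemma EE_norm_S_ge_scale (xi : R -> R) n (b c1 c3 : R) :
  integ P (X 0%N) -> EE P (X 0%N) = 0 -> 0 < b -> 0 <= c1 -> 0 <= c3 ->
  measurable_fun setT xi -> (forall u, 0 <= xi u <= u ^+ 2) ->
  (forall u, xi u <= b ^+ 2) ->
  let v := EE P (fun w => xi (X 0%N w)) in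
  c1 * b ^+ 2 <= n%:R * v <= c3 * b ^+ 2 ->
  c1 / (36 * (1 + c3)) * b <= EE P (fun w => `|wsum (path_of X w) n|).
Proof.
move=> IX EX b0 c10 c30 mxi xi_sq xiB v /andP[lo hi].
(* At the scale [lam * b] the negative term takes away at most half of the leading one. The constant
   36 is 2 * 2 * 9. *)
pose lam : R := 2 * (1 + c3).
have lam0 : 0 < lam by rewrite /lam; lra.
have t0 : 0 < lam * b by rewrite mulr_gt0.
apply: le_trans (EE_norm_S_ge IX EX n t0 mxi xi_sq xiB); rewrite -/v.
set q := n%:R * v in lo hi *.
have -> : n%:R * b ^+ 2 * v + 2 * n%:R ^+ 2 * v ^+ 2 = q * (b ^+ 2 + 2 * q).
  by rewrite /q; ring.
have q0 : 0 <= q by apply: le_trans lo; rewrite mulr_ge0 ?sqr_ge0.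
have -> : (q / (lam * b) - q * (b ^+ 2 + 2 * q) / (lam * b) ^+ 3) / 9 =
    q / (lam * b) * ((1 - (b ^+ 2 + 2 * q) / (lam * b) ^+ 2) / 9).
  by field; lra.
have half : 1 / 2 <= 1 - (b ^+ 2 + 2 * q) / (lam * b) ^+ 2.
  have : (b ^+ 2 + 2 * q) / (lam * b) ^+ 2 <= 1 / 2; last lra.
  rewrite ler_pdivrMr ?exprn_gt0// exprMn.
  have e : 2 * (1 + 2 * c3) <= lam ^+ 2 by rewrite /lam; nra.
  have : 2 * (1 + 2 * c3) * b ^+ 2 <= lam ^+ 2 * b ^+ 2 by rewrite ler_wpM2r ?sqr_ge0.
  lra.
apply: (@le_trans _ _ (q / (lam * b) * ((1 / 2) / 9))); last first.
  apply: ler_wpM2l; last lra.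
  by rewrite divr_ge0// ltW.
apply: (@le_trans _ _ (c1 * b ^+ 2 / (lam * b) * ((1 / 2) / 9))); last first.
  by apply: ler_wpM2r; [lra|rewrite ler_pM2r// invr_gt0].
rewrite le_eqVlt; apply/orP; left; apply/eqP; rewrite /lam; field.
by apply/andP; split; lra.
Qed.

End moments.

(** * From convolution bounds to pointwise bounds *)

Section convolution_asymptotics.
Variables (R : realType) (g : R) (F p : nat -> R) (c1 c2 c5 : R).
Hypotheses (g0 : 0 < g) (g2 : g <= 1 / 2).
Let u (n : nat) : R := n%:R `^ (- g).
Hypotheses (F0 : forall n, 0 <= F n).
Hypothesis F_mono : forall m n, (m <= n)%N -> F n <= F m.
Hypotheses (c1_gt0 : 0 < c1) (c5_gt0 : 0 < c5).
Hypothesis conv : forall n, (1 <= n)%N ->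
  c1 * (n%:R * u n ^+ 2) <= \sum_(1 <= k < n.+1) F (n - k)%N * F k.-1
    <= c2 * (n%:R * u n ^+ 2).
Hypothesis pF : forall n, c5 * F n <= p n.+1 <= F n.+1.

Let u_gt0 n : (0 < n)%N -> 0 < u n.
Proof. by move=> n0; rewrite powR_gt0// ltr0n. Qed.

Let u_mono m n : (0 < m <= n)%N -> u n <= u m.
Proof.
move=> /andP[m0 mn]; rewrite /u !powRN lef_pV2 ?posrE ?powR_gt0 ?ltr0n//; last lia.
by apply: ge0_ler_powR; rewrite ?(ltW g0) ?nnegrE ?ler0n ?ler_nat.
Qed.

(** The exponent 1/2 - g is nonnegative. Hence sums of [u] are dominated by sums of inverse square
    roots, for every g at once. *)
Let u_sqrt m n : (0 < m <= n)%N -> u m * Num.sqrt m%:R <= u n * Num.sqrt n%:R.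
Proof.
move=> /andP[m0 mn].
have E k : (0 < k)%N -> u k * Num.sqrt k%:R = k%:R `^ (1 / 2 - g).
  move=> k0; rewrite -powR12_sqrt ?ler0n// -powRD; first by congr powR; lra.
  by apply/implyP => _; rewrite pnatr_eq0; lia.
rewrite !E//; last lia.
by apply: ge0_ler_powR; rewrite ?nnegrE ?ler0n ?ler_nat// subr_ge0.
Qed.

Let sum_inv_sqrt n : \sum_(0 <= i < n) (Num.sqrt i.+1%:R)^-1 <= 2 * Num.sqrt n%:R :> R.
Proof.
elim: n => [|n IH]; first by rewrite big_geq// sqrtr0 mulr0.
rewrite big_nat_recr//=.
set a := Num.sqrt n%:R in IH *; set b := Num.sqrt n.+1%:R.
have b0 : 0 < b by rewrite sqrtr_gt0 ltr0n.
have a0 : 0 <= a by exact: sqrtr_ge0.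
have e : b ^+ 2 = a ^+ 2 + 1 by rewrite !sqr_sqrtr ?ler0n// natr1.
have : b^-1 <= 2 * b - 2 * a; last lra.
rewrite -[b^-1]mul1r ler_pdivrMr//.
by have := sqr_ge0 (b - a); nra.
Qed.

Let C := Num.sqrt c2.

Let c2_gt0 : 0 < c2.
Proof.
have /andP[h1 h2] := conv (leqnn 1).
have a : 0 < 1%:R * u 1 ^+ 2 by rewrite mulr_gt0// exprn_gt0// u_gt0.
have : 0 < c2 * (1%:R * u 1 ^+ 2).
  by apply: lt_le_trans (le_trans h1 h2); rewrite mulr_gt0.
by rewrite pmulr_lgt0.
Qed.

Let C_gt0 : 0 < C. Proof. by rewrite sqrtr_gt0. Qed.

(** The convolution of order n+1 has n+1 terms, each at least F(n)^2 by monotonicity. *)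
Lemma conv_upper n : F n <= C * u n.+1.
Proof.
have /andP[_ h] := @conv n.+1 isT.
have un := @u_gt0 n.+1 isT.
have low : n.+1%:R * F n ^+ 2 <= \sum_(1 <= k < n.+2) F (n.+1 - k)%N * F k.-1.
  apply: (@le_trans _ _ (\sum_(1 <= k < n.+2) F n ^+ 2)).
    by rewrite big_const_nat subn1 iter_addr_0 mulr_natl.
  apply: ler_sum_nat => k kn; rewrite expr2.
  by apply: ler_pM => //; apply: F_mono; lia.
have : F n ^+ 2 <= (C * u n.+1) ^+ 2.
  have n0 : 0 < n.+1%:R :> R by rewrite ltr0n.
  rewrite exprMn sqr_sqrtr; last exact: ltW.
  rewrite -(ler_pM2l n0); apply: le_trans low (le_trans h _).
  by rewrite mulrCA.
by rewrite ler_pXn2r// nnegrE// mulr_ge0// ltW.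
Qed.

Lemma conv_sum n : \sum_(0 <= i < n.+1) F i <= 2 * C * (n.+1%:R * u n.+1).
Proof.
have un := @u_gt0 n.+1 isT.
have sn : 0 < Num.sqrt n.+1%:R :> R by rewrite sqrtr_gt0 ltr0n.
apply: (@le_trans _ _ (\sum_(0 <= i < n.+1)
    C * (u n.+1 * Num.sqrt n.+1%:R) * (Num.sqrt i.+1%:R)^-1)).
  apply: ler_sum_nat => i /andP[_ ni]; apply: le_trans (conv_upper i) _.
  rewrite -mulrA ler_pM2l// ler_pdivlMr ?sqrtr_gt0 ?ltr0n//.
  by apply: u_sqrt; lia.
rewrite -mulr_sumr.
have := sum_inv_sqrt n.+1.
have Cu : 0 <= C * (u n.+1 * Num.sqrt n.+1%:R) by rewrite !mulr_ge0// ltW.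
move=> /(ler_wpM2l Cu) h; apply: le_trans h _.
have e : Num.sqrt n.+1%:R ^+ 2 = n.+1%:R :> R by rewrite sqr_sqrtr ?ler0n.
have -> : 2 * C * (n.+1%:R * u n.+1) = 2 * C * (Num.sqrt n.+1%:R ^+ 2 * u n.+1).
  by rewrite e.
by rewrite le_eqVlt; apply/orP; left; apply/eqP; ring.
Qed.

(** In the convolution of order 2n+1 the two indices of each product add up to 2n, so one of them is
    at least n. The whole is at most 2 F(n) times a partial sum of F, which [conv_sum] bounds. *)
Lemma conv_lower n : c1 / (16 * C) * u n.+1 <= F n.
Proof.
have un := @u_gt0 n.+1 isT.
pose N := (n + n).+1.
have /andP[h _] := @conv N isT.
have up : \sum_(1 <= k < N.+1) F (N - k)%N * F k.-1 <=
    F n * (2 * \sum_(0 <= i < n.+1) F i).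
  rewrite (big_cat_nat (n := n.+2))/=; [|lia|rewrite /N; lia].
  rewrite mulr_natl mulrDr; apply: lerD.
    rewrite big_add1 mulr_sumr /=; apply: ler_sum_nat => k kn.
    by apply: ler_wpM2r => //; apply: F_mono; rewrite /N; lia.
  rewrite big_nat_rev /= -{1}[n.+2]add0n big_addn.
  have -> : (N.+1 - n.+2 = n)%N by rewrite /N; lia.
  (* The right half of the convolution has n terms against n+1 in the partial sum; the surplus one
     is nonnegative. *)
  rewrite big_nat_recr//= mulrDr -[leLHS]addr0; apply: lerD; last exact: mulr_ge0.
  rewrite mulr_sumr; apply: ler_sum_nat => k kn; rewrite mulrC.
  have -> : (N - (n.+2 + N.+1 - (k + n.+2).+1) = k)%N by rewrite /N; lia.
  by apply: ler_wpM2r => //; apply: F_mono; rewrite /N; lia.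
have uN : u n.+1 / 2 <= u N.
  apply: (@le_trans _ _ (u (n.+1 * 2)%N)); last by apply: u_mono; rewrite /N; lia.
  rewrite /u natrM powRM ?ler0n// ler_pM2l//.
  rewrite -[leLHS](@powR_inv1 _ 2)//.
  apply: ler_powR; first lra.
  by rewrite lerN2; apply: le_trans g2 _; lra.
have h2 : c1 * (n.+1%:R * (u n.+1 / 2) ^+ 2) <= F n * (2 * (2 * C * (n.+1%:R * u n.+1))).
  apply: le_trans (_ : _ <= c1 * (N%:R * u N ^+ 2)) _.
    rewrite ler_pM2l//; apply: ler_pM => //.
    - by rewrite exprn_ge0// divr_ge0// ltW.
    - by rewrite ler_nat ltnS leq_addr.
    - by apply: lerXn2r => //; rewrite nnegrE ?divr_ge0// ltW// u_gt0.
  apply: le_trans h (le_trans up _); rewrite ler_wpM2l// ler_wpM2l//.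
  exact: conv_sum.
have n0 : 0 < n.+1%:R :> R by rewrite ltr0n.
have k0 : 0 < 4 * C * (n.+1%:R * u n.+1) by rewrite !mulr_gt0.
rewrite -(ler_pM2r k0); apply: le_trans (_ : _ <= c1 * (n.+1%:R * (u n.+1 / 2) ^+ 2)) _.
  rewrite le_eqVlt; apply/orP; left; apply/eqP; field.
  by rewrite gt_eqF.
by apply: le_trans h2 _; rewrite le_eqVlt; apply/orP; left; apply/eqP; ring.
Qed.

Lemma conv_asymp : asymp_equiv p (fun n => n%:R `^ (- g)).
Proof.
have c0 : 0 < c5 * (c1 / (16 * C)) by rewrite mulr_gt0// divr_gt0// mulr_gt0.
have key n : (1 <= n)%N -> c5 * (c1 / (16 * C)) * u n <= p n <= C * u n.
  case: n => // n _; have /andP[lo hi] := pF n; apply/andP; split.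
    by apply: le_trans lo; rewrite -mulrA ler_pM2l// conv_lower.
  apply: le_trans hi (le_trans _ (conv_upper n)); exact: F_mono.
exists (c5 * (c1 / (16 * C))), C; split => //.
have /andP[h1 h2] := key 1%N isT.
by have := le_trans h1 h2; rewrite ler_pM2r// u_gt0.
Qed.

End convolution_asymptotics.

(** * Persistence from the orders of E|S_n| and of the mean maxima *)

Section walk_asymptotics.
Context d (T : measurableType d) (R : realType) (P : probability T R).
Variable X : nat -> {RV P >-> R}.
Hypotheses (iidX : iid X) (IX : integ P (X 0%N)) (EX : EE P (X 0%N) = 0).
Hypothesis nondeg : 0 < EE P (fun w => `|X 0%N w|).

Let mX i : measurable_fun setT (X i).
Proof. exact: measurable_funP. Qed.

Let EE_pos : EE P (fun w => Num.max 0 (X 0%N w)) = EE P (fun w => `|X 0%N w|) / 2.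
Proof. by have [] := EE_parts IX EX. Qed.

Let EE_neg : EE P (fun w => Num.max 0 (- X 0%N w)) = EE P (fun w => `|X 0%N w|) / 2.
Proof. by have [] := EE_parts IX EX. Qed.

(** Otherwise X would be negative almost surely, and its positive part, which carries half of E|X|,
    would vanish. *)
Lemma ltail_lt1 t : 0 < t -> ltail (X 0%N) t < 1.
Proof.
move=> t0; rewrite ltNge; apply/negP => G1.
have I1 : integ P (fun w => Num.max 0 (X 0%N w)) by exact: integ_max0.
have : EE P (fun w => Num.max 0 (X 0%N w)) = 0; last first.
  by rewrite EE_pos => h; move: nondeg; rewrite (_ : EE P _ = 0) ?ltxx//; lra.
apply: ge0_EE_null => //; first by move=> w; rewrite le_max lexx.
apply/le_anti; rewrite fine_ge0// andbT.
have mb1 : measurable_fun setT (fun w => 0 < Num.max 0 (X 0%N w)).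
  by apply: measurable_fun_ltr => //; exact: measurable_maxr.
have mb2 : measurable_fun setT (fun w => t < - X 0%N w).
  by apply: measurable_fun_ltr; [exact: measurable_cst|exact: measurable_funN].
rewrite -EE_bool//; move: G1; rewrite /ltail -EE_bool// => G1.
have : EE P (fun w => (0 < Num.max 0 (X 0%N w))%R%:R + (t < - X 0%N w)%R%:R) <= 1.
  rewrite -[leRHS](EE_cst P 1); apply: le_EE; [|exact: integ_cst|].
    by apply: integD; exact: integ_bool.
  move=> w; case: (ltP t) => h1; last by rewrite addr0; case: (_ < _).
  by rewrite lt_max ltxx /=; case: (ltP 0) => h2; rewrite ?add0r//; lra.
rewrite EE_D; [|exact: integ_bool|exact: integ_bool]; lra.
Qed.

Lemma prob_neg_gt0 : 0 < fine (P [set w | 0 < - X 0%N w]).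
Proof.
rewrite lt_neqAle fine_ge0// andbT eq_sym; apply/eqP => e0.
have I1 : integ P (fun w => Num.max 0 (- X 0%N w)) by apply: integ_max0; exact: integN.
have : EE P (fun w => Num.max 0 (- X 0%N w)) = 0; last first.
  by rewrite EE_neg => h; move: nondeg; rewrite (_ : EE P _ = 0) ?ltxx//; lra.
apply: ge0_EE_null => //; first by move=> w; rewrite le_max lexx.
rewrite -[RHS]e0; congr (fine (P _)); apply/seteqP; split=> w /=;
  by rewrite lt_max ltxx.
Qed.

Variables (r theta K L : R).
Hypotheses (r0 : 0 < r) (theta_r : 1 / r < theta).
Hypothesis tail_submul : forall t s : R, 0 < t -> 0 < s ->
      ltail (X 0%N) (t + s) <=
        K * ltail (X 0%N) t * ltail (X 0%N) s
        + L * ltail (X 0%N) r `^ (theta * (t + s)).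
Variables (g cl cu : R).
Hypotheses (g0 : 0 < g) (g2 : g <= 1 / 2) (cl0 : 0 < cl).
Hypothesis S_lower : forall n, (1 <= n)%N ->
  cl * (n%:R * (n%:R `^ (- g)) ^+ 2) <= EE P (fun w => `|wsum (path_of X w) n|).
Hypothesis max_upper : forall n, (1 <= n)%N ->
  integ P (fun w => runmax (path_of X w) n) /\
  integ P (fun w => runmax (fun i => - path_of X w i) n) /\
  EE P (fun w => runmax (path_of X w) n) +
  EE P (fun w => runmax (fun i => - path_of X w i) n) <=
    cu * (n%:R * (n%:R `^ (- g)) ^+ 2).

Let gaps n : integ P (fun w => \sum_(1 <= k < n.+1) gap (path_of X w) n k) /\
  EE P (fun w => \sum_(1 <= k < n.+1) gap (path_of X w) n k) =
  \sum_(1 <= k < n.+1) EE P (fun w => gap (path_of X w) n k).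
Proof.
by apply: (@integ_sum _ _ _ P (fun k w => gap (path_of X w) n k)) => k _; exact: integ_gap.
Qed.

(** The difference of the extreme slopes, [x 0 - wsum x n.+1], is minus a sum of n increments. Its
    positive part has mean E|S_n| / 2 because S_n is centered. *)
Let gaps_lower n : EE P (fun w => `|wsum (path_of X w) n|) / 2 <=
  \sum_(1 <= k < n.+1) EE P (fun w => gap (path_of X w) n k).
Proof.
have [Ig Eg] := gaps n; rewrite -Eg.
have [<- _] := EE_parts (integ_S iidX IX n) (EE_S iidX IX EX n).
pose f (s : R) : R := Num.max 0 (- s).
have mf : measurable_fun setT f by apply: measurable_maxr => //; exact: measurable_funN.
have mw : measurable_fun setT (fun x : seqsp R => f (wsum x n)).
  by apply: measurableT_comp => //; apply: measurable_wsum => i; exact: measurable_coord.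
rewrite -(EE_relabel iidX succn_inj mw).
have I : integ P (fun w => f (wsum (fun i => X i.+1 w) n)).
  apply: integ_max0; apply: integN.
  apply: (integ_sum (h := fun i w => X i.+1 w) _).1 => i _.
  exact: (@integ_coord _ _ _ _ _ iidX i.+1 id (@measurable_id _ _ setT) IX).
apply: le_EE => // w.
rewrite /f ge_max sumr_ge0 /=; last by move=> k _; exact: gap_ge0.
apply: le_trans (sum_gap_ge (path_of X w) n).
have -> : wsum (path_of X w) n.+1 = path_of X w 0%N + wsum (fun i => X i.+1 w) n.
  by rewrite /wsum big_nat_recl.
lra.
Qed.

(** The range is taken over n+1 steps; n+1 <= 2n brings it back to order n with a factor 2. *)
Let gaps_upper n : (1 <= n)%N ->
  \sum_(1 <= k < n.+1) EE P (fun w => gap (path_of X w) n k) <=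
  2 * cu * (n%:R * (n%:R `^ (- g)) ^+ 2).
Proof.
move=> n1; have nn : (n.+1 <= n + n)%N by rewrite -addn1 leq_add2l.
have [Ig Eg] := gaps n; rewrite -Eg.
have [I1 [I2 h]] := max_upper (isT : (1 <= n.+1)%N).
apply: le_trans (le_EE Ig (integD I1 I2) _) _.
  by move=> w; exact: sum_gap_le_runmax.
rewrite EE_D//; apply: le_trans h _.
have a0 : 0 < n.+1%:R * (n.+1%:R `^ (- g)) ^+ 2 :> R.
  by rewrite mulr_gt0 ?ltr0n// exprn_gt0// powR_gt0 ltr0n.
have cu0 : 0 <= cu.
  have [_ [_ h']] := max_upper (isT : (1 <= n.+1)%N).
  rewrite -(pmulr_lge0 _ a0); apply: le_trans h'; apply: addr_ge0;
    by apply: EE_ge0 => w; exact: runmax_ge0.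
rewrite [2 * cu]mulrC -mulrA ler_wpM2l// mulrA; apply: ler_pM => //.
- by rewrite mulr_natl mulr2n -natrD ler_nat.
- rewrite ler_pXn2r ?nnegrE ?powR_ge0// !powRN lef_pV2 ?posrE ?powR_gt0 ?ltr0n//.
  by apply: ge0_ler_powR; rewrite ?(ltW g0) ?nnegrE ?ler0n ?ler_nat.
Qed.

Lemma persist2_asymp : asymp_equiv (persist2 X) (fun n => n%:R `^ (- g)).
Proof.
have [C [C0 gapC]] := EE_gap_le iidX IX r0 theta_r (ltail_lt1 r0) tail_submul.
pose z := EE P (fun w => Num.max 0 (- X 0%N w)).
have z0 : 0 < z by rewrite /z EE_neg divr_gt0.
apply: (@conv_asymp R g (stay0 X) (persist2 X) (cl / (2 * C)) (2 * cu / z)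
  (fine (P [set w | 0 < - X 0%N w]))) => //.
- by move=> n; exact: stay0_ge0.
- by move=> m n mn; exact: stay0_mono.
- by rewrite divr_gt0// mulr_gt0.
- exact: prob_neg_gt0.
- move=> n n1; apply/andP; split.
    have h1 := S_lower n1.
    have h2 : \sum_(1 <= k < n.+1) EE P (fun w => gap (path_of X w) n k) <=
        C * \sum_(1 <= k < n.+1) stay0 X (n - k) * stay0 X k.-1.
      by rewrite mulr_sumr; apply: ler_sum_nat => k /andP[k1 _]; exact: gapC.
    have h3 := le_trans (gaps_lower n) h2.
    rewrite mulrAC ler_pdivrMr ?mulr_gt0//; lra.
  have h2 : z * \sum_(1 <= k < n.+1) stay0 X (n - k) * stay0 X k.-1 <=
      \sum_(1 <= k < n.+1) EE P (fun w => gap (path_of X w) n k).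
    by rewrite mulr_sumr; apply: ler_sum_nat => k /andP[k1 _]; exact: EE_gap_ge.
  have h3 := le_trans h2 (gaps_upper n1).
  rewrite mulrAC ler_pdivlMr//; lra.
- by move=> n; rewrite persist2_ge// persist2_le.
Qed.

End walk_asymptotics.

Theorem persist2_square_integrable d (T : measurableType d) (R : realType)
    (P : probability T R) (X : nat -> {RV P >-> R}) (r theta K L : R) :
  iid X -> ~ {ae P, forall w, X 0%N w = 0} -> ('E_P[X 0%N] = 0)%E ->
  ('E_P[(fun w => X 0%N w ^+ 2)%R] < +oo)%E -> 0 < r -> 1 / r < theta ->
  (forall t s : R, 0 < t -> 0 < s ->
    ltail (X 0%N) (t + s) <= K * ltail (X 0%N) t * ltail (X 0%N) s
        + L * ltail (X 0%N) r `^ (theta * (t + s))) ->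
  asymp_equiv (persist2 X) (fun n => n%:R `^ (- (1 / 4))).
Proof.
move=> iidX nae EX0 EX2 r0 theta_r tail.
have mX : measurable_fun setT (X 0%N) by exact: measurable_funP.
have mX2 : measurable_fun setT (fun w => X 0%N w ^+ 2) by exact: measurable_funX.
have IX2 : integ P (fun w => X 0%N w ^+ 2).
  apply/integrableP; split; first exact/measurable_EFinP.
  move: EX2; rewrite unlock; under eq_integral do rewrite -(ger0_norm (sqr_ge0 _)).
  by under [X in _ -> (X < _)%E]eq_integral do rewrite abse_EFin.
have IX : integ P (X 0%N).
  apply: le_integ (integD (integ_cst P 1) IX2) _ => // w.
  set x := X 0%N w; have -> : x ^+ 2 = `|x| ^+ 2 by rewrite real_normK// num_real.
  by have := normr_ge0 x; have := sqr_ge0 (`|x| - 1); nra.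
have EX : EE P (X 0%N) = 0 by apply: EE_of_int; move: EX0; rewrite unlock.
clear EX0 EX2.
have nondeg := EE_norm_gt0 IX nae.
(* At the scale b = sqrt n >= 1 this is below b^2, and n v = v b^2 allows [c1 = c3 = v] in
   [EE_norm_S_ge_scale]. *)
pose xi (x : R) : R := Num.min (x ^+ 2) 1.
have mxi : measurable_fun setT xi by apply: measurable_minr => //; exact: measurable_funX.
have xi0 x : 0 <= xi x by rewrite /xi le_min sqr_ge0 ler01.
have Ixi : integ P (fun w => xi (X 0%N w)).
  apply: le_integ IX2 _; first exact: measurableT_comp.
  by move=> w; rewrite ger0_norm// /xi ge_min lexx.
pose v := EE P (fun w => xi (X 0%N w)).
have v0 : 0 < v.
  rewrite /v (_ : EE P _ = EE P (fun w => `|xi (X 0%N w)|)); last first.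
    by apply: eq_EE => w; rewrite ger0_norm.
  apply: EE_norm_gt0 => // ae0; apply: nae; apply: filterS ae0 => w.
  rewrite /xi /Num.min; case: ifP => _ /eqP; last by rewrite oner_eq0.
  by rewrite sqrf_eq0 => /eqP.
have uE n : n%:R * (n%:R `^ (- (1 / 4))) ^+ 2 = Num.sqrt n%:R :> R.
  rewrite -powR12_sqrt ?ler0n//; case: n => [|n].
    by rewrite mul0r powR0// gt_eqF.
  rewrite -powR_mulrn ?powR_ge0// -powRrM -{1}[n.+1%:R]powRr1 ?ler0n// -powRD.
    by congr powR; field.
  by apply/implyP => _; rewrite pnatr_eq0.
pose s2 := EE P (fun w => X 0%N w ^+ 2).
apply: (@persist2_asymp _ _ _ P X iidX IX EX nondeg r theta K L r0 theta_r tail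
  (1 / 4) (v / (36 * (1 + v))) (2 * (2 * s2 + 1 / 2))); rewrite ?divr_gt0 ?mulr_gt0//; try lra.
- move=> n n1; rewrite uE.
  have sn : 1 <= Num.sqrt n%:R :> R by rewrite -{1}sqrtr1 ler_sqrt// ?ler0n// ler1n.
  have sq : Num.sqrt n%:R ^+ 2 = n%:R :> R by rewrite sqr_sqrtr ?ler0n.
  apply: (@EE_norm_S_ge_scale _ _ _ P X iidX xi n _ v v IX EX) => //; try lra.
  + by move=> x; rewrite xi0 /= /xi ge_min lexx.
  + move=> x; rewrite /xi; apply: (@le_trans _ _ 1); first by rewrite ge_min lexx orbT.
    by rewrite sq ler1n.
  + by rewrite -/v sq mulrC lexx.
- move=> n n1; rewrite uE; set b := Num.sqrt n%:R.
  have b0 : 0 < b by rewrite sqrtr_gt0 ltr0n.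
  have nb : n%:R = b ^+ 2 by rewrite sqr_sqrtr ?ler0n.
  have mid := @measurable_id _ R setT.
  (* With a finite variance the truncated variable is X itself, and the remainder vanishes. *)
  have [I1 E1] := EE_runmax_trunc iidX n b0 mid mid IX EX IX IX2.
  have mN : measurable_fun setT (fun x : R => - x) by exact: measurable_funN.
  have IN := integN IX.
  have EN : EE P (fun w => - X 0%N w) = 0 by rewrite EE_N// EX oppr0.
  have IN2 : integ P (fun w => (- X 0%N w) ^+ 2) by under eq_fun do rewrite sqrrN.
  have [I2 E2] := EE_runmax_trunc iidX n b0 mN mN IN EN IN IN2.
  have D0 (f : T -> R) : EE P (fun w => `|f w - f w|) = 0.
    by transitivity (EE P (fun=> 0)); [apply: eq_EE => w; rewrite subrr normr0|exact: EE_cst].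
  split => //; split => //; apply: le_trans (lerD E1 E2) _.
  rewrite (D0 (X 0%N)) (D0 (fun w => - X 0%N w)) !mulr0 !addr0.
  rewrite (_ : EE P (fun w => (- X 0%N w) ^+ 2) = s2); last first.
    by apply: eq_EE => w; rewrite sqrrN.
  rewrite -/s2 nb le_eqVlt; apply/orP; left; apply/eqP; field.
  by rewrite gt_eqF.
Qed.

(** * The heavy-tailed example *)

Section geometric_sequence.
Variable R : realType.

Let D01 : set (measurableTypeR R) := `]0, 1]%classic.
Let mD01 : measurable D01. Proof. exact: measurable_itv. Qed.

Definition unif01 : set (measurableTypeR R) -> \bar R := mrestr lebesgue_measure mD01.

HB.instance Definition _ := Measure.on unif01.

Let unif01_setT : unif01 setT = 1%E.
Proof.
by rewrite /unif01 /mrestr setTI lebesgue_measure_itv /= lte_fin ltr01 oppr0 adde0.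
Qed.

HB.instance Definition _ := Measure_isProbability.Build _ _ R unif01 unif01_setT.

(* The interval ]2^-(k+1), 2^-k] has Lebesgue measure 2^-(k+1), and [renorm]
   maps it affinely onto ]0, 1]; hence [dyadic] and [renorm] are independent
   and [renorm] preserves the uniform law. Off ]0, 1], [dyadic] is 0. *)
Definition dyadic (y : R) : nat := xget 0%N [set k | 0 < 2 ^+ k.+1 * y - 1 <= 1].

Definition renorm (y : R) : R := 2 ^+ (dyadic y).+1 * y - 1.

Let piece k : set (measurableTypeR R) := [set y | 0 < 2 ^+ k.+1 * y - 1 <= 1].

Let pieceE k : piece k = `]2 ^- k.+1, 2 ^- k]%classic.
Proof.
have p0 j : 0 < 2 ^+ j :> R by rewrite exprn_gt0.
apply/seteqP; split=> y; rewrite /piece /= in_itv /= => /andP[h1 h2]; apply/andP; split.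
- by rewrite -[2 ^- _]mul1r ltr_pdivrMr// mulrC; lra.
- by rewrite -[2 ^- _]mul1r ler_pdivlMr// mulrC; rewrite exprS in h2; lra.
- by move: h1; rewrite -[2 ^- _]mul1r ltr_pdivrMr// mulrC; lra.
- by move: h2; rewrite -[2 ^- _]mul1r ler_pdivlMr// mulrC exprS; lra.
Qed.

Let piece_inj y j k : piece j y -> piece k y -> j = k.
Proof.
wlog jk : j k / (j <= k)%N => [wl hj hk|].
  by have [/wl->//|/ltnW/wl->] := leqP j k.
rewrite /piece /= => /andP[h1 h2] /andP[h3 h4]; apply/eqP; rewrite eqn_leq jk /=.
rewrite leqNgt; apply/negP => jk'.
have y0 : 0 < y.
  have : 0 < 2 ^+ j.+1 * y by lra.
  by rewrite pmulr_rgt0// exprn_gt0.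
have : 2 * (2 ^+ j.+1 * y) <= 2 ^+ k.+1 * y.
  rewrite mulrA -exprS ler_pM2r//; apply: ler_weXn2l; [lra|exact: jk'].
lra.
Qed.

Let dyadic_piece y k : piece k y -> dyadic y = k.
Proof.
move=> pk; apply: (@piece_inj y) => //.
exact: (@xgetPex _ 0%N [set k | 0 < 2 ^+ k.+1 * y - 1 <= 1] (ex_intro _ k pk)).
Qed.

Let piece_ex y : D01 y -> piece (dyadic y) y.
Proof.
rewrite /D01 /= in_itv /= => /andP[y0 y1].
suff [k pk] : exists k, piece k y by rewrite (dyadic_piece pk).
have yi0 : 0 <= y^-1 by rewrite invr_ge0 ltW.
have [n ny] : exists n, 1 < 2 ^+ n.+1 * y.
  exists (Num.bound y^-1); have := archi_boundP yi0.
  rewrite -[y^-1]mul1r ltr_pdivrMr// => h; apply: lt_le_trans h _.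
  rewrite ler_pM2r// -natrX ler_nat; apply/ltnW/(leq_trans (ltn_expl _ (ltnSn 1))).
  by rewrite leq_exp2l.
(* The least k with 2^(k+1) y > 1; minimality gives 2^(k+1) y <= 2, with y <= 1 covering k = 0. *)
have [k pk kmin] := find_ex_minn (ex_intro (fun n => 1 < 2 ^+ n.+1 * y) n ny).
exists k; rewrite /piece /=; apply/andP; split; first lra.
case: k pk kmin => [|k] pk kmin; first by rewrite expr1; lra.
have : ~~ (1 < 2 ^+ k.+1 * y) by apply/negP => /kmin; rewrite ltnn.
by rewrite -leNgt [2 ^+ k.+2]exprS; lra.
Qed.

Lemma measurable_dyadic_fiber k : measurable (piece k).
Proof. by rewrite pieceE; exact: measurable_itv. Qed.

Let not_in_pieces (y : R) : (forall k, ~ piece k y) -> dyadic y = 0%N.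
Proof. by move=> h; rewrite /dyadic; apply: xgetPN => k; exact: h. Qed.

Lemma measurable_dyadic : measurable_fun setT (dyadic : measurableTypeR R -> nat).
Proof.
move=> _ A _; rewrite setTI.
(* The points outside all pieces take the default value 0, so they belong to the preimage exactly
   when [A] contains 0. *)
have -> : dyadic @^-1` A = \bigcup_(k in A) piece k `|`
   (if `[< A 0%N >] then ~` (\bigcup_k piece k) else set0).
  apply/seteqP; split=> y /=.
    move=> Ay; have [[k pk]|nk] := pselect (exists k, piece k y).
      by left; exists k => //; rewrite -(dyadic_piece pk).
    right; rewrite asboolT; last first.
      by rewrite -(not_in_pieces (y := y))// => k pk; apply: nk; exists k.
    by move=> [k _ pk]; apply: nk; exists k.
  case=> [[k Ak pk]|]; first by rewrite (dyadic_piece pk).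
  case: asboolP => // A0 np; rewrite not_in_pieces// => k pk; apply: np; exists k => //.
apply: measurableU; first by apply: bigcup_measurable => k _; exact: measurable_dyadic_fiber.
case: asboolP => // _; apply: measurableC; apply: bigcupT_measurable => k.
exact: measurable_dyadic_fiber.
Qed.

Lemma measurable_renorm :
  measurable_fun setT (renorm : measurableTypeR R -> measurableTypeR R).
Proof.
apply: measurable_funB; last exact: measurable_cst.
apply: measurable_funM; last exact: measurable_id.
exact: (measurableT_comp (f := fun k : nat => 2 ^+ k.+1 : R) _ measurable_dyadic).
Qed.

Let lebesgue_oc (a b : R) :
  lebesgue_measure (`]a, b]%classic : set (measurableTypeR R)) = (Num.max 0 (b - a))%:E.
Proof.
rewrite lebesgue_measure_itv /= lte_fin; case: (ltP a b) => ab.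
  by rewrite max_r// subr_ge0 ltW.
by rewrite max_l// subr_le0.
Qed.

Let exp2_gt0 k : 0 < 2 ^+ k :> R. Proof. by rewrite exprn_gt0. Qed.

Let unif01_oc (a b : R) :
  unif01 `]a, b]%classic = (Num.max 0 (Num.min b 1 - Num.max a 0))%:E.
Proof.
rewrite /unif01 /mrestr -lebesgue_oc; congr (lebesgue_measure _).
have E y : (y \in `]Num.max a 0, Num.min b 1]) = (y \in `]a, b]) && (y \in `]0, 1]).
  by rewrite !in_itv /= gt_max le_min andbACA.
by apply/seteqP; split=> y; rewrite /= E => /andP.
Qed.

Lemma unif01_dyadic k : unif01 (dyadic @^-1` [set k]) = (2 ^- k.+1)%:E.
Proof.
rewrite /unif01 /mrestr.
have -> : dyadic @^-1` [set k] `&` D01 = piece k.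
  apply/seteqP; split=> y /=; first by move=> [<- Dy]; exact: piece_ex.
  move=> pk; split; first exact: dyadic_piece.
  move: pk; rewrite pieceE /D01 /= !in_itv /= => /andP[h1 h2]; apply/andP; split.
    by apply: lt_trans h1; rewrite invr_gt0.
  by apply: le_trans h2 _; rewrite invf_le1// exprn_ege1//; lra.
rewrite pieceE lebesgue_oc; congr EFin; rewrite max_r.
  by rewrite exprS; field; rewrite gt_eqF.
by rewrite subr_ge0 lef_pV2 ?posrE// ler_weXn2l//; lra.
Qed.

(** On half-open intervals this is a computation of lengths under an affine map; these intervals
    form a pi-system generating the Borel sets. *)
Lemma unif01_renorm_dyadic k (A : set (measurableTypeR R)) : measurable A ->
  unif01 (renorm @^-1` A `&` dyadic @^-1` [set k]) =
  (unif01 A * unif01 (dyadic @^-1` [set k]))%E.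
Proof.
move=> mA.
have mk : measurable (dyadic @^-1` [set k] : set (measurableTypeR R)).
  by rewrite -[X in measurable X]setTI; exact: measurable_dyadic.
apply: (@prob_pi_ind _ _ _ _ R unif01 unif01 renorm (dyadic @^-1` [set k])
   (@measurable _ (ocitv_type R)) measurable_renorm mk) => //.
  by move=> B C; exact: measurableI.
move=> _ [[a b]] _ <-; rewrite /= unif01_dyadic unif01_oc /unif01 /mrestr.
set lo := Num.max a 0; set hi := Num.min b 1.
have -> : renorm @^-1` `]a, b] `&` dyadic @^-1` [set k] `&` D01 =
    `]2 ^- k.+1 * (lo + 1), 2 ^- k.+1 * (hi + 1)]%classic.
  have E y : (y \in `]2 ^- k.+1 * (lo + 1), 2 ^- k.+1 * (hi + 1)]) =
      (lo < 2 ^+ k.+1 * y - 1) && (2 ^+ k.+1 * y - 1 <= hi).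
    rewrite in_itv /= -!(mulrC (_ + 1)) ltr_pdivrMr// ler_pdivlMr// [y * _]mulrC.
    by congr (_ && _); apply/idP/idP; lra.
  apply/seteqP; split=> y /=.
    move=> [[+ yk] Dy]; have /= pk := piece_ex Dy; rewrite yk in pk.
    rewrite /renorm yk in_itv /= => /andP[h1 h2]; rewrite E /lo /hi gt_max le_min.
    by case/andP: pk => -> ->; rewrite h1 h2.
  rewrite E /lo /hi gt_max le_min => /andP[/andP[h1 h2] /andP[h3 h4]].
  have pk : piece k y by rewrite /piece /= h2 h4.
  have yk := dyadic_piece pk; split; first split => //.
    by rewrite /renorm yk in_itv /= h1 h3.
  move: pk; rewrite pieceE /D01 /= !in_itv /= => /andP[h5 h6]; apply/andP; split.
    by apply: lt_trans h5; rewrite invr_gt0.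
  by apply: le_trans h6 _; rewrite invf_le1// exprn_ege1//; lra.
rewrite lebesgue_oc -EFinM; congr EFin.
have -> : 2 ^- k.+1 * (hi + 1) - 2 ^- k.+1 * (lo + 1) = (hi - lo) * 2 ^- k.+1 by ring.
by rewrite maxr_pMl ?mul0r// invr_ge0 ltW.
Qed.

Lemma unif01_dyadic_renorm (A : set nat) (C : set (measurableTypeR R)) :
  measurable C -> unif01 (dyadic @^-1` A `&` renorm @^-1` C) =
  (unif01 (dyadic @^-1` A) * unif01 C)%E.
Proof.
move=> mC.
have mk k : measurable (dyadic @^-1` [set k] : set (measurableTypeR R)).
  by rewrite -[X in measurable X]setTI; exact: measurable_dyadic.
have mr : measurable (renorm @^-1` C : set (measurableTypeR R)).
  by rewrite -[X in measurable X]setTI; exact: measurable_renorm.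
have disj : trivIset A (fun k => dyadic @^-1` [set k] : set (measurableTypeR R)).
  by move=> i j _ _ [y [/= <- <-]].
have AE : dyadic @^-1` A = \bigcup_(k in A) (dyadic @^-1` [set k]) :> set (measurableTypeR R).
  by apply/seteqP; split=> y /=; [move=> Ay; exists (dyadic y)|move=> [k Ak ->]].
rewrite AE setI_bigcupl [in LHS]measure_bigcup; last 2 first.
- by move=> k _; exact: measurableI.
- by move=> i j Ai Aj [y [[/= <- _] [/= <- _]]].
rewrite [in RHS]measure_bigcup//.
have cE : unif01 C = (fine (unif01 C))%:E by rewrite fineK ?fin_num_measure.
rewrite [RHS]muleC cE -nneseriesZl//.
by apply: eq_eseriesr => k _; rewrite -cE setIC; exact: unif01_renorm_dyadic.
Qed.

Lemma unif01_renorm (C : set (measurableTypeR R)) : measurable C ->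
  unif01 (renorm @^-1` C) = unif01 C.
Proof.
move=> mC; have := unif01_dyadic_renorm setT mC.
by rewrite preimage_setT setTI => ->; rewrite unif01_setT mul1e.
Qed.

Definition digit i (y : R) : nat := dyadic (iter i renorm y).

Lemma measurable_iter_renorm i :
  measurable_fun setT (iter i renorm : measurableTypeR R -> measurableTypeR R).
Proof.
elim: i => [|i IH]; first exact: measurable_id.
exact: (measurableT_comp measurable_renorm IH).
Qed.

Lemma measurable_digit i : measurable_fun setT (digit i : measurableTypeR R -> nat).
Proof. exact: (measurableT_comp measurable_dyadic (measurable_iter_renorm i)). Qed.

Let measurable_digit_pre i (A : set nat) :
  measurable (digit i @^-1` A : set (measurableTypeR R)).
Proof. by rewrite -[X in measurable X]setTI; exact: measurable_digit. Qed.

Lemma digit_law i (A : set nat) : unif01 (digit i @^-1` A) = unif01 (digit 0 @^-1` A).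
Proof.
elim: i => //= i <-; rewrite -[RHS]unif01_renorm; last exact: measurable_digit_pre.
by congr unif01; apply/seteqP; split=> y /=; rewrite /digit -iterSr.
Qed.

(** The first digit is split off: the later digits of y are the digits of [renorm y], which is
    uniform and independent of [dyadic y]. *)
Lemma digits_indep n (A : nat -> set nat) :
  unif01 [set y | forall i, (i < n)%N -> A i (digit i y)] =
  (\prod_(0 <= i < n) unif01 (digit i @^-1` A i))%E.
Proof.
elim: n A => [|n IH] A.
  by rewrite big_geq// -unif01_setT; congr unif01; apply/seteqP; split.
pose C : set (measurableTypeR R) :=
  [set y | forall i, (i < n)%N -> A i.+1 (digit i y)].
have CE : C = \bigcap_i (digit i @^-1` (if (i < n)%N then A i.+1 else setT)).
  apply/seteqP; split=> y /= h i; first by move=> _; case: ifP => // /h.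
  by move=> ni; have := h i I; rewrite /= ni.
have mC : measurable C.
  by rewrite CE; apply: bigcapT_measurable => i; exact: measurable_digit_pre.
have -> : [set y | forall i, (i < n.+1)%N -> A i (digit i y)] =
    dyadic @^-1` A 0%N `&` renorm @^-1` C.
  apply/seteqP; split=> y /=.
    move=> h; split; first exact: (h 0%N).
    by move=> i ni; have := h i.+1 ni; rewrite /digit iterSr.
  by move=> [h0 h] [|i] ni //; have := h i ni; rewrite /digit iterSr.
rewrite unif01_dyadic_renorm// big_nat_recl//; congr (_ * _)%E.
apply: etrans (IH (fun i => A i.+1)) _; apply: eq_bigr => i _.
by rewrite digit_law [RHS]digit_law.
Qed.

Section values.
Variable f : nat -> R.

Definition digit_value i (y : measurableTypeR R) : R := f (digit i y).

Let mf i : measurable_fun setT (digit_value i).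
Proof. exact: (measurableT_comp (f := f) _ (measurable_digit i)). Qed.

HB.instance Definition _ i := isMeasurableFun.Build _ _ _ _ (digit_value i) (mf i).

Definition geoX (i : nat) : {RV unif01 >-> R} := digit_value i.

Lemma iid_geoX : iid geoX.
Proof.
split; last first.
  by move=> i B mB; exact: (digit_law i (f @^-1` B)).
move=> J B uJ mB.
pose n := (\max_(i <- J) i).+1.
pose A i : set nat := if i \in J then f @^-1` B i else setT.
have Jn i : i \in J -> (i < n)%N.
  by move=> iJ; rewrite ltnS; exact: (@leq_bigmax_seq _ _ xpredT id).
transitivity (unif01 [set y | forall i, (i < n)%N -> A i (digit i y)]).
  congr unif01; apply/seteqP; split=> y /= h i.
    by move=> _; rewrite /A; case: ifP => // iJ; exact: h.
  by move=> /= iJ; have := h i (Jn i iJ); rewrite /A iJ.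
rewrite digits_indep.
transitivity (\prod_(0 <= i < n | i \in J) unif01 (geoX i @^-1` B i))%E.
  by rewrite [RHS]big_mkcond; apply: eq_bigr => i _; rewrite /A; case: ifP.
rewrite -big_filter; apply: perm_big; apply: uniq_perm => //.
  by rewrite filter_uniq// iota_uniq.
move=> i; rewrite mem_filter mem_index_iota /=.
by case: (boolP (i \in J)) => // /Jn ->.
Qed.

End values.

Lemma geo_integ (phi : nat -> R) (B : R) : (forall k, 0 <= phi k) ->
  (forall N, \sum_(0 <= k < N) phi k * 2 ^- k.+1 <= B) ->
  integ unif01 (fun y => phi (digit 0 y)) /\
  EE unif01 (fun y => phi (digit 0 y)) <= B.
Proof.
move=> phi0 hB.
have mphi : measurable_fun setT (fun y : measurableTypeR R => phi (digit 0 y)).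
  exact: (measurableT_comp (f := phi) _ (measurable_digit 0)).
apply: ge0_integ => //.
have TE : [set: measurableTypeR R] = \bigcup_k (digit 0 @^-1` [set k]).
  by apply/seteqP; split => // y _; exists (digit 0 y).
rewrite TE ge0_integral_bigcup; last 4 first.
- by move=> k; exact: measurable_digit_pre.
- by apply/measurable_EFinP; exact: measurable_funTS.
- by move=> y _; rewrite lee_fin.
- by move=> i j _ _ [y [/= <- <-]].
apply: lime_le.
  by apply: is_cvg_nneseries => k _ _; apply: integral_ge0 => y _; rewrite lee_fin.
apply: nearW => N.
rewrite (eq_bigr (fun k => (phi k * 2 ^- k.+1)%:E)); last first.
  move=> k _; rewrite (eq_integral (cst (phi k)%:E)); last first.
    by move=> y; rewrite inE /= => <-.
  rewrite integral_cst; last exact: measurable_digit_pre.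
  by rewrite EFinM; congr (_ * _)%E; exact: unif01_dyadic.
by rewrite sumEFin lee_fin.
Qed.

Lemma EE_digit_eq k : EE unif01 (fun y => (digit 0 y == k)%R%:R) = 2 ^- k.+1.
Proof.
rewrite EE_bool; last first.
  exact: (measurableT_comp (f := fun j => j == k) _ (measurable_digit 0)).
have e : [set y | digit 0 y == k] = dyadic @^-1` [set k].
  by apply/seteqP; split=> y /= /eqP.
by apply: etrans (congr1 (fun A => fine (unif01 A)) e) _; rewrite unif01_dyadic.
Qed.

End geometric_sequence.

(** * Moments and persistence of the example *)

Section heavy_tail.
Variables (R : realType) (g : R).
Hypotheses (g0 : 0 < g) (g4 : g < 1 / 4).

Let kap : R := 1 - 2 * g.
Let lam : R := 2 `^ kap.
(** Against the weights 2^-(k+1), the values lam^k have first moments of ratio [nu < 1] and second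
    moments of ratio [mu > 1]. The mean is finite and the truncated second moment grows
    geometrically; [mu > 1] is the condition g < 1/4. *)
Let nu := lam / 2.
Let mu := lam ^+ 2 / 2.

Let kap_gt : 1 / 2 < kap. Proof. by rewrite /kap; have := g4; lra. Qed.
Let kap_lt : kap < 1. Proof. by rewrite /kap; have := g0; lra. Qed.

Let lam_gt1 : 1 < lam.
Proof.
have e : 2 `^ 0 = 1 :> R by rewrite powRr0.
by rewrite -[ltLHS]e /lam /powR gt_eqF// ltr_expR ltr_pM2r ?ln_gt0 ?ltr1n//; have := kap_gt; have := kap_lt; lra.
Qed.

Let lam_lt2 : lam < 2.
Proof.
have e : 2 `^ 1 = 2 :> R by rewrite powRr1.
by rewrite -[ltRHS]e /lam /powR gt_eqF// ltr_expR ltr_pM2r ?ln_gt0 ?ltr1n//; have := kap_gt; have := kap_lt; lra.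
Qed.

Let lam_sqr : 2 < lam ^+ 2.
Proof.
have e : 2 `^ 1 = 2 :> R by rewrite powRr1.
rewrite -powR_mulrn ?powR_ge0// -powRrM -[ltLHS]e /powR gt_eqF// ltr_expR.
by rewrite ltr_pM2r ?ln_gt0 ?ltr1n//; have := kap_gt; have := kap_lt; lra.
Qed.

Let nu_gt0 : 0 < nu. Proof. by rewrite /nu; have := lam_gt1; have := lam_lt2; lra. Qed.
Let nu_lt1 : nu < 1. Proof. by rewrite /nu; have := lam_gt1; have := lam_lt2; lra. Qed.
Let mu_gt1 : 1 < mu. Proof. by rewrite /mu; have := lam_sqr; lra. Qed.

Let lam1_gt0 : 0 < lam. Proof. exact: lt_trans lam_gt1. Qed.

Let lamX k : lam ^+ k = (2 ^+ k) `^ kap.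
Proof.
rewrite -(powR_mulrn k (ltW lam1_gt0)) -(powR_mulrn k (ler0n R 2)) /lam.
exact: powRAC.
Qed.

Let lam_gt0 k : 0 < lam ^+ k. Proof. exact: exprn_gt0. Qed.

Let P0 := @unif01 R.
(** The remainder left by truncation at level M. *)
Let tailv M (k : nat) : R := if (k <= M)%N then 0 else lam ^+ k.

Let tailv_ge0 M k : 0 <= tailv M k.
Proof. by rewrite /tailv; case: ifP => // _; exact: ltW. Qed.

Let scale_nu k : lam ^+ k * 2 ^- k.+1 = nu ^+ k / 2.
Proof. by rewrite /nu expr_div_n exprS; field; rewrite expf_neq0. Qed.

Let EE_tailv M : integ P0 (fun y => tailv M (digit 0 y)) /\
  EE P0 (fun y => tailv M (digit 0 y)) <= nu ^+ M / (1 - nu).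
Proof.
have d0 : 0 < 1 - nu by rewrite subr_gt0.
have nX k : 0 < nu ^+ k by rewrite exprn_gt0.
apply: geo_integ; first exact: tailv_ge0.
move=> N.
have key : (\sum_(0 <= k < N) tailv M k * 2 ^- k.+1) * (1 - nu) <=
    nu ^+ M.+1 - nu ^+ (maxn N M.+1).
  elim: N => [|N IH]; first by rewrite big_geq// mul0r max0n subrr.
  rewrite big_nat_recr//= mulrDl {2}/tailv; case: leqP => NM.
    have e1 : maxn N M.+1 = M.+1 by apply/maxn_idPr; exact: leqW.
    have e2 : maxn N.+1 M.+1 = M.+1 by apply/maxn_idPr.
    by rewrite e2 !mul0r addr0; rewrite e1 in IH.
  have e1 : maxn N M.+1 = N by apply/maxn_idPl.
  have e2 : maxn N.+1 M.+1 = N.+1 by apply/maxn_idPl; exact: leqW.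
  rewrite scale_nu e2; rewrite e1 in IH.
  rewrite [nu ^+ N.+1]exprS.
  have : 0 <= nu ^+ N * (1 - nu) by rewrite mulr_ge0// ltW.
  lra.
rewrite ler_pdivlMr//; apply: le_trans key _.
have h1 := nX (maxn N M.+1).
have : 0 <= nu ^+ M * (1 - nu) by rewrite mulr_ge0// ltW.
by rewrite exprS; lra.
Qed.

(** The value -beta has probability 1/2, whence the factor 2. *)
Let beta := 2 * EE P0 (fun y => tailv 0 (digit 0 y)).

Let beta0 : 0 <= beta.
Proof. by rewrite mulr_ge0// EE_ge0. Qed.

(* Taken with probability 2^-(k+1): the positive tail decays with exponent
   [1 / (1 - 2 * g)], so that sums of [n] copies have order [n ^ (1 - 2 * g)];
   [beta] centers the variable. *)
Definition heavy_value (k : nat) : R := if k == 0%N then - beta else lam ^+ k.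
Local Notation f := heavy_value.

Let f_split k : f k = tailv 0 k - beta * (k == 0%N)%R%:R.
Proof.
rewrite /f /tailv leqn0; case: eqP => _; first by rewrite mulr1 sub0r.
by rewrite mulr0 subr0.
Qed.

Let meq k : measurable_fun setT (fun y : measurableTypeR R => digit 0 y == k).
Proof.
have h : measurable_fun setT (fun j : nat => j == k) by [].
exact: (measurableT_comp h (@measurable_digit R 0)).
Qed.

Definition heavyX : nat -> {RV (@unif01 R) >-> R} := geoX f.

Let X0E y : heavyX 0%N y = f (digit 0 y). Proof. by []. Qed.

Lemma integ_heavyX : integ P0 (heavyX 0%N).
Proof.
have [I _] := EE_tailv 0.
have Ie := integ_bool P0 (meq 0%N).
have := integB I (integZ beta Ie).
by apply: eq_integrable => // y _ /=; rewrite X0E f_split.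
Qed.

Lemma EE_heavyX : EE P0 (heavyX 0%N) = 0.
Proof.
have [I _] := EE_tailv 0.
have Ie := integ_bool P0 (meq 0%N).
transitivity (EE P0 (fun y => tailv 0 (digit 0 y) - beta * (digit 0 y == 0%N)%R%:R)).
  by apply: eq_EE => y; rewrite X0E f_split.
rewrite EE_B ?EE_Z//; last exact: integZ.
by rewrite EE_digit_eq expr1 /beta; field.
Qed.

Let u M (x : R) : R := if x <= lam ^+ M then x else 0.
(** A single atom is enough for the lower bound: among n increments, with n of order 2^M, it occurs
    a number of times whose mean is of order 1, and lam^M is already the order of the sum. *)
Let xi M (x : R) : R := if x == lam ^+ M then (lam ^+ M) ^+ 2 else 0.

Let mu_ M : measurable_fun setT (u M).
Proof.
apply: measurable_fun_ifT; [|exact: measurable_id|exact: measurable_cst].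
by apply: measurable_fun_ler; [exact: measurable_id|exact: measurable_cst].
Qed.

Let mxi M : measurable_fun setT (xi M).
Proof.
apply: measurable_fun_ifT; [|exact: measurable_cst|exact: measurable_cst].
by apply: measurable_fun_eqr => //; exact: measurable_cst.
Qed.

Let u0 M : u M (f 0%N) = - beta.
Proof. by rewrite /u /f /= ifT// (le_trans _ (ltW (lam_gt0 M)))// oppr_le0. Qed.

Let uS M k : u M (f k.+1) = if (k.+1 <= M)%N then lam ^+ k.+1 else 0.
Proof. by rewrite /u /f /= ler_eXn2l. Qed.

Let f_sub_u M k : `|f k - u M (f k)| = tailv M k.
Proof.
case: k => [|k]; first by rewrite u0 /f /= subrr normr0 /tailv.
rewrite uS /tailv /f /=; case: ifP => _; first by rewrite subrr normr0.
by rewrite subr0 ger0_norm ?ltW.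
Qed.

Let EE_u_sqr M : integ P0 (fun y => u M (heavyX 0%N y) ^+ 2) /\
  EE P0 (fun y => u M (heavyX 0%N y) ^+ 2) <= beta ^+ 2 + mu ^+ M.+1 / (mu - 1).
Proof.
have m1 : 0 < mu - 1 by rewrite subr_gt0.
have mX k : 0 < mu ^+ k by rewrite exprn_gt0// (lt_trans _ mu_gt1).
apply: (@geo_integ R (fun k => u M (f k) ^+ 2)) => [k|N]; first exact: sqr_ge0.
have b2 : 0 <= beta ^+ 2 by exact: sqr_ge0.
case: N => [|N]; first by rewrite big_geq// addr_ge0// divr_ge0// ltW.
have key : (\sum_(0 <= k < N.+1) u M (f k) ^+ 2 * 2 ^- k.+1) * (mu - 1) <=
    beta ^+ 2 * (mu - 1) + mu ^+ (minn N.+1 M.+1).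
  elim: N => [|N IH].
    rewrite big_nat1 u0 sqrrN expr1; have := mX (minn 1 M.+1).
    have : 0 <= beta ^+ 2 * (mu - 1) by rewrite mulr_ge0// ltW.
    lra.
  rewrite big_nat_recr//= mulrDl uS; case: (leqP N.+1 M) => NM.
    have e : (lam ^+ N.+1) ^+ 2 * 2 ^- N.+2 = mu ^+ N.+1 / 2.
      by rewrite /mu expr_div_n [2 ^+ N.+2]exprS -!exprM mulnC; field; rewrite expf_neq0.
    have e1 : minn N.+1 M.+1 = N.+1 by apply/minn_idPl; exact: ltnW.
    have e2 : minn N.+2 M.+1 = N.+2 by apply/minn_idPl.
    rewrite e e2; rewrite e1 in IH.
    have : 0 <= mu ^+ N.+1 * (mu - 1) by rewrite mulr_ge0// ltW.
    by rewrite [mu ^+ N.+2]exprS; lra.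
  have e1 : minn N.+1 M.+1 = M.+1 by apply/minn_idPr.
  have e2 : minn N.+2 M.+1 = M.+1 by apply/minn_idPr; exact: leqW.
  by rewrite expr0n /= !mul0r addr0 e2; rewrite e1 in IH.
have : mu ^+ (minn N.+1 M.+1) <= mu ^+ M.+1.
  by apply: ler_weXn2l; [exact: ltW|exact: geq_minr].
move=> h; rewrite -(ler_pM2r m1) mulrDl divfK ?gt_eqF//; lra.
Qed.

Let EE_xi M : (0 < M)%N ->
  EE P0 (fun y => xi M (heavyX 0%N y)) = (lam ^+ M) ^+ 2 * 2 ^- M.+1.
Proof.
move=> M0; rewrite -EE_digit_eq -EE_Z; last exact: integ_bool (meq M).
apply: eq_EE => y; rewrite X0E; case: (digit 0 y) => [|k].
  rewrite /xi /f /= lt_eqF ?(gt_eqF M0) ?mulr0//; last first.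
    by rewrite (le_lt_trans _ (lam_gt0 M))// oppr_le0.
  by case: M M0 => //= *; rewrite mulr0.
rewrite /xi /f /= (inj_eq (@ieexprIn _ lam _ _))//; last by rewrite gt_eqF.
by case: (k.+1 == M); rewrite ?mulr1 ?mulr0.
Qed.

Lemma heavyX_norm : 0 < EE P0 (fun y => `|heavyX 0%N y|).
Proof.
apply: (@lt_le_trans _ _ (lam * 2 ^- 2)).
  by rewrite mulr_gt0// invr_gt0 exprn_gt0.
rewrite -EE_digit_eq -EE_Z; last exact: integ_bool (meq 1%N).
apply: le_EE.
- by apply: integZ; exact: integ_bool (meq 1%N).
- by apply: integ_norm; exact: integ_heavyX.
- move=> y; rewrite X0E; case: (digit 0 y =P 1%N) => [->|_]; last by rewrite mulr0.
  by rewrite mulr1 /f /= expr1 ler_norm.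
Qed.

Lemma ltail_heavyX t : 0 < t ->
  ltail (heavyX 0%N) t = if t < beta then 1 / 2 else 0.
Proof.
move=> t0; rewrite ltail_EE.
transitivity (EE P0 (fun y => (if t < beta then 1 else 0) * (digit 0 y == 0%N)%R%:R)).
  apply: eq_EE => y; rewrite X0E; case: (digit 0 y) => [|k] /=.
    by rewrite /f /= opprK mulr1; case: ifP.
  rewrite mulr0 /f /= ltNge (_ : - lam ^+ k.+1 <= t)//.
  by rewrite (le_trans _ (ltW t0))// oppr_le0 ltW.
rewrite EE_Z; last exact: integ_bool (meq 0%N).
by rewrite EE_digit_eq expr1; case: ifP => _; rewrite ?mul0r// mul1r div1r.
Qed.

Let powR_sqr n : (1 <= n)%N -> n%:R * (n%:R `^ (- g)) ^+ 2 = n%:R `^ kap :> R.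
Proof.
move=> n1; rewrite -powR_mulrn ?powR_ge0// -powRrM -{1}[n%:R]powRr1 ?ler0n// -powRD.
  by congr powR; rewrite /kap; ring.
by apply/implyP => _; rewrite pnatr_eq0 -lt0n.
Qed.

Let scale n : (1 <= n)%N -> exists M, [/\ (0 < M)%N,
  2 ^+ M <= 2 * n%:R :> R, n%:R <= 2 ^+ M :> R & n%:R `^ kap <= lam ^+ M <= 2 * n%:R `^ kap].
Proof.
(* The successor gives n <= 2^M and also M > 0, as required by [EE_xi]: the digit 0 carries -beta,
   not lam^0. *)
move=> n1; exists (trunc_log 2 n).+1.
have kap0 : 0 <= kap by have := kap_gt; lra.
have a1 : 2 ^+ (trunc_log 2 n) <= n%:R :> R by rewrite -natrX ler_nat trunc_logP.
have a2 : n%:R <= 2 ^+ (trunc_log 2 n).+1 :> R.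
  by rewrite -natrX ler_nat ltnW// trunc_log_ltn.
split => //; first by rewrite exprS ler_pM2l.
apply/andP; split.
  by rewrite lamX; apply: ge0_ler_powR; rewrite ?nnegrE ?exprn_ge0.
rewrite exprS; apply: ler_pM => //; try exact: ltW.
by rewrite lamX; apply: ge0_ler_powR; rewrite ?nnegrE ?exprn_ge0.
Qed.

Section law.
Context d (T : measurableType d) (P : probability T R).
Variable Y : nat -> {RV P >-> R}.
Hypotheses (iidY : iid Y) (lawY : same_law (Y 0%N) (heavyX 0%N)).

Let indX := (iid_geoX f).1.
Let XY i : same_law (heavyX i) (Y i).
Proof. by move=> B mB; rewrite (iidY.2 i)// lawY// (iid_geoX f).2. Qed.

Let mH (H : R -> R) : measurable_fun setT H ->
  measurable_fun setT (fun x : seqsp R => H (x 0%N)).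
Proof. by move=> mH; apply: measurableT_comp => //; exact: measurable_coord. Qed.

Let EE_Y (H : R -> R) : measurable_fun setT H ->
  EE P (fun w => H (Y 0%N w)) = EE P0 (fun y => H (heavyX 0%N y)).
Proof. by move=> mHH; have /esym := eq_path_EE indX iidY.1 XY (mH mHH). Qed.

Let integ_Y (H : R -> R) : measurable_fun setT H ->
  integ P0 (fun y => H (heavyX 0%N y)) -> integ P (fun w => H (Y 0%N w)).
Proof. by move=> mHH; exact: (path_integrable indX iidY.1 XY (mH mHH)). Qed.

Let mid : measurable_fun setT (@id R) := @measurable_id _ _ setT.

(** Only moments and tails of one increment are needed, and these are transported from [Y] to
    [heavyX], where they are sums over digits. The common scale is b = lam^M, of order n^(1-2g). *)
Lemma heavy_persist2 : asymp_equiv (persist2 Y) (fun n => n%:R `^ (- g)).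
Proof.
have g0' := g0; have g4' := g4.
have IY : integ P (Y 0%N) by exact: (integ_Y mid integ_heavyX).
have EY : EE P (Y 0%N) = 0 by apply: etrans (EE_Y mid) _; exact: EE_heavyX.
have nY : 0 < EE P (fun w => `|Y 0%N w|).
  by rewrite (EE_Y (@normr_measurable R setT)); exact: heavyX_norm.
have tailY t : 0 < t -> ltail (Y 0%N) t = if t < beta then 1 / 2 else 0.
  move=> t0; rewrite -ltail_heavyX// !ltail_EE.
  apply: (EE_Y (H := fun x => (t < - x)%R%:R)); apply: measurable_bool.
  by apply: measurable_fun_ltr; [exact: measurable_cst|exact: measurable_funN].
(* The three terms of [EE_runmax_trunc] in units of b. In the final constant, one factor 2 counts Y
   and -Y, the other comes from b <= 2 n^(1-2g). *)
pose C := 2 * (beta ^+ 2 + mu / (mu - 1)) + 1 / 2 + 2 / (1 - nu).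
have m1 : 0 < mu - 1 by rewrite subr_gt0.
have n1' : 0 < 1 - nu by rewrite subr_gt0.
have C0 : 0 <= C.
  have h1 : 0 <= mu / (mu - 1) by rewrite divr_ge0// ltW// (lt_trans _ mu_gt1).
  have h2 : 0 <= 2 / (1 - nu) by rewrite divr_ge0// ltW.
  by rewrite /C; have := sqr_ge0 beta; lra.
(* The tail of -Y is 1/2 below [beta] and 0 from there on, so K = 2 and L = 0 satisfy the tail
   condition; r = 1 and theta = 2 meet 1/r < theta. *)
apply: (@persist2_asymp _ _ _ P Y iidY IY EY nY 1 2 2 0 _ _ _ g
  (1 / 4 / (36 * (1 + 1 / 2))) (2 * (2 * C))); rewrite ?mul0r; try lra.
- move=> t s t0 s0; rewrite mul0r addr0 !tailY//; last exact: addr_gt0.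
  case: (ltP (t + s) beta) => h.
    by rewrite !ifT; lra.
  by rewrite mulr_ge0// ?mulr_ge0//; case: ifP; lra.
- by apply: divr_gt0; lra.
- move=> n n1; rewrite powR_sqr//; have [M [M0 h1 h2 /andP[h3 h4]]] := scale n1.
  apply: le_trans (_ : _ <= 1 / 4 / (36 * (1 + 1 / 2)) * lam ^+ M) _.
    by rewrite ler_pM2l//; lra.
  apply: (@EE_norm_S_ge_scale _ _ _ P Y iidY (xi M) n _ (1 / 4) (1 / 2) IY EY) => //; try lra.
  + move=> x; rewrite /xi; case: eqP => [->|_]; first by rewrite sqr_ge0 lexx.
    by rewrite lexx sqr_ge0.
  + by move=> x; rewrite /xi; case: ifP => // _; exact: sqr_ge0.
  + rewrite (EE_Y (mxi M)) EE_xi//.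
    have e2 : 0 < 2 ^+ M :> R by rewrite exprn_gt0.
    have -> : n%:R * ((lam ^+ M) ^+ 2 * 2 ^- M.+1) =
        n%:R / 2 ^+ M * (1 / 2) * (lam ^+ M) ^+ 2.
      by rewrite [2 ^+ M.+1]exprS; field; rewrite gt_eqF.
    rewrite !ler_pM2r ?exprn_gt0//.
    have : n%:R / 2 ^+ M <= 1 :> R by rewrite ler_pdivrMr// mul1r.
    have : 1 / 2 <= n%:R / 2 ^+ M :> R by rewrite ler_pdivlMr//; lra.
    lra.
- move=> n n1; rewrite powR_sqr//; have [M [M0 h1 h2 /andP[h3 h4]]] := scale n1.
  have b0 := lam_gt0 M.
  have [Iu2 Eu2] := EE_u_sqr M.
  have mu2 : measurable_fun setT (fun x : R => u M x ^+ 2) by exact: measurable_funX.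
  have IYu2 := integ_Y mu2 Iu2.
  have IYu : integ P (fun w => u M (Y 0%N w)).
    apply: le_integ (integ_norm IY) _; first exact: measurableT_comp.
    by move=> w; rewrite /u; case: ifP => // _; rewrite normr0.
  pose s2 := EE P (fun w => u M (Y 0%N w) ^+ 2).
  have s2_le : s2 <= beta ^+ 2 + mu ^+ M.+1 / (mu - 1) by rewrite /s2 (EE_Y mu2).
  have mdiff : measurable_fun setT (fun x : R => `|x - u M x|).
    by apply: measurableT_comp => //; exact: measurable_funB.
  pose m := EE P (fun w => `|Y 0%N w - u M (Y 0%N w)|).
  have m_le : m <= nu ^+ M / (1 - nu).
    rewrite /m (EE_Y mdiff); have [_ h] := EE_tailv M.
    by apply: le_trans h; under eq_EE do rewrite X0E f_sub_u.
  have [I1 E1] := EE_runmax_trunc iidY n b0 mid (mu_ M) IY EY IYu IYu2.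
  have mN : measurable_fun setT (fun x : R => - x) by exact: measurable_funN.
  have muN : measurable_fun setT (fun x : R => - u M x) by exact: measurable_funN.
  have EN : EE P (fun w => - Y 0%N w) = 0 by rewrite EE_N// EY oppr0.
  have IN2 : integ P (fun w => (- u M (Y 0%N w)) ^+ 2) by under eq_fun do rewrite sqrrN.
  have [I2 E2] := EE_runmax_trunc iidY n b0 mN muN (integN IY) EN (integN IYu) IN2.
  split => //; split => //; apply: le_trans (lerD E1 E2) _.
  have -> : EE P (fun w => (- u M (Y 0%N w)) ^+ 2) = s2.
    by apply: eq_EE => w; rewrite sqrrN.
  have -> : EE P (fun w => `|- Y 0%N w - - u M (Y 0%N w)|) = m.
    by apply: eq_EE => w; rewrite -opprD normrN.
  rewrite -/s2 -/m; set b := lam ^+ M in b0 h3 h4 *.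
  have e2 : 0 < 2 ^+ M :> R by rewrite exprn_gt0.
  have b2E : b ^+ 2 = 2 ^+ M * mu ^+ M.
    by rewrite /mu expr_div_n /b -!exprM mulnC; field; rewrite gt_eqF.
  have bE : b = 2 ^+ M * nu ^+ M.
    by rewrite /nu expr_div_n /b; field; rewrite gt_eqF.
  (* Lets b^2 absorb the contribution n beta^2 of the lower atom. *)
  have b2_ge : 2 ^+ M <= b ^+ 2.
    by rewrite b2E (ler_peMr (ltW e2))// exprn_ege1// ltW.
  have s2_0 : 0 <= s2 by apply: EE_ge0 => w; exact: sqr_ge0.
  have m_0 : 0 <= m by exact: EE_ge0.
  have ns2 : n%:R * s2 <= b ^+ 2 * (beta ^+ 2 + mu / (mu - 1)).
    apply: le_trans (ler_wpM2r s2_0 h2) _.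
    apply: le_trans (ler_wpM2l (ltW e2) s2_le) _.
    rewrite [mu ^+ M.+1]exprS [mu * mu ^+ M]mulrC -[mu ^+ M * mu / _]mulrA !mulrDr; apply: lerD.
      by rewrite (ler_wpM2r (sqr_ge0 beta) b2_ge).
    by rewrite [leLHS]mulrA b2E.
  have nm : n%:R * m <= b / (1 - nu).
    apply: le_trans (ler_wpM2r m_0 h2) _.
    apply: le_trans (ler_wpM2l (ltW e2) m_le) _.
    by rewrite mulrA -bE.
  have t1 : n%:R * s2 / b <= b * (beta ^+ 2 + mu / (mu - 1)).
    by rewrite ler_pdivrMr// mulrAC -expr2.
  apply: (@le_trans _ _ (2 * C * b)).
    have -> : 2 * n%:R * s2 / b = 2 * (n%:R * s2 / b) by rewrite !mulrA.
    rewrite -[2 * n%:R * m]mulrA /C; move: t1 nm.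
    set z := n%:R * s2 / b; set z' := n%:R * m; set w1 := mu / (mu - 1).
    rewrite [b / _]mulrC; set w2 := (1 - nu)^-1; lra.
  have -> : 2 * (2 * C) * n%:R `^ kap = 2 * C * (2 * n%:R `^ kap) by ring.
  by rewrite ler_wpM2l// mulr_ge0.
Qed.

End law.

Lemma iid_heavyX : iid heavyX. Proof. exact: iid_geoX. Qed.

End heavy_tail.

Theorem mainTheorem2 (R : realType) :
  (forall (d : measure_display) (T : measurableType d) (P : probability T R)
      (X : nat -> {RV P >-> R}) (r theta K L : R),
    iid X ->
    ~ {ae P, forall w, X 0%N w = 0} ->
    ('E_P[X 0%N] = 0)%E ->
    ('E_P[(fun w => X 0%N w ^+ 2)%R] < +oo)%E ->
    0 < r ->
    1 / r < theta ->
    (forall t s : R, 0 < t -> 0 < s ->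
      ltail (X 0%N) (t + s) <=
        K * ltail (X 0%N) t * ltail (X 0%N) s
        + L * ltail (X 0%N) r `^ (theta * (t + s))) ->
    asymp_equiv (persist2 X) (fun n => n%:R `^ (- (1 / 4))))
  /\
  (forall gamma : R, 0 < gamma -> gamma < 1 / 4 ->
    exists (d : measure_display) (T : measurableType d) (P : probability T R)
      (X : nat -> {RV P >-> R}),
      [/\ iid X,
          P.-integrable [set: T] (EFin \o X 0%N),
          ('E_P[X 0%N] = 0)%E &
          forall (d' : measure_display) (T' : measurableType d')
            (P' : probability T' R) (Y : nat -> {RV P' >-> R}),
            iid Y -> same_law (Y 0%N) (X 0%N) ->
            asymp_equiv (persist2 Y) (fun n => n%:R `^ (- gamma))]).
Proof.
split=> [d T P X r theta K L|gamma g0 g4]; first exact: persist2_square_integrable.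
exists _, _, (@unif01 R), (heavyX gamma); split.
- exact: iid_heavyX.
- exact: integ_heavyX.
- by rewrite unlock -EE_EFin ?EE_heavyX//; exact: integ_heavyX.
- by move=> d' T' P' Y iidY lawY; exact: heavy_persist2 lawY.
Qed.
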